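(* Let $(\Xi_1,\Xi_2,d_{1,2},\mathbf{A},\mathbf{L})$ be a joint data space with exponents $(Q,q_1,q_2)$, satisfying the polynomial preservation condition with parameter $c^*>0$. Suppose $\mathbb{X}_2$ has a partition of unity. Let $r,s>0$, let $A\subseteq\mathbb{X}_2$ be compact, let $B^-\subset\mathbb{X}_1$ be a nonempty compact set with $B^-\subseteq\{x_1\in\mathbb{X}_1: d_{1,2}(x_1,\mathbb{X}_2\setminus A)\ge s+r\}$, and let $B=\{x_1\in\mathbb{X}_1: d_1(x_1,B^-)\le s\}$. Let $S>\max(Q,q_1,q_2)+1$ be the fixed integer and $h$ the fixed filter of the context. (a) Let $f\in C(\mathbb{X}_2)$ satisfy $$\sum_{m=0}^\infty 2^{m(Q-q_2)}\|\sigma_{2^{m+1}}(\Xi_2;f)-\sigma_{2^m}(\Xi_2;f)\|_A<\infty .$$ Then the limit $\mathcal{E}(f)=\lim_{n\to\infty}\sigma_n(\Xi_1,\Xi_2;f)$ exists on $B$, and for every integer $n\ge 0$ with $c^*r2^n\ge 1$, $$\|\mathcal{E}(f)-\sigma_{c^*2^n}(\Xi_1,\Xi_2;f)\|_B\lesssim 2^{n(Q-q_2)}\|f-\sigma_{2^n}(\Xi_2;f)\|_A+\|f\|_{\mathbb{X}_2}2^{n(Q-S)}r^{q_2-S}+\sum_{m=n}^\infty 2^{m(Q-q_2)}\|\sigma_{2^{m+1}}(\Xi_2;f)-\sigma_{2^m}(\Xi_2;f)\|_A .$$ In particular, if $\Xi_1$ satisfies the strong product assumption, $\mathbb{X}_1$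 has a partition of unity, and $\alpha>0$ is such that $\alpha\ell_{j,k}\ge\lambda_{1,j}$ for all indices $j,k$, then $\sigma_n(\Xi_1,\Xi_2;f)\in\Pi_{\alpha n}(\Xi_1)$ for all $n>0$. (b) Suppose, in addition to all the hypotheses in (a) (including that $\Xi_1$ satisfies the strong product assumption, $\mathbb{X}_1$ has a partition of unity, and there is $\alpha>0$ with $\alpha\ell_{j,k}\ge\lambda_{1,j}$ for all $j,k$), that $f\in W_\gamma(\Xi_2;A)$ with $Q-q_2<\gamma<S-q_2$ (and $\gamma>0$). Then $\mathcal{E}(f)$ is continuous on $B$, and for every $\phi\in C^\infty(B)$ we have $\phi\,\mathcal{E}(f)\in W_{\gamma-Q+q_2}(\Xi_1)$, where $\phi\,\mathcal{E}(f)$ is understood to be $0$ outside $B$.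
   Context: **Data space.** Let $\mathbb{X}$ be a compact metric measure space with metric $d$ and probability measure $\mu^*$, $\{\lambda_k\}_{k\ge0}$ a non-decreasing sequence of real numbers with $\lambda_0=0$, $\lambda_k\to\infty$, and $\{\phi_k\}_{k\ge0}$ an orthonormal set in $L^2(\mu^* )$ of continuous real-valued functions. Write $\mathbb{B}(x,r)=\{y: d(x,y)\le r\}$. The tuple $\Xi=(\mathbb{X},d,\mu^*,\{\lambda_k\},\{\phi_k\})$ is a (compact) data space if: (1) all balls $\mathbb{B}(x,r)$ are compact; (2) there are $q\ge1$, $\kappa>0$ with $\mu^*(\mathbb{B}(x,r))=\mu^*(\{y:d(x,y)<r\})\le\kappa r^q$ for all $x\in\mathbb{X}$, $r>0$; (3) there are $\kappa_1,\kappa_2>0$ with $\left|\sum_{k=0}^\infty e^{-\lambda_k^2t}\phi_k(x)\phi_k(y)\right|\le\kappa_1t^{-q/2}\exp(-\kappa_2d(x,y)^2/t)$ for all $x,y\in\mathbb{X}$, $0<t\le1$. **Polynomials, operators, smoothness on one data space.** $\Pi_n=\Pi_n(\Xi)=\mathrm{span}\{\phi_k:\lambda_k<n\}$ for $n>0$. $\|f\|_K$ denotes the supremum norm on a set $K$. Fix once and for all a filter $h$: an infinitely differentiable function $h:[0,\infty)\to[0,1]$ with $h(t)=1$ for $0\le t\le1/2$ and $h(t)=0$ for $t\ge1$ (extended evenly to $\mathbb{R}$). With $\hat f(\Xi;k)=\int_{\mathbb{X}}f\phi_k\,d\mu^*$, $$\sigma_n(\Xi;f)=\sum_{k:\lambda_k<n}h(\lambda_k/n)\hat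 f(\Xi;k)\phi_k .$$ $E_n(f)=E_n(\Xi;f)=\min_{P\in\Pi_n}\|f-P\|_{\mathbb{X}}$. For $\gamma>0$, $W_\gamma(\Xi)$ is the space of $f$ with $\lim_{n\to\infty}E_n(f)=0$ and $\|f\|_{\mathbb{X}}+\sup_{n>0}n^\gamma E_n(f)<\infty$. $C^\infty=C^\infty(\Xi)=\bigcap_{\gamma>0}W_\gamma(\Xi)$; $C^\infty(B)$ is the set of $f\in C^\infty$ supported on $B$. For $x_0\in\mathbb{X}$, $W_\gamma(\Xi;x_0)$ consists of the functions $f$ for which there is $r>0$ such that $\phi f\in W_\gamma(\Xi)$ for all $\phi\in C^\infty(\mathbb{B}(x_0,r))$; $W_\gamma(\Xi;A)=\bigcap_{x_0\in A}W_\gamma(\Xi;x_0)$. **Partition of unity.** $\mathbb{X}$ has a partition of unity if for every $r>0$ there is a countable family $\mathcal{F}_r=\{\psi_{k,r}\}$ of $C^\infty$ functions such that: each $\psi_{k,r}$ is supported on $\mathbb{B}(x_k,r)$ for some $x_k\in\mathbb{X}$; $0\le\psi_{k,r}\le1$; for every $x\in\mathbb{X}$ there is a finite subset $\mathcal{F}_r(x)\subseteq\mathcal{F}_r$, of cardinality bounded independently of $x$, with $\sum_{\psi\in\mathcal{F}_r(x)}\psi(y)=1$ for all $y\in\mathbb{B}(x,r)$. **Strong product assumption.** There is $A^*\ge1$ such that for every $n>0$ and $P,Q\in\Pi_n$, $PQ\in\Pi_{A^*n}$. **Joint data space.** Let $\Xi_m=(\mathbb{X}_m,d_m,\mu_m^*,\{\lambda_{m,k}\},\{\phi_{m,k}\})$,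 $m=1,2$, be compact data spaces. A joint distance is a function $d_{1,2}:\mathbb{X}_1\times\mathbb{X}_2\to[0,\infty)$ with $d_{1,2}(x_1,x_2)\le d_1(x_1,x_1')+d_{1,2}(x_1',x_2)$ and $d_{1,2}(x_1,x_2)\le d_{1,2}(x_1,x_2')+d_2(x_2',x_2)$ for all points. Put $\mathbb{B}_{1,2}(x_1,r)=\{z\in\mathbb{X}_2:d_{1,2}(x_1,z)\le r\}$, $\mathbb{B}_{2,1}(x_2,r)=\{z\in\mathbb{X}_1:d_{1,2}(z,x_2)\le r\}$, $d_{1,2}(x_1,A_2)=\inf_{y\in A_2}d_{1,2}(x_1,y)$ for $A_2\subseteq\mathbb{X}_2$ ($=\infty$ if $A_2=\emptyset$). Let $\mathbf{A}=(A_{j,k})_{j,k\ge0}$ and $\mathbf{L}=(\ell_{j,k})_{j,k\ge0}$ be real matrices with all $\ell_{j,k}\ge0$ and $\{(j,k):\ell_{j,k}<u\}$ finite for every $u>0$. The tuple $(\Xi_1,\Xi_2,d_{1,2},\mathbf{A},\mathbf{L})$ is a joint data space with exponents $(Q,q_1,q_2)$, $Q,q_1,q_2>0$, if for some positive constants $c,c_1,c_2,C$ and all $x_1\in\mathbb{X}_1,x_2\in\mathbb{X}_2$: (1) $\mu_1^*(\mathbb{B}_{2,1}(x_2,r))\le Cr^{q_1}$ and $\mu_2^*(\mathbb{B}_{1,2}(x_1,r))\le Cr^{q_2}$ for all $r>0$; (2) $\sum_{j,k:\ell_{j,k}<n}|A_{j,k}\phi_{1,j}(x_1)\phi_{2,k}(x_2)|\le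 Cn^Q$ for all $n>0$; (3) the limit $K_t(x_1,x_2)=\lim_{n\to\infty}\sum_{j,k:\ell_{j,k}<n}e^{-\ell_{j,k}^2t}A_{j,k}\phi_{1,j}(x_1)\phi_{2,k}(x_2)$ exists and $|K_t(x_1,x_2)|\le c_1t^{-c}\exp(-c_2d_{1,2}(x_1,x_2)^2/t)$ for $0<t\le1$. **Joint operators.** For $n>0$, $$\sigma_n(\Xi_1,\Xi_2;f)(x_1)=\sum_{j,k}h(\ell_{j,k}/n)A_{j,k}\hat f(\Xi_2;k)\phi_{1,j}(x_1),\qquad x_1\in\mathbb{X}_1 .$$ **Polynomial preservation condition** with parameter $c^*>0$: for every $n>0$ and $P\in\Pi_n(\Xi_2)$, $\sigma_m(\Xi_1,\Xi_2;P)=\sigma_{c^*n}(\Xi_1,\Xi_2;P)$ for all $m\ge c^*n$. **Constants.** $S$ is a fixed integer with $S>\max(Q,q_1,q_2)+1$. $X\lesssim Y$ means $X\le cY$ with $c>0$ depending only on the joint data space, $c^*$, $h$, $S$ and the smoothness parameters, but not on $n$, $f$ or $r$. *)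

(* Defs.v *)
From HB Require Import structures.
From mathcomp Require Import all_boot all_order all_algebra finmap.
From mathcomp Require Import all_classical all_reals all_analysis.

Set Implicit Arguments.
Unset Strict Implicit.
Unset Printing Implicit Defensive.

Import Order.TTheory GRing.Theory Num.Theory.
Import numFieldNormedType.Exports.

Local Open Scope classical_set_scope.
Local Open Scope ring_scope.

(* The base point is only there because [measurableType]s are pointed; a space
   carrying a probability measure is never empty. *)
#[short(type="pmetricType")]
HB.structure Definition PointedMetric (R : numDomainType) :=
  {T of Metric R T & isPointed T}.

(* The library's [closed_ball] is the closure of the open ball, which may be
   smaller. *)
Definition cball (R : realType) (T : metricType R) (x : T) (r : R) : set T :=
  [set y | mdist x y <= r].

(* The maximum with 0 only matters for the empty set, whose supremum is -oo. *)
Definition supnorm (R : realType) (T : Type) (K : set T) (f : T -> R)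
  : \bar R := maxe 0%E (ereal_sup [set (`|f x|)%:E | x in K]).

Arguments supnorm {R T} K%_classical_set_scope f%_ring_scope.

(* d(x, K) for a distance or a joint distance d; it is +oo if K is empty. *)
Definition dist_to (R : realType) (T U : Type) (d : T -> U -> R) (x : T)
  (K : set U) : \bar R := ereal_inf [set (d x y)%:E | y in K].

Record data_space (R : realType) := DataSpace {
  carrier :> pmetricType R ;
  ds_mu : probability (g_sigma_algebraType (@open carrier)) R ;
  ds_lam : nat -> R ;
  ds_phi : nat -> carrier -> R ;
  ds_compact : compact [set: carrier] ;
  ds_lam0 : ds_lam 0%N = 0 ;
  ds_lam_nd : {homo ds_lam : j k / (j <= k)%N >-> j <= k} ;
  ds_lam_oo : ds_lam k @[k --> \oo] --> +oo ;
  ds_phi_cont : forall k, continuous (ds_phi k) ;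
  ds_phi_orthonormal : forall j k,
    \int[ds_mu]_x (ds_phi j x * ds_phi k x) = (j == k)%:R ;
  ds_ball_compact : forall (x : carrier) (r : R), compact (cball x r) ;
  ds_exponents : exists q kappa kappa1 kappa2 : R,
    [/\ 1 <= q, 0 < kappa, 0 < kappa1 & 0 < kappa2] /\
    (forall (x : carrier) (r : R), 0 < r ->
       ds_mu (cball x r) = ds_mu [set y | mdist x y < r] /\
       (ds_mu (cball x r) <= (kappa * r `^ q)%:E)%E) /\
    (forall (x y : carrier) (t : R), 0 < t -> t <= 1 ->
       let u := series (fun k : nat =>
         expR (- ds_lam k ^+ 2 * t) * ds_phi k x * ds_phi k y) in
       cvg (u @ \oo) /\
       `|lim (u @ \oo)|
         <= kappa1 * t `^ (- q / 2) * expR (- kappa2 * mdist x y ^+ 2 / t))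
}.

Section one_space.
Context {R : realType} (X : data_space R).

Definition diffpoly (n : R) : set (X -> R) :=
  [set P | exists c : nat -> R,
     P = fun x => \sum_(k \in [set k | ds_lam X k < n]) c k * ds_phi k x].

Definition fcoef (f : X -> R) (k : nat) : R :=
  \int[ds_mu X]_x (f x * ds_phi k x).

Definition sigma_op (h : R -> R) (n : R) (f : X -> R) : X -> R :=
  fun x => \sum_(k \in [set k | ds_lam X k < n])
    h (ds_lam X k / n) * fcoef f k * ds_phi k x.

(* The infimum is attained whenever it is finite, [diffpoly n] being
   finite-dimensional. *)
Definition approx_deg (n : R) (f : X -> R) : \bar R :=
  ereal_inf [set supnorm setT (f \- P) | P in diffpoly n].

Definition smooth_class (gamma : R) : set (X -> R) :=
  [set f | approx_deg n f @[n --> +oo%R] --> 0%E /\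
     (supnorm setT f
      + ereal_sup [set (n `^ gamma)%:E * approx_deg n f | n in [set n | (0 < n)%R]]
      < +oo)%E].

Definition Cinfty : set (X -> R) :=
  [set f | forall gamma : R, 0 < gamma -> smooth_class gamma f].

(* Used only for closed B, where vanishing outside B amounts to the closed
   support being contained in B. *)
Definition Cinfty_on (B : set X) : set (X -> R) :=
  [set f | Cinfty f /\ forall x, ~ B x -> f x = 0].

Definition smooth_class_at (gamma : R) (x0 : X) : set (X -> R) :=
  [set f | exists2 r : R, 0 < r &
     forall phi, Cinfty_on (cball x0 r) phi -> smooth_class gamma (phi \* f)].

Definition smooth_class_on (gamma : R) (A : set X) : set (X -> R) :=
  \bigcap_(x0 in A) smooth_class_at gamma x0.

Definition has_partition_of_unity : Prop :=
  forall r : R, 0 < r ->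
  exists (I : set nat) (psi : nat -> X -> R) (ctr : nat -> X) (N : nat),
    (forall k, I k ->
       Cinfty_on (cball (ctr k) r) (psi k) /\
       forall x, 0 <= psi k x <= 1) /\
    (forall x : X, exists J : {fset nat},
       [/\ [set` J] `<=` I, (#|` J| <= N)%N &
           forall y, cball x r y -> \sum_(k <- J) psi k y = 1]).

Definition strong_product : Prop :=
  exists2 As : R, 1 <= As &
    forall (n : R) (P P' : X -> R), 0 < n ->
      diffpoly n P -> diffpoly n P' -> diffpoly (As * n) (P \* P').

End one_space.

(* The even extension to the line is smooth at 0 because h is constant on
   [0, 1/2], so smoothness on the whole line is no extra requirement. *)
Definition lowpass_filter (R : realType) (h : R -> R) : Prop :=
  [/\ (forall (n : nat) (t : R), derivable (derive1n n h) t 1),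
      (forall t, 0 <= h t <= 1),
      (forall t, h (- t) = h t),
      (forall t, 0 <= t <= 2^-1 -> h t = 1) &
      (forall t, 1 <= t -> h t = 0)].

Section two_spaces.
Context {R : realType} (X1 X2 : data_space R).
Implicit Types (A L : nat -> nat -> R).

Definition joint_distance (d12 : X1 -> X2 -> R) : Prop :=
  [/\ (forall x1 x2, 0 <= d12 x1 x2),
      (forall x1 x1' x2, d12 x1 x2 <= mdist x1 x1' + d12 x1' x2) &
      (forall x1 x2 x2', d12 x1 x2 <= d12 x1 x2' + mdist x2' x2)].

Definition joint_data_space (d12 : X1 -> X2 -> R) A L (Q q1 q2 : R) : Prop :=
  [/\ joint_distance d12,
      (forall j k, 0 <= L j k),
      (forall u : R, 0 < u -> finite_set [set p : nat * nat | L p.1 p.2 < u]),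
      [/\ 0 < Q, 0 < q1 & 0 < q2] &
      exists c c1 c2 C : R, [/\ 0 < c, 0 < c1, 0 < c2 & 0 < C] /\
      forall (x1 : X1) (x2 : X2),
      [/\ (forall r : R, 0 < r ->
             (ds_mu X1 [set z | (d12 z x2 <= r)%R] <= (C * r `^ q1)%:E)%E /\
             (ds_mu X2 [set z | (d12 x1 z <= r)%R] <= (C * r `^ q2)%:E)%E),
          (forall n : R, 0 < n ->
             \sum_(p \in [set p : nat * nat | L p.1 p.2 < n])
               `|A p.1 p.2 * ds_phi p.1 x1 * ds_phi p.2 x2| <= C * n `^ Q) &
          (forall t : R, 0 < t -> t <= 1 ->
             let K := fun n : R =>
               \sum_(p \in [set p : nat * nat | L p.1 p.2 < n])
                 expR (- L p.1 p.2 ^+ 2 * t) * A p.1 p.2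
                 * ds_phi p.1 x1 * ds_phi p.2 x2 in
             cvg (K n @[n --> +oo%R]) /\
             `|lim (K n @[n --> +oo%R])|
               <= c1 * t `^ (- c) * expR (- c2 * d12 x1 x2 ^+ 2 / t))]].

(* For n > 0 only the finitely many terms with L j k < n are nonzero. *)
Definition joint_sigma (h : R -> R) A L (n : R) (f : X2 -> R) : X1 -> R :=
  fun x1 => \sum_(p \in [set: nat * nat])
    h (L p.1 p.2 / n) * A p.1 p.2 * fcoef f p.2 * ds_phi p.1 x1.

Definition joint_lift (h : R -> R) A L (f : X2 -> R) : X1 -> R :=
  fun x1 => lim (joint_sigma h A L n f x1 @[n --> +oo%R]).

Definition polynomial_preservation (h : R -> R) A L (cs : R) : Prop :=
  forall (n : R) (P : X2 -> R), 0 < n -> diffpoly n P ->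
    forall m : R, cs * n <= m ->
      joint_sigma h A L m P = joint_sigma h A L (cs * n) P.

End two_spaces.

Arguments diffpoly {R} X n.
Arguments smooth_class {R} X gamma.
Arguments smooth_class_on {R} X gamma A.
Arguments Cinfty_on {R} X B.
Arguments joint_sigma {R} X1 X2 h A L n f.
Arguments joint_lift {R} X1 X2 h A L f.
Arguments polynomial_preservation {R} X1 X2 h A L cs.

(* Main.v *)
(* Both parts rest on localization: for every S the kernel of a filtered sum is at most
   C n^Q max(1, n d)^(-S).  The Gaussian bound on the heat kernel says that the discrete measure
   carried by the eigenvalues nearly annihilates narrow Gaussians.  Polynomials in a Gaussian of
   Chebyshev type turn this into finite propagation speed: the measure annihilates even functions
   of exponential type at most N ~ n d.  By Jackson's theorem the filter is within O(N^-S) of such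
   functions, relative to a power of sinc that compensates the growth of the measure.

   Integrating the kernel bound over dyadic shells, the joint operator sends a function which is at
   most a on A and at most b elsewhere to a function bounded on B by a multiple of
   n^(Q-q2) a + n^(Q-S) r^(q2-S) b.  Polynomial preservation makes the joint operator eventually
   constant on each sigma_(2^m) f, and telescoping over m yields the limit and its error bound.

   For the second part, a partition of unity gives |f - sigma_n f| = O(n^-gamma) on A, and the
   product of an approximant of phi with the joint operator applied to f, which is a diffusion
   polynomial by the product assumption, approximates phi E(f) at the required rate. *)
Require Import Defs.
From mathcomp Require Import all_boot all_order all_algebra finmap.
From mathcomp Require Import all_classical all_reals all_analysis.
From mathcomp Require Import measurable_realfun ring lra zify.

Set Implicit Arguments.
Unset Strict Implicit.
Unset Printing Implicit Defensive.

Import Order.TTheory GRing.Theory Num.Theory.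
Import numFieldNormedType.Exports.

Local Open Scope classical_set_scope.
Local Open Scope ring_scope.

(** The heat kernel hypotheses test the measure carried by the eigenvalues only against Gaussians
    exp(-x^2 t), so every other test function has to be reached through finite combinations of
    these. The obstacle is the size of the coefficients, here bounded by 3^D in degree D. It is
    affordable: the monomials of degree at most m N in exp(-x^2 / (2 m^2)) have times t <= N / (2
    m), where exp(-N^2 / t) is at most exp(-2 m N), and 3 <= exp(3/2). The same gain absorbs any
    power of 1 / t, so the exponent of t in the heat bound leaves no trace in the final estimate.
    The combinations converge to band-limited functions only pointwise, while the total mass of the
    measure may be infinite. The powers of sinc, present before the limit as normalized Chebyshev
    polynomials of the second kind, supply a majorant uniform in m whose tails beat the growth u^Q.
    Constants are fixed before the measure is chosen, since the measure varies with the points and a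
    single kernel bound is wanted. *)

(** * Elementary bounds for sine and cosine *)

Lemma lipschitz_of_derive (R : realType) (f f' : R -> R) (B : R) :
  (forall x : R, is_derive x 1 f (f' x)) -> (forall x, `|f' x| <= B) ->
  forall x y, `|f x - f y| <= B * `|x - y|.
Proof.
move=> df bf.
suff H x y : x <= y -> `|f y - f x| <= B * `|y - x|.
  move=> x y; case/orP: (le_total x y) => xy; last exact: H.
  by rewrite distrC (distrC x); exact: H.
move=> xy.
have cf : {within `[x, y], continuous f}.
  apply: continuous_subspaceT => z; apply: differentiable_continuous.
  by apply/derivable1_diffP; have [] := df z.
have [c _ ->] := MVT_segment xy (fun z _ => df z) cf.
by rewrite normrM ler_wpM2r.
Qed.

Lemma sin_le_id (R : realType) (x : R) : `|sin x| <= `|x|.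
Proof.
have := lipschitz_of_derive (@is_derive_sin R) (@cos_max R) x 0.
by rewrite sin0 !subr0 mul1r.
Qed.

Lemma onemcos (R : realType) (x : R) : 1 - cos x = 2 * sin (x / 2) ^+ 2.
Proof.
rewrite -[in cos x](divfK (_ : 2 != 0) x) // mulr_natr cos_mulr2n sin2cos2.
by ring.
Qed.

Lemma onemcos_le (R : realType) (x : R) : 1 - cos x <= x ^+ 2 / 2.
Proof.
rewrite onemcos.
have := sin_le_id (x / 2).
rewrite -(@ler_pXn2r R 2) ?nnegrE// !real_normK ?num_real// => H.
by rewrite -subr_ge0; move: H; rewrite -subr_ge0; lra.
Qed.

(** Up to pi/4 the derivative is at least cos (pi/4) >= 1/2; beyond, [sin] is at least sin (pi/4) >=
    1/2 >= x/4, because x <= pi/2 < 2. *)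
Lemma sin_ge_quarter (R : realType) (x : R) :
  0 <= x -> x <= pi / 2 -> x / 4 <= sin x.
Proof.
move=> x0 xpi.
have p2 := @pihalf_lt2 R; have p0 := @pihalf_ge1 R.
have q0 : 0 <= cos (pi / 4 : R) by apply: cos_ge0_pihalf; lra.
have sc : sin (pi / 4 : R) = cos (pi / 4).
  have cn0 : cos (pi / 4 : R) != 0.
    by rewrite gt_eqF// cos_gt0_pihalf//; lra.
  by have := @tan_piquarter R; rewrite /tan => /(canRL (divfK cn0)); rewrite mul1r.
have s0 : 1 / 2 <= sin (pi / 4 : R).
  rewrite leNgt; apply/negP => sl.
  by have := cos2Dsin2 (pi / 4 : R); rewrite -sc; move: sl q0; rewrite -sc; nra.
have [xq|xq] := leP x (pi / 4).
- have cs : {within `[0, x], continuous (@sin R)}.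
    by apply: continuous_subspaceT; exact: continuous_sin.
  have [c /[!in_itv]/= /andP[c0 c1]] :=
    MVT_segment x0 (fun z _ => is_derive_sin z) cs.
  rewrite sin0 !subr0 => ->.
  have : 1 / 2 <= cos c.
    rewrite (le_trans s0)// sc.
    have := @ltr_cos R (pi / 4) c; rewrite !in_itv/= => H.
    rewrite leNgt H; [|lra|lra].
    by rewrite -leNgt (le_trans c1).
  by nra.
- have : sin (pi / 4) <= sin x.
    have := @ltr_sin R x (pi / 4); rewrite !in_itv/= => H.
    by rewrite leNgt H; [rewrite -leNgt ltW|lra|lra].
  lra.
Qed.

(** 1 - cos x = 2 sin (x/2)^2, and sin (x/2) >= x/8 for x in [0, pi], whence 32. *)
Lemma sqr_le_onemcos (R : realType) (x : R) :
  `|x| <= pi -> x ^+ 2 <= 32 * (1 - cos x).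
Proof.
move=> xpi; rewrite -cos_norm -normr_id -(real_normK (num_real x)).
rewrite normr_id onemcos; move: (normr_ge0 x) xpi; move: `|x| => y y0 ypi.
by have := @sin_ge_quarter R (y / 2) ltac:(lra) ltac:(lra); nra.
Qed.

(** * Jackson's theorem for trigonometric polynomials *)

Lemma periodicz (U V : zmodType) (f : U -> V) (T : U) :
  periodic f T -> forall (z : int) a, f (a + T *~ z) = f a.
Proof.
move=> fT [n|n] a; first by rewrite -pmulrn periodicn.
by rewrite NegzE -nmulrn -[in RHS](subrK (T *+ n.+1) a) periodicn.
Qed.

Section nodes.
Variable R : realType.
Implicit Types (u v w x : R) (z : int).

Definition node (L : nat) (l : nat) : R := 2 * pi * l%:R / L%:R.

Lemma cosD2pi_int x z : cos (x + 2 * pi * z%:~R) = cos x.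
Proof.
have -> : 2 * pi * z%:~R = (pi *+ 2) *~ z :> R.
  by rewrite -mulrzr mulr2n; ring.
by have /= -> := periodicz (@cosD2pi R) z x.
Qed.

(** Discrete orthogonality. Multiplied by 2 sin b, where b is half the angular step z * 2 pi / L,
    the sum telescopes over a full number of turns; 0 < [|z|] < L keeps sin b away from 0. *)
Lemma sum_cos_node (L : nat) z u : (`|z| < L)%N ->
  \sum_(l < L) cos (z%:~R * (u - node L l)) = (L * (z == 0))%:R.
Proof.
move=> zL; have [->|z0] := eqVneq z 0.
  rewrite muln1 (eq_bigr (fun=> 1)); last by move=> l _; rewrite mul0r cos0.
  by rewrite sumr_const card_ord.
have L0 : L%:R != 0 :> R by rewrite pnatr_eq0; case: L zL.
rewrite muln0; set b := z%:~R * pi / L%:R : R.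
have sb : sin b != 0.
  have zn : 0 < `|z|%:R :> R by rewrite ltr0n absz_gt0.
  have Lp : 0 < L%:R :> R by rewrite lt0r L0 ler0n.
  have : 0 < sin (`|z|%:R * pi / L%:R : R).
    apply: sin_gt0_pi; rewrite divr_gt0 ?mulr_gt0 ?pi_gt0//=.
    by rewrite ltr_pdivrMr// mulrC ltr_pM2l ?pi_gt0// ltr_nat.
  rewrite /b natr_absz; case: (ger0P z) => // _; first by move=> /gt_eqF ->.
  by rewrite mulrNz !mulNr sinN oppr_gt0 => /lt_eqF ->.
apply: (mulfI (mulf_neq0 (_ : 2 != 0) sb)) => //; rewrite mulr0.
pose F (l : nat) := - sin (z%:~R * u + b - 2 * b * l%:R) : R.
rewrite mulr_sumr (eq_bigr (fun l : 'I_L => F l.+1 - F l)); last first.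
  move=> l _; rewrite /F opprK.
  have -> : z%:~R * u + b - 2 * b * l.+1%:R = z%:~R * (u - node L l) - b.
    by rewrite /node /b -natr1; field.
  have -> : z%:~R * u + b - 2 * b * l%:R = z%:~R * (u - node L l) + b.
    by rewrite /node /b; field.
  by rewrite sinB sinD; ring.
rewrite -(big_mkord predT (fun l => F l.+1 - F l)) telescope_sumr//.
rewrite /F mulr0 subr0 opprK.
have -> : z%:~R * u + b - 2 * b * L%:R = z%:~R * u + b + (pi *+ 2) *~ (- z) :> R.
  by rewrite -mulrzr mulrNz mulr2n /b; field.
have /= -> := periodicz (@sinD2pi R) (- z) (z%:~R * u + b).
by rewrite addrC subrr.
Qed.

(* The squared modulus of a trigonometric polynomial whose coefficients form the Perron
   eigenvector of the path: this minimizes the mass of [1 - cos], and convolution at the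
   [L] equispaced nodes is exact, so that no integral is needed. *)
Definition korovkin_coef (m i : nat) : R := sin (pi * i%:R / m.+1%:R).

Definition korovkin (m : nat) (v : R) : R :=
  \sum_(i < m.+2) \sum_(j < m.+2)
    korovkin_coef m i * korovkin_coef m j * cos ((i%:Z - j%:Z)%:~R * v).

Definition korovkin_mass (m : nat) : R := \sum_(i < m.+2) korovkin_coef m i ^+ 2.

Lemma korovkin_ge0 m v : 0 <= korovkin m v.
Proof.
suff -> : korovkin m v =
    (\sum_(i < m.+2) korovkin_coef m i * cos (i%:R * v)) ^+ 2 +
    (\sum_(i < m.+2) korovkin_coef m i * sin (i%:R * v)) ^+ 2.
  by rewrite addr_ge0 ?sqr_ge0.
rewrite !expr2 !mulr_suml -big_split/=; apply: eq_bigr => i _.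
rewrite !mulr_sumr -big_split/=; apply: eq_bigr => j _.
by rewrite rmorphB/= -!pmulrn mulrBl cosB; ring.
Qed.

Lemma korovkin_mass_gt0 m : (0 < m)%N -> 0 < korovkin_mass m.
Proof.
move=> m0; have i1 : (1 < m.+2)%N by [].
rewrite /korovkin_mass (bigD1 (Ordinal i1))//= ltr_pwDl//; last first.
  by apply: sumr_ge0 => i _; exact: sqr_ge0.
rewrite exprn_gt0// sin_gt0_pi// mulr1 divr_gt0 ?pi_gt0//=.
by rewrite ltr_pdivrMr// ltr_pMr ?pi_gt0// ltr1n.
Qed.

Lemma ord_subz_lt (m : nat) (i j : 'I_m.+2) : (`|i%:Z - j%:Z| < m.+2)%N.
Proof. by move: (ltn_ord i) (ltn_ord j); lia. Qed.

Lemma sum_korovkin m L u : (m.+2 < L)%N ->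
  \sum_(l < L) korovkin m (u - node L l) = L%:R * korovkin_mass m.
Proof.
move=> mL; rewrite /korovkin exchange_big/= /korovkin_mass mulr_sumr.
apply: eq_bigr => i _; rewrite exchange_big/= (bigD1 i)//= [X in _ + X]big1 => [|j ji].
  rewrite addr0 -mulr_sumr sum_cos_node; last by have := ord_subz_lt i i; lia.
  by rewrite subrr eqxx muln1 mulrC expr2.
rewrite -mulr_sumr sum_cos_node; last by have := ord_subz_lt i j; lia.
suff -> : (i%:Z - j%:Z == 0) = false by rewrite muln0 mulr0.
by apply/negbTE; rewrite subr_eq0 eqz_nat eq_sym.
Qed.

(** The eigenvector equation (a_(i-1) + a_(i+1)) / 2 = cos (pi / m.+1) a_i, multiplied by a_i: at
    the two ends, where a neighbour is missing, a_i vanishes. *)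
Lemma korovkin_coef_step m i : (i < m.+2)%N ->
  korovkin_coef m i * (\sum_(j < m.+2) korovkin_coef m j *
    (((i%:Z - j%:Z + 1 == 0) + (i%:Z - j%:Z - 1 == 0))%:R / 2))
  = korovkin_coef m i ^+ 2 * cos (pi / m.+1%:R).
Proof.
have m0 : m.+1%:R != 0 :> R by rewrite pnatr_eq0.
have k0 : korovkin_coef m 0 = 0 by rewrite /korovkin_coef mulr0 mul0r sin0.
have kl : korovkin_coef m m.+1 = 0 by rewrite /korovkin_coef mulfK// sinpi.
rewrite leq_eqVlt => /orP[/eqP[->]|]; first by rewrite kl expr2 !mul0r.
rewrite ltnS; case: i => [|i] im; first by rewrite k0 expr2 !mul0r.
rewrite expr2 -mulrA; congr (_ * _).
have ip : (i.+2 < m.+2)%N by [].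
have iq : (i < m.+2)%N by lia.
rewrite (bigD1 (Ordinal ip))//= (bigD1 (Ordinal iq))/=; last first.
  by rewrite -val_eqE/=; lia.
rewrite big1 => [|j /andP[/negPf j1 /negPf j2]]; last first.
  have -> : (i.+1%:Z - j%:Z + 1 == 0) = false.
    by move/negbT: j1; rewrite -val_eqE/=; lia.
  have -> : (i.+1%:Z - j%:Z - 1 == 0) = false.
    by move/negbT: j2; rewrite -val_eqE/=; lia.
  by rewrite mul0r mulr0.
have -> : (i.+1%:Z - i.+2%:Z + 1 == 0) = true by lia.
have -> : (i.+1%:Z - i.+2%:Z - 1 == 0) = false by lia.
have -> : (i.+1%:Z - i%:Z + 1 == 0) = false by lia.
have -> : (i.+1%:Z - i%:Z - 1 == 0) = true by lia.
rewrite /korovkin_coef addr0.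
have -> : pi * i.+2%:R / m.+1%:R = pi * i.+1%:R / m.+1%:R + pi / m.+1%:R :> R.
  by rewrite -[i.+2%:R]natr1; field.
have -> : pi * i%:R / m.+1%:R = pi * i.+1%:R / m.+1%:R - pi / m.+1%:R :> R.
  by rewrite -[i.+1%:R]natr1; field.
by rewrite sinD sinB /=; field.
Qed.

(** With [sum_korovkin], this says that 1 - cos has mean 1 - cos (pi / m.+1) = O(m^-2) under the
    normalized kernel. The product with [cos] raises the frequencies by one, and they still stay
    below [L]. *)
Lemma sum_korovkin_cos m L u : (m.+2 < L)%N ->
  \sum_(l < L) korovkin m (u - node L l) * cos (u - node L l)
  = L%:R * korovkin_mass m * cos (pi / m.+1%:R).
Proof.
move=> mL.
under eq_bigr do rewrite /korovkin mulr_suml.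
rewrite exchange_big/= /korovkin_mass mulr_sumr mulr_suml.
apply: eq_bigr => i _; rewrite -mulrA -korovkin_coef_step//.
under eq_bigr do rewrite mulr_suml.
rewrite exchange_big/= !mulr_sumr; apply: eq_bigr => j _.
have cc x z : cos (z%:~R * x) * cos x =
    (cos ((z + 1)%:~R * x) + cos ((z - 1)%:~R * x)) / 2 :> R.
  have -> : (z + 1)%:~R * x = z%:~R * x + x by rewrite rmorphD/= mulrDl mul1r.
  have -> : (z - 1)%:~R * x = z%:~R * x - x by rewrite rmorphB/= mulrBl mul1r.
  by rewrite cosD cosB; field.
under eq_bigr do rewrite -mulrA cc.
rewrite -mulr_sumr -mulr_suml big_split/= !sum_cos_node; last 2 first.
- by have := ord_subz_lt i j; lia.
- by have := ord_subz_lt i j; lia.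
by rewrite -natrD -mulnDr natrM; ring.
Qed.

Definition trigpoly (D : nat) (g : R -> R) := exists al be : nat -> R,
  forall u, g u = \sum_(j < D) (al j * cos (j%:R * u) + be j * sin (j%:R * u)).

Lemma trigpolyD D g1 g2 : trigpoly D g1 -> trigpoly D g2 -> trigpoly D (g1 \+ g2).
Proof.
move=> [a1 [b1 e1]] [a2 [b2 e2]]; exists (a1 \+ a2), (b1 \+ b2) => u.
by rewrite /= e1 e2 -big_split/=; apply: eq_bigr => j _; ring.
Qed.

Lemma trigpoly_cst D a : (0 < D)%N -> trigpoly D (fun=> a).
Proof.
case: D => // D _; exists (fun j => if j is 0%N then a else 0), (fun=> 0) => u.
rewrite big_ord_recl/= mul0r cos0 sin0 big1 ?mulr0 ?mulr1 ?addr0// => i _.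
by rewrite !mul0r addr0.
Qed.

Lemma trigpolyZ D a g : trigpoly D g -> trigpoly D (fun u => a * g u).
Proof.
move=> [a1 [b1 e1]]; exists (fun j => a * a1 j), (fun j => a * b1 j) => u.
by rewrite /= e1 mulr_sumr; apply: eq_bigr => j _; ring.
Qed.

Lemma trigpoly_sum D (I : Type) (s : seq I) (g : I -> R -> R) :
  (forall i, trigpoly D (g i)) -> trigpoly D (fun u => \sum_(i <- s) g i u).
Proof.
move=> H; elim: s => [|i s IH].
  by exists (fun=> 0), (fun=> 0) => u; rewrite big_nil big1// => j _; ring.
have [a [b e]] := trigpolyD (H i) IH.
by exists a, b => u; rewrite big_cons -e.
Qed.

Lemma trigpoly_cos D z v : (`|z| < D)%N -> trigpoly D (fun u => cos (z%:~R * (u - v))).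
Proof.
move=> zD.
suff H (n : nat) : (n < D)%N -> trigpoly D (fun u => cos (n%:R * (u - v))).
  have := H _ zD; rewrite natr_absz; case: (ger0P z) => // _ [a [b e]].
  by exists a, b => u; rewrite -e mulrNz mulNr cosN.
move=> nD; exists (fun j => (j == n)%:R * cos (n%:R * v)),
  (fun j => (j == n)%:R * sin (n%:R * v)) => u.
rewrite (bigD1 (Ordinal nD))//= big1 => [|j]; last first.
  by rewrite -val_eqE/= => /negPf ->; rewrite mulr0n !mul0r addr0.
by rewrite eqxx mulr1n !mul1r addr0 mulrBr cosB; ring.
Qed.

Lemma trigpoly_korovkin m v : trigpoly m.+2 (fun u => korovkin m (u - v)).
Proof.
rewrite /korovkin; apply: trigpoly_sum => i; apply: trigpoly_sum => j.
by apply/trigpolyZ/trigpoly_cos/ord_subz_lt.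
Qed.

Lemma reduce_2pi x : exists z : int, `|x - 2 * pi * z%:~R| <= pi.
Proof.
have p0 := @pi_gt0 R.
have p2 : 0 < 2 * pi :> R by rewrite mulr_gt0.
exists (Num.floor (x / (2 * pi) + 1 / 2)).
have /andP[] := floor_itv (x / (2 * pi) + 1 / 2).
set z := (Num.floor _)%:~R; rewrite intrD1 -/z => h1 h2.
have e : x = x / (2 * pi) * (2 * pi) by rewrite divfK ?gt_eqF.
by rewrite e ler_norml; apply/andP; split; nra.
Qed.

(** For w = x - y reduced modulo 2 pi, [|w|] <= 1/m.+1 + m.+1 w^2, and w^2 <= 32 (1 - cos w).
    Averaging against the kernel, where 1 - cos has mean at most pi^2 / (2 m.+1^2) <= 8 / m.+1^2,
    gives the constant 257 = 1 + 32 * 8. *)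
Lemma jackson_lipschitz (m : nat) (f : R -> R) (B : R) : (0 < m)%N ->
  (forall x, f (x + 2 * pi) = f x) ->
  (forall x y, `|f x - f y| <= B * `|x - y|) ->
  exists2 g, trigpoly m.+2 g & forall u, `|f u - g u| <= 257 / m.+1%:R * B.
Proof.
move=> m0 fper flip.
have B0 : 0 <= B.
  by have := le_trans (normr_ge0 _) (flip 1 0); rewrite subr0 normr1 mulr1.
have mp : 0 < m.+1%:R :> R by [].
have key x y : `|f x - f y| <= B * (m.+1%:R^-1 + 32 * m.+1%:R * (1 - cos (x - y))).
  have [z zp] := reduce_2pi (x - y).
  have -> : f y = f (y + 2 * pi * z%:~R).
    have := @periodicz _ _ f (2 * pi) fper z y.
    by rewrite -mulrzr => ->.
  rewrite (le_trans (flip _ _))// ler_wpM2l// opprD addrA.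
  rewrite -(cosD2pi_int (x - y) (- z)) mulrNz mulrN.
  have := sqr_le_onemcos zp; move: (x - y - _) => w h.
  have : `|w| <= m.+1%:R^-1 + m.+1%:R * w ^+ 2.
    rewrite -(real_normK (num_real w)); move: (normr_ge0 w); move: `|w| => {h}w w0.
    have [wm|wm] := leP w (m.+1%:R^-1).
      by rewrite (le_trans wm)// lerDl mulr_ge0 ?sqr_ge0.
    rewrite ltW// ltr_wpDl// expr2 mulrA ltr_pMl ?(le_lt_trans _ wm)//.
    by rewrite mulrC -ltr_pdivrMr// div1r.
  by move=> /le_trans; apply; rewrite lerD2l mulrAC mulrC ler_wpM2r.
pose L := (m.+2 + m.+2)%N; have mL : (m.+2 < L)%N by rewrite /L; lia.
have Lp : 0 < L%:R :> R by rewrite ltr0n.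
have M0 := korovkin_mass_gt0 m0.
pose c := (L%:R * korovkin_mass m)^-1.
have c0 : 0 < c by rewrite invr_gt0 mulr_gt0.
have cn0 : L%:R * korovkin_mass m != 0 by rewrite gt_eqF// mulr_gt0.
exists (fun u => c * \sum_(l < L) f (node L l) * korovkin m (u - node L l)).
  apply: trigpolyZ; apply: trigpoly_sum => l; apply: trigpolyZ.
  exact: trigpoly_korovkin.
move=> u.
have -> : f u - c * \sum_(l < L) f (node L l) * korovkin m (u - node L l) =
    c * \sum_(l < L) (f u - f (node L l)) * korovkin m (u - node L l).
  have fu : f u = c * \sum_(l < L) f u * korovkin m (u - node L l).
    by rewrite -mulr_sumr sum_korovkin// mulrCA mulVf// mulr1.
  rewrite {1}fu -mulrBr -sumrB; congr (_ * _); apply: eq_bigr => l _.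
  by rewrite -mulrBl.
rewrite normrM gtr0_norm//.
have H : `|\sum_(l < L) (f u - f (node L l)) * korovkin m (u - node L l)| <=
   \sum_(l < L) B * ((m.+1%:R^-1 + 32 * m.+1%:R) * korovkin m (u - node L l) -
     32 * m.+1%:R * (korovkin m (u - node L l) * cos (u - node L l))).
  rewrite (le_trans (ler_norm_sum _ _ _))//; apply: ler_sum => l _.
  rewrite normrM (ger0_norm (korovkin_ge0 _ _)).
  rewrite (le_trans (ler_wpM2r (korovkin_ge0 _ _) (key _ _)))//.
  by rewrite le_eqVlt; apply/orP; left; apply/eqP; ring.
rewrite (le_trans (ler_wpM2l (ltW c0) H))//.
rewrite -mulr_sumr sumrB -!mulr_sumr sum_korovkin// sum_korovkin_cos//.
have -> : c * (B * ((m.+1%:R^-1 + 32 * m.+1%:R) * (L%:R * korovkin_mass m) -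
   32 * m.+1%:R * (L%:R * korovkin_mass m * cos (pi / m.+1%:R)))) =
   (c * (L%:R * korovkin_mass m)) *
   (B * (m.+1%:R^-1 + 32 * m.+1%:R * (1 - cos (pi / m.+1%:R)))) by ring.
rewrite mulVf// mul1r mulrC ler_wpM2r//.
have h := onemcos_le (pi / m.+1%:R : R).
have -> : 257 / m.+1%:R = m.+1%:R^-1 + 32 * m.+1%:R * (8 / m.+1%:R ^+ 2) :> R.
  by move: (m.+1%:R : R) mp => M /gt_eqF M0'; field; rewrite M0'.
rewrite lerD2l ler_wpM2l ?mulr_ge0// (le_trans h)// expr_div_n mulrAC.
rewrite ler_pM2r ?invr_gt0 ?exprn_gt0//.
by have := @pihalf_lt2 R; have := @pi_gt0 R; nra.
Qed.

End nodes.

Section jackson.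
Variable R : realType.
Implicit Types (u v w x B : R) (f g : R -> R).

(** Derivatives are given by witnesses, each periodic, so that an induction can peel them off one at
    a time; [B] bounds the last one only. *)
Fixpoint periodic_chain (k : nat) (f : R -> R) (B : R) : Prop :=
  (forall x, f (x + 2 * pi) = f x) /\
  match k with
  | 0 => forall x, `|f x| <= B
  | k'.+1 => exists2 f', (forall x : R, is_derive x 1 f (f' x)) & periodic_chain k' f' B
  end.

Lemma trigpoly_primitive D (al be : nat -> R) : (0 < D)%N ->
  exists2 G, trigpoly D G & forall x : R, is_derive x 1 G
    (\sum_(j < D) (al j * cos (j%:R * x) + be j * sin (j%:R * x)) - al 0%N).
Proof.
case: D => // D _.
(* For j = 0 the division by zero returns 0, so the constant mode, which has no periodic primitive,
   drops out. *)
pose F (j : 'I_D.+1) (u : R) :=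
  - be j / j%:R * cos (j%:R * u) + al j / j%:R * sin (j%:R * u).
exists (\sum_(j < D.+1) F j).
  exists (fun j => - be j / j%:R), (fun j => al j / j%:R) => u.
  by rewrite fct_sumE.
move=> x.
have dF (j : 'I_D.+1) : is_derive x 1 (F j)
    (j%:R / j%:R * (al j * cos (j%:R * x) + be j * sin (j%:R * x))).
  have -> : F j = (fun u => - be j / j%:R *: (cos \o ( *%R j%:R)) u +
      (al j / j%:R) *: (sin \o ( *%R j%:R)) u) by [].
  have dl : is_derive x 1 ( *%R (j%:R : R)) (j%:R : R).
    have -> : *%R (j%:R : R) = j%:R *: id by apply/funext => y.
    by apply: is_derive_eq; rewrite -[LHS]/(_ * _) mulr1.
  apply: is_derive_eq.
  by rewrite -![_ *: _]/(_ * _); ring.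
have := is_derive_sum dF.
move=> H; apply: is_derive_eq H _.
rewrite !big_ord_recl/= !mul0r cos0 sin0 mulr0 mulr1 addr0 add0r addrAC.
rewrite subrr add0r; apply: eq_bigr => j _.
by rewrite divff ?mul1r// pnatr_eq0.
Qed.

(* Approximate [f'] by [g]; subtracting a primitive of [g] minus its constant term from [f]
   leaves a periodic function whose Lipschitz constant is of the size of that error. *)
Lemma jackson (m k : nat) f B : (0 < m)%N -> periodic_chain k f B ->
  exists2 g, trigpoly m.+2 g & forall u, `|f u - g u| <= (514 / m.+1%:R) ^+ k * B.
Proof.
move=> m0; elim: k f => [|k IH] f [fper].
  move=> fB; exists (fun=> 0); first exact: trigpoly_cst.
  by move=> u; rewrite subr0 expr0 mul1r.
move=> [f' df /IH[g [al [be ge]] fg]].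
have [G tG dG] := @trigpoly_primitive m.+2 al be isT.
set e := (514 / m.+1%:R) ^+ k * B in fg.
have p2 : 0 < 2 * pi :> R by rewrite mulr_gt0// pi_gt0.
have Gper x : G (x + 2 * pi) = G x.
  have [a [b Ge]] := tG; rewrite !Ge; apply: eq_bigr => j _.
  have -> : (j : nat)%:R * (x + 2 * pi) = j%:R * x + (pi *+ 2) *+ j.
    by rewrite -[(pi *+ 2) *+ _]mulr_natl mulr2n; ring.
  by rewrite (periodicn (@cosD2pi R)) (periodicn (@sinD2pi R)).
pose H x := f x - G x.
have Hper x : H (x + 2 * pi) = H x by rewrite /H fper Gper.
have dH (x : R) : is_derive x 1 H (f' x - (g x - al 0%N)).
  by have := dG x; rewrite -ge => dGx; exact: is_deriveB.
(* [K] has derivative f' - g, bounded by [e]; over one period [H] returns to its value and [K]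
   changes by [al 0%N] times 2 pi. *)
have al0 : `|al 0%N| <= e.
  pose K x := H x - al 0%N * x.
  have dK (x : R) : is_derive x 1 K (f' x - g x).
    have da : is_derive x 1 ( *%R (al 0%N)) (al 0%N).
      have -> : *%R (al 0%N) = al 0%N *: id by apply/funext => y.
      by apply: is_derive_eq; rewrite -[LHS]/(_ * _) mulr1.
    have := is_deriveB (dH x) da; rewrite -[H - *%R (al 0%N)]/K => dKx.
    by apply: is_derive_eq dKx _; ring.
  have := lipschitz_of_derive dK fg (0 + 2 * pi) 0; rewrite /K Hper.
  rewrite [X in `|X|](_ : _ = - (al 0%N * (2 * pi))); last by ring.
  by rewrite normrN normrM add0r subr0 (gtr0_norm p2) ler_pM2r.
(* Dropping the constant term doubles the error, whence 514 = 2 * 257. *)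
have dB (x : R) : `|f' x - (g x - al 0%N)| <= 2 * e.
  rewrite (_ : _ - _ = f' x - g x + al 0%N); last by ring.
  by rewrite (le_trans (ler_normD _ _))// mulr2n mulrDl mul1r lerD.
have Lip := lipschitz_of_derive dH dB.
have [g2 tg2 fg2] := jackson_lipschitz m0 Hper Lip.
exists (G \+ g2); first exact: trigpolyD.
move=> u; rewrite /= opprD addrA -/(H u).
by rewrite (le_trans (fg2 u))// le_eqVlt /e exprS; apply/orP; left; apply/eqP; ring.
Qed.

End jackson.

(** * The filter as a multiple of a power of sinc *)

Section sinc.
Variable R : realType.
Implicit Types (x : R) (c : nat -> R).

(** Domination by the exponential series: it gives convergence everywhere and is stable under
    termwise differentiation. *)
Definition exp_bounded c := forall n, `|c n| <= n`!%:R^-1.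

Lemma exp_bounded_diffs c : exp_bounded c -> exp_bounded (pseries_diffs c).
Proof.
move=> cb n; rewrite /pseries_diffs normrM normr_nat.
rewrite -[leRHS](@mulVKf _ n.+1%:R) ?pnatr_eq0// ler_wpM2l//.
by rewrite -invfM -natrM -factS.
Qed.

Lemma cvg_pseries_exp_bounded c x : exp_bounded c -> cvgn (pseries c x).
Proof.
move=> cb; apply: normed_cvg.
apply: series_le_cvg; last exact: (is_cvg_series_exp_coeff `|x|).
- by move=> n; rewrite normr_ge0.
- by move=> n; rewrite divr_ge0.
- by move=> n /=; rewrite /exp_coeff/= normrM normrX mulrC ler_wpM2l.
Qed.

Lemma is_derive_pseries c x : exp_bounded c ->
  is_derive x 1 (fun y => limn (pseries c y)) (limn (pseries (pseries_diffs c) x)).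
Proof.
move=> cb; have c1 := exp_bounded_diffs cb; have c2 := exp_bounded_diffs c1.
apply: (@pseries_snd_diffs _ c (`|x| + 1)); try exact: cvg_pseries_exp_bounded.
by rewrite [ltRHS]ger0_norm ?addr_ge0// ltrDl.
Qed.

Definition sinc_coef (n : nat) : R := (~~ odd n)%:R * (-1) ^+ n./2 * (n.+1`!%:R)^-1.

(** A power series rather than sin x / x, so that smoothness at 0 comes from termwise
    differentiation. *)
Definition sinc x : R := limn (pseries sinc_coef x).

Lemma sinc_coef_bounded : exp_bounded sinc_coef.
Proof.
move=> n; rewrite /sinc_coef !normrM normrX normrN1 expr1n mulr1.
rewrite normfV !normr_nat -[leRHS]mul1r ler_pM//; first by case: odd.
by rewrite lef_pV2 ?posrE ?ltr0n ?fact_gt0// ler_nat factS leq_pmull.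
Qed.

Lemma mul_sinc x : x * sinc x = sin x.
Proof.
rewrite sinE /sinc; apply/esym/cvg_lim => //.
set s := (fun n : nat => _ : R).
have e : (fun n => pseries s x n.+1) = (fun n => x * pseries sinc_coef x n).
  apply/funext => n; rewrite /pseries /series/= big_nat_recl//= /s !mul0r add0r.
  rewrite mulr_sumr; apply: eq_bigr => i _.
  by rewrite /sinc_coef exprS; ring.
rewrite -(cvg_shiftS (pseries s x)) /= e; apply: cvgMr.
exact/cvg_pseries_exp_bounded/sinc_coef_bounded.
Qed.

Lemma sinc0 : sinc 0 = 1.
Proof.
apply/cvg_lim => //; rewrite -cvg_shiftS /=.
have -> : (fun n => pseries sinc_coef 0 n.+1) = cst 1; last exact: cvg_cst.
apply/funext => n; rewrite /pseries /series/= big_nat_recl//= big1.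
  by rewrite /sinc_coef/= expr0 divr1 !mulr1 addr0.
by move=> i _; rewrite exprS mul0r mulr0.
Qed.

Lemma sincE x : x != 0 -> sinc x = sin x / x.
Proof. by move=> x0; rewrite -mul_sinc mulrC mulKf. Qed.

Lemma sinc_le1 x : `|sinc x| <= 1.
Proof.
have [->|x0] := eqVneq x 0; first by rewrite sinc0 normr1.
rewrite sincE// normrM normfV ler_pdivrMr ?normr_gt0// mul1r.
exact: sin_le_id.
Qed.

Lemma sinc_leV x : 0 < x -> `|sinc x| <= x^-1.
Proof.
move=> x0; rewrite sincE ?gt_eqF// normrM normfV (gtr0_norm x0).
by rewrite ler_piMl ?invr_ge0 ?(ltW x0)// sin_max.
Qed.

Lemma sincN x : sinc (- x) = sinc x.
Proof.
have [->|x0] := eqVneq x 0; first by rewrite oppr0.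
by rewrite !sincE ?oppr_eq0// sinN invrN mulrNN.
Qed.

Lemma sinc_neq0 x : `|x| < 2 -> sinc x != 0.
Proof.
wlog x0 : x / 0 <= x.
  move=> H; have [/H//|x0] := leP 0 x.
  by rewrite -sincN -normrN; apply: H; rewrite oppr_ge0 ltW.
rewrite ger0_norm//; move: x0; rewrite le_eqVlt => /orP[/eqP <- _|x0 x2].
  by rewrite sinc0 oner_eq0.
by rewrite sincE ?gt_eqF// divr_gt0// sin2_gt0// x0.
Qed.

End sinc.

Section chains.
Variable R : realType.
Implicit Types (f g h : R -> R) (x : R).

Lemma is_derive_continuous f x d : is_derive x 1 f d -> {for x, continuous f}.
Proof.
by move=> [df _]; apply: differentiable_continuous; exact/derivable1_diffP.
Qed.

(* The interval ]-2, 2[ contains the support of the filter and no zero of [sinc]. *)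
Fixpoint smooth2 (k : nat) f : Prop :=
  match k with
  | 0 => forall x, `|x| < 2 -> {for x, continuous f}
  | k'.+1 => exists2 f', (forall x, `|x| < 2 -> is_derive x 1 f (f' x)) & smooth2 k' f'
  end.

Lemma smooth2S k f : smooth2 k.+1 f -> smooth2 k f.
Proof.
elim: k f => [|k IH] f [f' df sf].
  by move=> x /df; exact: is_derive_continuous.
by exists f' => //; exact: IH.
Qed.

Lemma smooth2D k f g : smooth2 k f -> smooth2 k g -> smooth2 k (fun x => f x + g x).
Proof.
elim: k f g => [|k IH] f g.
  by move=> cf cg x x2; apply: continuousD; [exact: cf|exact: cg].
move=> [f' df sf] [g' dg sg]; exists (fun x => f' x + g' x); last exact: IH.
by move=> x x2; have := df x x2; have := dg x x2 => ? ?; exact: is_deriveD.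
Qed.

Lemma is_deriveM1 f g x a b : is_derive x 1 f a -> is_derive x 1 g b ->
  is_derive x 1 (fun y => f y * g y) (a * g x + f x * b).
Proof.
move=> df dg; have := is_deriveM df dg => H.
by apply: is_derive_eq H _; rewrite -![_ *: _]/(_ * _) addrC mulrC; congr (_ + _); ring.
Qed.

Lemma smooth2M k f g : smooth2 k f -> smooth2 k g -> smooth2 k (fun x => f x * g x).
Proof.
elim: k f g => [|k IH] f g.
  by move=> cf cg x x2; apply: continuousM; [exact: cf|exact: cg].
move=> sf sg; have sf' := smooth2S sf; have sg' := smooth2S sg.
case: sf sg => f' df sf [g' dg sg].
exists (fun x => f' x * g x + f x * g' x); last by apply: smooth2D; exact: IH.
by move=> x x2; apply: is_deriveM1; [exact: df|exact: dg].
Qed.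

Lemma smooth2N k f : smooth2 k f -> smooth2 k (fun x => - f x).
Proof.
elim: k f => [|k IH] f; first by move=> cf x x2; apply: continuousN; exact: cf.
move=> [f' df sf]; exists (fun x => - f' x); last exact: IH.
by move=> x x2; have := df x x2 => ?; exact: is_deriveN.
Qed.

Lemma smooth2V k f : (forall x, `|x| < 2 -> f x != 0) ->
  smooth2 k f -> smooth2 k (fun x => (f x)^-1).
Proof.
move=> f0; elim: k => [|k IH].
  by move=> cf x x2; apply: continuousV; [exact: f0|exact: cf].
move=> sf; have sV := IH (smooth2S sf); case: sf => f' df sf.
exists (fun x => - ((f x)^-1 * (f x)^-1 * f' x)).
  move=> x x2; have := df x x2 => dfx; have H := is_deriveV (f0 _ x2) dfx.
  by apply: is_derive_eq H _; rewrite -[_ *: _]/(_ * _) mulNr expr2 invfM.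
by apply: smooth2N; apply: smooth2M => //; exact: smooth2M.
Qed.

Lemma smooth2_cst k (a : R) : smooth2 k (fun=> a).
Proof.
elim: k a => [|k IH] a; first by move=> x _; exact: cvg_cst.
by exists (fun=> 0) => // x _; exact: is_derive_cst.
Qed.

Lemma smooth2X k f n : smooth2 k f -> smooth2 k (fun x => f x ^+ n).
Proof.
move=> sf; elim: n => [|n IH].
  have -> : (fun x => f x ^+ 0) = (fun=> 1) by apply/funext => x; rewrite expr0.
  exact: smooth2_cst.
have -> : (fun x => f x ^+ n.+1) = (fun x => f x * f x ^+ n).
  by apply/funext => x; rewrite exprS.
exact: smooth2M.
Qed.

Lemma smooth2_sinc k : smooth2 k (@sinc R).
Proof.
suff H c : exp_bounded c -> smooth2 k (fun x : R => limn (pseries c x)).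
  exact/H/sinc_coef_bounded.
elim: k c => [|k IH] c cb.
  by move=> x _; exact: is_derive_continuous (is_derive_pseries x cb).
exists (fun x : R => limn (pseries (pseries_diffs c) x)).
  by move=> x _; exact: is_derive_pseries.
exact/IH/exp_bounded_diffs.
Qed.

Fixpoint bump (k : nat) f : Prop :=
  (forall x, 1 < `|x| -> f x = 0) /\
  match k with
  | 0 => continuous f
  | k'.+1 => exists2 f', (forall x, is_derive x 1 f (f' x)) & bump k' f'
  end.

Lemma bump_supp k f : bump k f -> forall x, 1 < `|x| -> f x = 0.
Proof. by case: k => [|k] []. Qed.

Lemma bumpS k f : bump k.+1 f -> bump k f.
Proof.
elim: k f => [|k IH] f [f0 [f' df sf]]; split => //.
  by move=> x; exact: is_derive_continuous (df x).
by exists f' => //; exact: IH.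
Qed.

Lemma bumpD k f g : bump k f -> bump k g -> bump k (fun x => f x + g x).
Proof.
elim: k f g => [|k IH] f g [f0 sf] [g0 sg]; split.
- by move=> x x1; rewrite f0// g0// addr0.
- by move=> x; apply: continuousD; [exact: sf|exact: sg].
- by move=> x x1; rewrite f0// g0// addr0.
- case: sf sg => f' df sf [g' dg sg]; exists (fun x => f' x + g' x); last exact: IH.
  by move=> x; have := df x; have := dg x => ? ?; exact: is_deriveD.
Qed.

Lemma near_gt_norm x (a : R) : a < `|x| -> \forall y \near x, a < `|y|.
Proof.
move=> ax; have : `|y| @[y --> x] --> `|x| by exact: norm_continuous.
by move/cvgr_gt => /(_ _ ax).
Qed.

(** Nothing is known of [g] outside ]-2, 2[, but there [f] vanishes in a neighbourhood and the
    product is locally zero. *)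
Lemma bumpM k f g : bump k f -> smooth2 k g -> bump k (fun x => f x * g x).
Proof.
elim: k f g => [|k IH] f g.
  move=> [f0 cf] cg; split; first by move=> x x1; rewrite f0// mul0r.
  move=> x; have [x2|x2] := ltP `|x| 2; first by apply: continuousM; [exact: cf|exact: cg].
  have x1 : 1 < `|x| by rewrite (lt_le_trans _ x2)// ltr1n.
  rewrite /prop_for/continuous_at (f0 _ x1) mul0r; apply: cvg_near_cst.
  by near=> y; rewrite f0 ?mul0r//; near: y; exact: near_gt_norm.
move=> sf sg; have sf' := bumpS sf; have sg' := smooth2S sg.
case: sf sg => f0 [f' df sf] [g' dg sg]; split.
  by move=> x x1; rewrite f0// mul0r.
exists (fun x => f' x * g x + f x * g' x); last by apply: bumpD; exact: IH.
move=> x; have [x2|x2] := ltP `|x| 2; first exact: is_deriveM1 (df x) (dg x x2).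
have x1 : 1 < `|x| by rewrite (lt_le_trans _ x2)// ltr1n.
rewrite f0// (bump_supp sf)// !mul0r addr0.
apply: near_eq_is_derive (is_derive_cst (0:R) x 1).
by near=> y; rewrite f0 ?mul0r//; near: y; exact: near_gt_norm.
Unshelve. all: by end_near. Qed.

Lemma bump_bounded f : bump 0 f -> exists B, forall x, `|f x| <= B.
Proof.
move=> [f0 cf].
have cn : {within `[(-1 : R), 1], continuous (fun x => `|f x|)}.
  apply: continuous_subspaceT => x.
  by apply: continuous_comp; [exact: cf|exact: norm_continuous].
have ab : (-1 : R) <= 1 by lra.
have [c _ cM] := EVT_max ab cn.
exists `|f c| => x; have [x1|x1] := leP `|x| 1.
  by apply: cM; rewrite in_itv/= -ler_norml.
by rewrite f0// normr0.
Qed.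

Lemma lowpass_bump k h : lowpass_filter h -> bump k h.
Proof.
move=> [dh h01 hN h1 h0].
have hz x : 1 < `|x| -> h x = 0.
  move=> x1; have [x0|x0] := leP 0 x; first by rewrite h0// ltW// -(ger0_norm x0).
  by rewrite -hN h0// ltW// -(ltr0_norm x0).
suff H n : (forall x, 1 < `|x| -> derive1n n h x = 0) -> bump k (derive1n n h).
  exact: (H 0%N).
elim: k n => [|k IH] n hn; split => //.
  move=> x; apply: differentiable_continuous; apply/derivable1_diffP; exact: dh.
have dn x : is_derive x 1 (derive1n n h) (derive1n n.+1 h x).
  by rewrite derive1nS derive1E; apply: derivableP; exact: dh.
exists (derive1n n.+1 h) => //; apply: IH => x x1.
rewrite derive1nS derive1E.
have : is_derive x 1 (derive1n n h) 0.
  apply: near_eq_is_derive (is_derive_cst (0:R) x 1).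
  by near=> y; rewrite hn//; near: y; exact: near_gt_norm.
by case.
Unshelve. all: by end_near. Qed.

(* [sinc] has no zero where the filter lives, and [sinc ^ M] supplies the decay of order M. *)
Lemma lowpass_factor k M h : lowpass_filter h -> exists F : R -> R,
  [/\ bump k F, (forall x, F (- x) = F x) & forall x, h x = sinc x ^+ M * F x].
Proof.
move=> fh; exists (fun x => h x * (sinc x ^+ M)^-1); split.
- apply: bumpM; first exact: lowpass_bump.
  apply: smooth2V => [x x2|]; first by rewrite expf_neq0// sinc_neq0.
  exact/smooth2X/smooth2_sinc.
- by case: fh => _ _ hN _ _ x; rewrite hN sincN.
- move=> x; have [x2|x2] := ltP `|x| 2.
    by rewrite mulrC divfK// expf_neq0// sinc_neq0.
  rewrite (bump_supp (lowpass_bump 0 fh)) ?mul0r ?mulr0//.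
  by rewrite (lt_le_trans _ x2)// ltr1n.
Qed.

End chains.

(** * Approximation of the filter by cosines times a power of sinc *)

Section periodization.
Variable R : realType.
Implicit Types (f : R -> R) (x t u : R) (p : nat).

(** The number of full turns separating [t] from its representative in [-pi, pi[. *)
Definition turn t : int := Num.floor (t / (2 * pi) + 1 / 2).

Lemma turnE t (z : int) : - pi <= t - 2 * pi * z%:~R < pi -> turn t = z.
Proof.
have p2 : 0 < 2 * pi :> R by rewrite mulr_gt0// pi_gt0.
move=> /andP[h1 h2]; apply: floor_def; rewrite intrD1.
have e : t = t / (2 * pi) * (2 * pi) by rewrite divfK ?gt_eqF.
move: e h1 h2; move: z%:~R (t / _) => z' v e h1 h2.
by apply/andP; split; nra.
Qed.

Lemma turn_itv t : - pi <= t - 2 * pi * (turn t)%:~R < pi.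
Proof.
have p2 : 0 < 2 * pi :> R by rewrite mulr_gt0// pi_gt0.
have /andP[] := floor_itv (t / (2 * pi) + 1 / 2); rewrite -/(turn t).
rewrite intrD1; have e : t = t / (2 * pi) * (2 * pi) by rewrite divfK ?gt_eqF.
move: e; move: (turn t)%:~R (t / _) => z v e h1 h2.
by apply/andP; split; nra.
Qed.

(** In the variable u = p t, copies of [f] repeat with period 2 pi p: letting p grow sends all
    copies but one to infinity. *)
Definition periodize p f t : R := f (p%:R * (t - 2 * pi * (turn t)%:~R)).

Lemma periodize_periodic p f t : periodize p f (t + 2 * pi) = periodize p f t.
Proof.
rewrite /periodize; have -> : turn (t + 2 * pi) = turn t + 1.
  apply: turnE; rewrite intrD1.
  by rewrite (_ : _ - _ = t - 2 * pi * (turn t)%:~R); [exact: turn_itv|ring].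
by congr (f (_ * _)); rewrite intrD1; ring.
Qed.

(* At a jump of [turn] both sides vanish, as [f] is supported in [-1, 1] and [p * pi > 1]. *)
Lemma periodize_near p f t : (0 < p)%N -> (forall x, 1 < `|x| -> f x = 0) ->
  \forall s \near t, f (p%:R * (s - 2 * pi * (turn t)%:~R)) = periodize p f s.
Proof.
move=> p0 f0.
have p1 : 1 <= p%:R :> R by rewrite ler1n.
have pi2 := @pi_ge2 R.
have big y : 5 / 4 <= y \/ y <= - (5 / 4) -> f (p%:R * y) = 0.
  move=> hy; apply: f0; rewrite normrM ger0_norm//.
  have : 5 / 4 <= `|y| by rewrite ler_normr; case: hy => h; apply/orP; [left|right]; lra.
  by nra.
have : \forall s \near t, `|t - s| < 1 / 2 by apply/nbhs_ballP; exists (1 / 2) => //=; lra.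
apply: filterS => s; rewrite ltr_norml => /andP[s1 s2].
have /andP[t1 t2] := turn_itv t.
rewrite /periodize; set z := turn t in t1 t2 *.
have [sl|sl] := ltP (s - 2 * pi * z%:~R) (- pi).
  have -> : turn s = z - 1 by apply: turnE; rewrite rmorphB/=; apply/andP; split; lra.
  rewrite big; last by right; lra.
  by rewrite big//; left; rewrite rmorphB/=; lra.
have [sr|sr] := ltP (s - 2 * pi * z%:~R) pi.
  have H : turn s = z by apply: turnE; rewrite sl sr.
  by rewrite H.
have -> : turn s = z + 1 by apply: turnE; rewrite intrD1; apply/andP; split; lra.
rewrite big; last by left; lra.
by rewrite big//; right; rewrite intrD1; lra.
Qed.

(** Each derivative costs a factor [p]. The scalar [c] collects these factors during the induction,
    and [B] is independent of both. *)
Lemma periodize_chain k f : bump k f -> exists2 B, 0 <= B &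
  forall (p : nat) (c : R), (0 < p)%N -> 0 <= c ->
  periodic_chain k (fun t => c * periodize p f t) (c * p%:R ^+ k * B).
Proof.
elim: k f => [|k IH] f bf.
  have [B fB] := bump_bounded bf.
  exists B; first exact: le_trans (normr_ge0 _) (fB 0).
  move=> p c p0 c0; split; first by move=> x; rewrite /= periodize_periodic.
  by move=> x; rewrite /= normrM ger0_norm// expr0 mulr1 ler_wpM2l// /periodize.
have f0 := bump_supp bf; case: bf => _ [f' df /IH[B B0 HB]].
exists B => // p c p0 c0; split; first by move=> x; rewrite /= periodize_periodic.
exists (fun t => c * p%:R * periodize p f' t); last first.
  by rewrite exprS mulrA; apply: HB => //; rewrite mulr_ge0.
move=> t.
have lin : is_derive t 1 (fun s : R => p%:R * (s - 2 * pi * (turn t)%:~R)) (p%:R : R).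
  have -> : (fun s : R => p%:R * (s - 2 * pi * (turn t)%:~R)) =
     p%:R *: (id - cst (2 * pi * (turn t)%:~R)) by apply/funext => s.
  by apply: is_derive_eq; rewrite -[LHS]/(_ * _) subr0 mulr1.
have H := is_derive1_comp (df _) lin.
have H2 : is_derive t 1 (periodize p f) (f' (p%:R * (t - 2 * pi * (turn t)%:~R)) * p%:R).
  exact: near_eq_is_derive (periodize_near t p0 f0) H.
have H3 := is_deriveZ c H2.
by apply: is_derive_eq H3 _; rewrite -[LHS]/(_ * _) /periodize; ring.
Qed.

Lemma periodize_id p f t : - pi <= t < pi -> periodize p f t = f (p%:R * t).
Proof.
by move=> tp; rewrite /periodize (@turnE t 0) ?mulr0 ?subr0.
Qed.

(** Jackson's theorem for [periodize p F]. With m.+1 = N p the error (514 / N)^k is free of p, the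
    frequencies j / p are at most N, and the range [|u| < pi * p%:R] of the approximation grows with
    p. Outside this range [g] is merely bounded. *)
Lemma bandlimited_approx k F : bump k F -> (forall x, F (- x) = F x) ->
  exists2 B, 0 <= B & forall p m : nat, (0 < p)%N -> (0 < m)%N ->
  exists al : nat -> R, let g u := \sum_(j < m.+2) al j * cos (j%:R * u / p%:R) in
    (forall u, `|u| < pi * p%:R -> `|F u - g u| <= (514 * p%:R / m.+1%:R) ^+ k * B) /\
    (forall u, `|g u| <= B + (514 * p%:R / m.+1%:R) ^+ k * B).
Proof.
move=> bF FN; have [B1 B10 HB] := periodize_chain bF.
have [B2 FB] : exists B, forall x, `|F x| <= B.
  have : bump 0 F by elim: k bF {HB} => [//|k IH] /bumpS.
  exact: bump_bounded.
exists (B1 + B2); first by rewrite addr_ge0// (le_trans (normr_ge0 _) (FB 0)).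
move=> p m p0 m0.
have := HB p 1 p0 ler01; rewrite mul1r => /(jackson m0)[g0 [al [be ge]]].
move=> fg; pose e := (514 * p%:R / m.+1%:R) ^+ k * B1.
have fg0 u : `|periodize p F u - g0 u| <= e.
  by have := fg u; rewrite mul1r mulrA -exprMn mulrAC.
have p1 : 0 < p%:R :> R by rewrite ltr0n.
exists al => g.
(* As [F] is even, averaging over u and -u keeps the error and removes the sines. *)
have gE u : g u = (g0 (u / p%:R) + g0 (- (u / p%:R))) / 2.
  rewrite !ge -big_split/= mulr_suml; apply: eq_bigr => j _.
  by rewrite mulrN cosN sinN -mulrA; field.
have e0 : 0 <= e by exact: le_trans (normr_ge0 _) (fg0 0).
have eB : e <= (514 * p%:R / m.+1%:R) ^+ k * (B1 + B2).
  rewrite /e ler_wpM2l ?exprn_ge0 ?divr_ge0 ?mulr_ge0 ?ler0n//.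
  by rewrite lerDl (le_trans (normr_ge0 _) (FB 0)).
have half a b c : `|a| <= c -> `|b| <= c -> `|(a + b) / 2| <= c :> R.
  by rewrite !ler_norml => /andP[? ?] /andP[? ?]; apply/andP; split; lra.
split=> u.
  move=> up; apply: le_trans eB; rewrite gE.
  have ub : `|u / p%:R| < pi by rewrite normrM normfV (gtr0_norm p1) ltr_pdivrMr.
  have uc : u = p%:R * (u / p%:R) by rewrite mulrC divfK// gt_eqF.
  have -> : F u - (g0 (u / p%:R) + g0 (- (u / p%:R))) / 2 =
    ((F u - g0 (u / p%:R)) + (F u - g0 (- (u / p%:R)))) / 2 by field.
  apply: half.
    have := fg0 (u / p%:R); rewrite periodize_id -?uc//.
    by move: ub; rewrite ltr_norml => /andP[h1 h2]; apply/andP; split; lra.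
  have := fg0 (- (u / p%:R)); rewrite periodize_id ?mulrN -?uc ?FN//.
  by move: ub; rewrite ltr_norml => /andP[h1 h2]; apply/andP; split; lra.
have gb v : `|g0 v| <= B2 + e.
  have := fg0 v; rewrite distrC => h; rewrite -(subrK (periodize p F v) (g0 v)).
  by rewrite addrC (le_trans (ler_normD _ _))// lerD// FB.
by rewrite gE (le_trans (half _ _ _ (gb _) (gb _)))// lerD// lerDr.
Qed.

End periodization.

(** * Chebyshev polynomials in a Gaussian *)

Section chebyshev.
Variable R : realType.
Implicit Types (x y : R) (f g : R -> R) (D k m M : nat) (W : R).

(** [W] bounds the l1 norm of the coefficients, which is submultiplicative and allows a polynomial
    in a Gaussian to be tested term by term. *)
Definition powsum D W f := exists2 b : nat -> R,
  (forall y, f y = \sum_(i < D.+1) b i * y ^+ i) & \sum_(i < D.+1) `|b i| <= W.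

Lemma powsum_ext D W f g : f =1 g -> powsum D W f -> powsum D W g.
Proof. by move=> fg [b e h]; exists b => // y; rewrite -fg. Qed.

Lemma powsum_le D D' W W' f : (D <= D')%N -> W <= W' -> powsum D W f -> powsum D' W' f.
Proof.
move=> DD WW [b e h].
exists (fun i => if (i < D.+1)%N then b i else 0).
  move=> y; rewrite e (big_ord_widen D'.+1 (fun i => b i * y ^+ i))//.
  by rewrite big_mkcond; apply: eq_bigr => i _; case: ifP => // _; rewrite mul0r.
rewrite (le_trans _ WW)// (le_trans _ h)//.
rewrite (big_ord_widen D'.+1 (fun i => `|b i|))// [leRHS]big_mkcond.
by apply: ler_sum => i _; case: ifP => // _; rewrite normr0.
Qed.

Lemma powsumD D W W' f g : powsum D W f -> powsum D W' g -> powsum D (W + W') (f \+ g).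
Proof.
move=> [b e h] [c e' h']; exists (b \+ c) => [y|].
  by rewrite /= e e' -big_split; apply: eq_bigr => i _; rewrite mulrDl.
rewrite (le_trans _ (lerD h h'))// -big_split ler_sum// => i _.
exact: ler_normD.
Qed.

Lemma powsumZ D W a f : powsum D W f -> powsum D (`|a| * W) (fun y => a * f y).
Proof.
move=> [b e h]; exists (fun i => a * b i) => [y|].
  by rewrite e mulr_sumr; apply: eq_bigr => i _; rewrite mulrA.
under eq_bigr do rewrite normrM; by rewrite -mulr_sumr ler_wpM2l.
Qed.

Lemma powsumX D W f : powsum D W f -> powsum D.+1 W (fun y => y * f y).
Proof.
move=> [b e h]; exists (fun i => if i is i'.+1 then b i' else 0) => [y|].
  rewrite e [RHS]big_ord_recl/= mul0r add0r mulr_sumr.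
  by apply: eq_bigr => i _; rewrite /= exprS; ring.
by rewrite big_ord_recl/= normr0 add0r.
Qed.

Lemma powsum_sum n D (W : nat -> R) (f : nat -> R -> R) :
  (forall i, (i < n)%N -> powsum D (W i) (f i)) ->
  powsum D (\sum_(i < n) W i) (fun y => \sum_(i < n) f i y).
Proof.
elim: n => [|n IH] H.
  exists (fun=> 0) => [y|]; first by rewrite big_ord0 big1// => i _; rewrite mul0r.
  by rewrite big_ord0 big1// => i _; rewrite normr0.
have Hn : forall i, (i < n)%N -> powsum D (W i) (f i) by move=> i ?; apply: H; lia.
rewrite big_ord_recr/=; apply: powsum_ext (powsumD (IH Hn) (H _ (ltnSn n))).
by move=> y; rewrite big_ord_recr.
Qed.

Lemma powsumM D D' W W' f g : powsum D W f -> powsum D' W' g ->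
  powsum (D + D') (W * W') (fun y => f y * g y).
Proof.
move=> [b e h] pg.
have W'0 : 0 <= W' by case: pg => c _; apply: le_trans; rewrite sumr_ge0.
apply: (@powsum_le (D + D') _ (\sum_(i < D.+1) `|b i| * W')) => //.
  by rewrite -mulr_suml ler_wpM2r.
apply: (@powsum_ext _ _ (fun y => \sum_(i < D.+1) b i * (y ^+ i * g y))).
  by move=> y; rewrite e mulr_suml; apply: eq_bigr => i _; rewrite mulrA.
apply: (@powsum_sum D.+1 (D + D') (fun i => `|b i| * W')
  (fun i y => b i * (y ^+ i * g y))) => i iD.
apply: powsumZ; apply: (@powsum_le (i + D') _ W') => //; first by lia.
elim: i {iD} => [|i IH].
  by apply: powsum_ext pg => y; rewrite expr0 mul1r.
by apply: powsum_ext (powsumX IH) => y; rewrite exprS mulrA.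
Qed.

Lemma powsum1 : powsum 0 1 (fun=> 1).
Proof. by exists (fun=> 1) => [y|]; rewrite big_ord1 ?normr1// expr0 mul1r. Qed.

Lemma powsum_exp D W f M : powsum D W f -> powsum (M * D) (W ^+ M) (fun y => f y ^+ M).
Proof.
move=> pf; elim: M => [|M IH].
  by rewrite expr0; apply: powsum_ext powsum1 => y; rewrite expr0.
rewrite mulSn exprS; apply: powsum_ext (powsumM pf IH) => y.
by rewrite exprS.
Qed.

(** Two consecutive Chebyshev polynomials of the first kind, which makes the three-term recurrence
    structural. *)
Fixpoint chebT2 k y : R * R :=
  if k is k'.+1 then let: (p, q) := chebT2 k' y in (q, 2 * y * q - p) else (1, y).
Definition chebT k y := (chebT2 k y).1.

Lemma chebTS2 k y : chebT k.+2 y = 2 * y * chebT k.+1 y - chebT k y.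
Proof. by rewrite /chebT /=; case: (chebT2 k y). Qed.

(** The second kind, through U_(k+1) = y U_k + T_(k+1): this form yields both the bound k+1 on
    [-1, 1] and the bound on the coefficients by induction. *)
Fixpoint chebU k y : R := if k is k'.+1 then y * chebU k' y + chebT k y else 1.

Lemma powsum_chebT k : powsum k (3 ^+ k) (chebT k).
Proof.
suff : powsum k (3 ^+ k) (chebT k) /\ powsum k.+1 (3 ^+ k.+1) (chebT k.+1) by case.
have X1 := powsumX powsum1.
elim: k => [|k [IH1 IH2]].
  split; first exact: powsum_ext powsum1.
  apply: (@powsum_le 1 _ 1) => //; first by rewrite expr1 ler1n.
  by apply: powsum_ext X1 => y; rewrite mulr1.
split => //.
have H1 := powsumZ 2 (powsumX IH2).
have H2 := powsumZ (-1) (@powsum_le k k.+2 _ _ _ ltac:(lia) (lexx _) IH1).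
apply: (@powsum_le k.+2 _ (`|2| * 3 ^+ k.+1 + `|-1| * 3 ^+ k)) => //.
  by rewrite normrN1 normr_nat !exprS; have := exprn_ge0 k (ler0n R 3); nra.
by apply: powsum_ext (powsumD H1 H2) => y; rewrite chebTS2/=; ring.
Qed.

Lemma powsum_chebU k : powsum k (3 ^+ k.+1) (chebU k).
Proof.
elim: k => [|k IH].
  by apply: powsum_le powsum1 => //; rewrite expr1 ler1n.
apply: (@powsum_le k.+1 _ (3 ^+ k.+1 + 3 ^+ k.+1)) => //.
  by rewrite [leRHS]exprS; have := exprn_ge0 k.+1 (ler0n R 3); nra.
exact: powsumD (powsumX IH) (powsum_chebT k.+1).
Qed.

Lemma chebT_cos k x : chebT k (cos x) = cos (k%:R * x).
Proof.
suff : chebT k (cos x) = cos (k%:R * x) /\ chebT k.+1 (cos x) = cos (k.+1%:R * x) by case.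
elim: k => [|k [IH1 IH2]]; first by rewrite mul0r mul1r cos0.
split => //; rewrite chebTS2 IH1 IH2.
have -> : k.+2%:R * x = k.+1%:R * x + x by rewrite -[k.+2%:R]natr1; ring.
have -> : k%:R * x = k.+1%:R * x - x by rewrite -[k.+1%:R]natr1; ring.
by rewrite cosB cosD; ring.
Qed.

Lemma chebU_sin k x : chebU k (cos x) * sin x = sin (k.+1%:R * x).
Proof.
elim: k => [|k IH]; first by rewrite !mul1r.
rewrite [chebU _ _]/= mulrDl -mulrA IH chebT_cos.
have -> : k.+2%:R * x = k.+1%:R * x + x by rewrite -[k.+2%:R]natr1; ring.
by rewrite sinD; ring.
Qed.

Lemma chebU_cos_le k x : `|chebU k (cos x)| <= k.+1%:R.
Proof.
elim: k => [|k IH]; first by rewrite normr1.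
rewrite [chebU _ _]/= (le_trans (ler_normD _ _))// -[leRHS]natr1 lerD//.
  by rewrite normrM -[leRHS]mul1r ler_pM// cos_max.
by rewrite chebT_cos cos_max.
Qed.

Lemma chebU1 k : chebU k 1 = k.+1%:R.
Proof.
have T1 j : chebT j 1 = 1 by rewrite -[in LHS](@cos0 R) chebT_cos mulr0 cos0.
by elim: k => [//|k IH]; rewrite [LHS]/= IH mul1r T1 natr1.
Qed.

Lemma chebU_sinc k x : sinc x != 0 ->
  chebU k (cos x) = k.+1%:R * (sinc (k.+1%:R * x) / sinc x).
Proof.
move=> sx; have [->|x0] := eqVneq x 0.
  by rewrite cos0 chebU1 mulr0 sinc0 divr1 mulr1.
apply: (mulIf sx); apply: (mulIf x0).
rewrite -mulrA [sinc x * x]mulrC mul_sinc chebU_sin -mul_sinc; field.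
exact: sx.
Qed.

(* The analogue of [sinc u ^ M * cos (k u / m)] that is a polynomial in [y]. *)
Definition chebP M m k y := (y * (m%:R^-1 * chebU m.-1 y)) ^+ M * chebT k y.

(** The factor y^M makes the exponents start at M. For M > 0 there is no constant term, which would
    correspond to a Gaussian of time 0. *)
Lemma powsum_chebP M m k : (0 < m)%N ->
  exists2 b : nat -> R,
    (forall y, chebP M m k y = \sum_(i < (M * m.-1 + k).+1) b i * y ^+ (i + M)) &
    \sum_(i < (M * m.-1 + k).+1) `|b i| <= 3 ^+ (M * m + k).
Proof.
move=> m0.
have pU : powsum m.-1 (3 ^+ m) (fun y => m%:R^-1 * chebU m.-1 y).
  apply: (@powsum_le m.-1 _ (`|m%:R^-1| * 3 ^+ m)) => //.
    rewrite ler_piMl ?exprn_ge0// normfV normr_nat invf_le1 ?ltr0n//.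
    by rewrite ler1n.
  by rewrite -[in X in _ * X](prednK m0); exact/powsumZ/powsum_chebU.
have [b e h] := powsumM (powsum_exp M pU) (powsum_chebT k).
exists b; last by rewrite (le_trans h)// -exprM -exprD mulnC.
move=> y; rewrite /chebP exprMn -mulrA e mulr_sumr; apply: eq_bigr => i _.
by rewrite exprD; ring.
Qed.

Lemma expR_le_invD (x : R) : 0 <= x -> expR (- x) <= (1 + x)^-1.
Proof.
move=> x0; rewrite expRN lef_pV2 ?posrE ?expR_gt0 ?ltr_pwDl//.
exact: expR_ge1Dx.
Qed.

(* [gauss_angle m x] is [x / m] to first order as [m] grows. *)
Definition gauss_angle m x : R := acos (expR (- (x ^+ 2 / (2 * m%:R ^+ 2)))).

Lemma cos_gauss_angle m x :
  cos (gauss_angle m x) = expR (- (x ^+ 2 / (2 * m%:R ^+ 2))).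
Proof.
have H : 0 <= x ^+ 2 / (2 * m%:R ^+ 2).
  by apply: divr_ge0; [exact: sqr_ge0|apply: mulr_ge0 => //; exact: sqr_ge0].
rewrite /gauss_angle acosK// in_itv/=; apply/andP; split.
  by rewrite (le_trans _ (expR_ge0 _))// oppr_le0.
by rewrite -[leRHS]expR0 ler_expR oppr_le0.
Qed.

(** A bound uniform in m, for a dominated passage to the limit. For x > 1 it follows from
    [|U_(m-1) sin|] <= 1 and x y <= m [|sin|]. The factor y is essential when x exceeds m, where m
    [|sin|] cannot grow with x: y^2 = exp(-x^2/m^2) <= 1 / (1 + x^2/m^2). *)
Lemma chebP_le M m k x : (0 < m)%N -> 0 <= x ->
  `|chebP M m k (cos (gauss_angle m x))| <= (Num.max 1 x) ^- M.
Proof.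
move=> m0 x0; set y := cos _; have mp : 0 < m%:R :> R by rewrite ltr0n.
rewrite normrM -[leRHS]mulr1 ler_pM//; last by rewrite chebT_cos cos_max.
rewrite normrX -exprVn; apply: lerXn2r; rewrite ?nnegrE ?invr_ge0 ?le_max ?ler01//.
have y0 : 0 < y by rewrite /y cos_gauss_angle expR_gt0.
have y1 : y <= 1 by exact: cos_le1.
have Um : `|m%:R^-1 * chebU m.-1 y| <= 1.
  rewrite normrM normfV normr_nat mulrC ler_pdivrMr// mul1r.
  by have := chebU_cos_le m.-1 (gauss_angle m x); rewrite prednK.
have [x1|x1] := leP x 1.
  by rewrite invr1 normrM (gtr0_norm y0) -[leRHS]mulr1 ler_pM// ltW.
have xp : 0 < x by lra.
rewrite -[leRHS]div1r ler_pdivlMr// -(@ler_pXn2r _ 2) ?nnegrE ?mulr_ge0//.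
rewrite exprMn real_normK ?num_real// expr1n.
have s2 := cos2Dsin2 (gauss_angle m x); rewrite -/y in s2.
have Us : (chebU m.-1 y * sin (gauss_angle m x)) ^+ 2 <= 1.
  rewrite chebU_sin -real_normK ?num_real// -[leRHS](expr1n _ 2).
  by rewrite ler_pXn2r ?nnegrE// sin_max.
have key : (x * y) ^+ 2 <= m%:R ^+ 2 * sin (gauss_angle m x) ^+ 2.
  have -> : sin (gauss_angle m x) ^+ 2 = 1 - y ^+ 2 by rewrite -s2; ring.
  have yv : y ^+ 2 * (1 + x ^+ 2 / m%:R ^+ 2) <= 1.
    have v0 : 0 <= x ^+ 2 / m%:R ^+ 2 by rewrite divr_ge0 ?sqr_ge0.
    rewrite -ler_pdivlMr ?ltr_pwDl// div1r; apply: le_trans (expR_le_invD v0).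
    rewrite /y cos_gauss_angle expr2 -expRD ler_expR.
    by rewrite le_eqVlt; apply/orP; left; apply/eqP; field; rewrite gt_eqF.
  have -> : (x * y) ^+ 2 = m%:R ^+ 2 * (y ^+ 2 * (x ^+ 2 / m%:R ^+ 2)).
    by field; rewrite gt_eqF.
  rewrite ler_wpM2l ?sqr_ge0//; lra.
have -> : (y * (m%:R^-1 * chebU m.-1 y)) ^+ 2 * x ^+ 2 =
  chebU m.-1 y ^+ 2 * ((x * y) ^+ 2 / m%:R ^+ 2) by field; rewrite gt_eqF.
apply: le_trans Us; rewrite [leRHS]exprMn ler_wpM2l ?sqr_ge0//.
by rewrite ler_pdivrMr ?exprn_gt0// [leRHS]mulrC.
Qed.

End chebyshev.

Section cheb_limit.
Variable R : realType.

Lemma continuous_sinc : continuous (@sinc R).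
Proof.
move=> x; exact: is_derive_continuous (is_derive_pseries x (@sinc_coef_bounded R)).
Qed.

Lemma sqr_cvg_sqrt (u : nat -> R) (l : R) : (forall n, 0 <= u n) -> 0 <= l ->
  (fun n => u n ^+ 2) @ \oo --> l ^+ 2 -> u @ \oo --> l.
Proof.
move=> u0 l0 h.
have -> : u = (fun n => Num.sqrt (u n ^+ 2)).
  by apply/funext => n; rewrite sqrtr_sqr ger0_norm.
rewrite -[l](ger0_norm l0) -sqrtr_sqr.
by apply: continuous_cvg => //; exact: sqrt_continuous.
Qed.

Lemma onemexpRN_le (v : R) : 1 - expR (- v) <= v.
Proof. by have := expR_ge1Dx (- v); lra. Qed.

Lemma onemexpRN_ge (v : R) : v * expR (- v) <= 1 - expR (- v).
Proof.
have := expR_ge1Dx v; rewrite -(ler_pM2r (expR_gt0 (- v))) expRxMexpNx_1.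
by lra.
Qed.

(** Everything follows from m * psi --> x, where m = p n.+1 and psi is the Gaussian angle: cos (j
    n.+1 psi) = cos (j / p * m psi), and U_(m-1)(cos psi) / m = sinc (m psi) / sinc psi with psi -->
    0. *)
Lemma cvg_chebP (M p j : nat) (x : R) : (0 < p)%N -> 0 <= x ->
  (fun n => chebP M (p * n.+1) (j * n.+1) (cos (gauss_angle (p * n.+1) x))) @ \oo
  --> sinc x ^+ M * cos (j%:R * x / p%:R).
Proof.
move=> p0 x0.
pose m n : R := (p * n.+1)%:R; pose v n := x ^+ 2 / (2 * m n ^+ 2).
pose psi n := gauss_angle (p * n.+1) x.
have p1 : 0 < p%:R :> R by rewrite ltr0n.
have m0 n : 0 < m n by rewrite ltr0n muln_gt0 p0.
have v0 n : 0 <= v n by rewrite divr_ge0 ?sqr_ge0// mulr_ge0// sqr_ge0.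
have cpsi n : cos (psi n) = expR (- v n) by exact: cos_gauss_angle.
have psi_itv n : 0 <= psi n <= pi.
  by rewrite /psi /gauss_angle acos_ge0 ?acos_lepi//;
     rewrite -cos_gauss_angle cos_geN1 cos_le1.
have vcvg : v @ \oo --> (0 : R).
  have -> : v = (fun n => x ^+ 2 / (2 * p%:R ^+ 2) * (harmonic n * harmonic n)).
    apply/funext => n; rewrite /v /m natrM /harmonic/=; field.
    by rewrite !gt_eqF.
  set c := x ^+ 2 / _.
  have : (fun n => c * (harmonic n * harmonic n)) @ \oo --> c * (0 * 0 : R).
    by apply: cvgMr; apply: cvgM; exact: cvg_harmonic.
  by rewrite !mulr0.
have evcvg : (fun n => expR (- v n)) @ \oo --> (1 : R).
  rewrite -expR0 -oppr0; apply: continuous_cvg; first exact: continuous_expR.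
  exact: cvgN.
have psicvg : psi @ \oo --> (0 : R).
  apply: sqr_cvg_sqrt => //; first by move=> n; case/andP: (psi_itv n).
  rewrite expr0n/=.
  apply: (@squeeze_cvgr _ _ _ _ (cst 0) (fun n => 32 * v n)); last 2 first.
  - exact: cvg_cst.
  - have : (fun n => 32 * v n) @ \oo --> (32 * 0 : R) by exact: cvgMr.
    by rewrite mulr0.
  near=> n; rewrite sqr_ge0/=; have /andP[a b] := psi_itv n.
  rewrite (le_trans (sqr_le_onemcos _)) ?ger0_norm// cpsi ler_pM2l//.
  exact: onemexpRN_le.
have sc2 : (fun n => sinc (psi n / 2)) @ \oo --> (1 : R).
  have h : (fun n => psi n / 2) @ \oo --> (0 / 2 : R) by exact: cvgMl.
  rewrite mul0r in h; rewrite -[X in _ --> X](@sinc0 R).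
  by apply: continuous_cvg => //; exact: continuous_sinc.
have mpsi : (fun n => m n * psi n) @ \oo --> x.
  apply: sqr_cvg_sqrt => //.
    by move=> n; rewrite mulr_ge0// ?(ltW (m0 n))//; case/andP: (psi_itv n).
  have sn0 : \forall n \near \oo, sinc (psi n / 2) != 0.
    by near=> n; rewrite gt_eqF//; near: n; exact: (cvgr_gt _ sc2).
  (* Both sides come from psi^2 sinc (psi/2)^2 = 4 sin (psi/2)^2 = 2 (1 - cos psi), where cos psi =
     exp(-v) and 2 m^2 v = x^2. *)
  have e : \forall n \near \oo,
      (2 * m n ^+ 2 * (1 - expR (- v n))) * (sinc (psi n / 2))^-1 ^+ 2
      = (m n * psi n) ^+ 2.
    near=> n; have h : sinc (psi n / 2) != 0 by near: n.
    have : psi n * sinc (psi n / 2) = 2 * sin (psi n / 2).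
      by rewrite -mul_sinc; field.
    move=> /(congr1 (fun z => z ^+ 2)); rewrite !exprMn => h1.
    rewrite -cpsi onemcos exprVn; apply: (canLR (mulfK _)).
      by rewrite expf_neq0.
    by rewrite -[RHS]mulrA h1; ring.
  apply: cvg_trans (near_eq_cvg e) _.
  rewrite -[x ^+ 2]mulr1 -[in X in _ * X](expr1n _ 2) -[in X in _ * X ^+ 2]invr1.
  apply: cvgM; last first.
    by rewrite expr2; apply: cvgM; apply: cvgV => //; rewrite oner_neq0.
  have mv n : 2 * m n ^+ 2 * v n = x ^+ 2.
    by rewrite /v; move: (m n) (m0 n) => y y0; field; rewrite gt_eqF.
  apply: (@squeeze_cvgr _ _ _ _ (fun n => x ^+ 2 * expR (- v n)) (cst (x ^+ 2))).
  - near=> n; rewrite -(mv n) -[_ * v n * _]mulrA !ler_wpM2l ?onemexpRN_ge//.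
    + by rewrite mulr_ge0// sqr_ge0.
    + exact: onemexpRN_le.
    + by rewrite mulr_ge0// sqr_ge0.
  - by rewrite -[X in _ --> X]mulr1; apply: cvgMr.
  - exact: cvg_cst.
have sc1 : (fun n => sinc (psi n)) @ \oo --> (1 : R).
  by rewrite -(@sinc0 R); apply: continuous_cvg => //; exact: continuous_sinc.
have e : \forall n \near \oo,
   (expR (- v n) * (sinc (m n * psi n) * (sinc (psi n))^-1)) ^+ M *
     cos (j%:R / p%:R * (m n * psi n)) =
   chebP M (p * n.+1) (j * n.+1) (cos (gauss_angle (p * n.+1) x)).
  near=> n; have h : sinc (psi n) != 0.
    by rewrite gt_eqF//; near: n; exact: (cvgr_gt _ sc1).
  rewrite /chebP -/(psi n) chebT_cos; congr (_ * _); last first.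
    by congr cos; rewrite /m !natrM; field; rewrite gt_eqF.
  congr (_ ^+ _); rewrite -cpsi chebU_sinc// prednK ?muln_gt0 ?p0// -/(m n).
  by rewrite mulKf ?gt_eqF.
apply: cvg_trans (near_eq_cvg e) _.
have -> : sinc x ^+ M * cos (j%:R * x / p%:R) =
  (1 * (sinc x * 1^-1)) ^+ M * cos (j%:R / p%:R * x).
  by rewrite invr1 mulr1 mul1r; congr (_ * cos _); ring.
apply: cvgM.
  have A : (fun n => expR (- v n) * (sinc (m n * psi n) * (sinc (psi n))^-1)) @ \oo
      --> 1 * (sinc x * 1^-1).
    apply: cvgM evcvg _; apply: cvgM; last by apply: cvgV => //; exact: oner_neq0.
    by apply: continuous_cvg => //; exact: continuous_sinc.
  exact: (continuous_cvg _ (@exprn_continuous R M _) A).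
apply: continuous_cvg; first exact: continuous_cos.
exact: cvgMr.
Unshelve. all: by end_near. Qed.

End cheb_limit.

(** * Discrete measures of polynomial growth *)

Section dyadic.
Variable R : realType.

(** The smallest j with x <= 2^j suffices, since then 2^j <= 2 max(1, x). Through this step
    function, bounds on the mass of balls become bounds on power weights, both for sums over
    frequencies and for integrals. *)
Lemma dyadic_weight (M J : nat) (x : R) : 0 <= x -> x <= 2 ^+ J ->
  (Num.max 1 x) ^- M <= 2 ^+ M * \sum_(j < J.+1) (2 ^+ j) ^- M * (x <= 2 ^+ j)%R%:R.
Proof.
move=> x0; elim: J => [|J IH] xJ.
  rewrite big_ord1 expr0 expr1n invr1 mul1r; rewrite expr0 in xJ.
  rewrite xJ mulr1 max_l// expr1n invr1.
  by rewrite exprn_ege1// ler1n.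
have [xl|xl] := leP x (2 ^+ J).
  rewrite (le_trans (IH xl))// [X in _ <= _ * X]big_ord_recr/= mulrDr lerDl.
  by rewrite mulr_ge0 ?exprn_ge0// mulr_ge0// ?ler0n// invr_ge0 !exprn_ge0.
rewrite big_ord_recr/= xJ mulr1 mulrDr ler_wpDl//.
  rewrite mulr_ge0 ?exprn_ge0//; apply: sumr_ge0 => j _.
  by rewrite mulr_ge0// ?ler0n// invr_ge0 !exprn_ge0.
rewrite exprS exprMn invfM mulrA divff ?mul1r ?expf_neq0//.
have J1 : 1 <= 2 ^+ J :> R by rewrite exprn_ege1// ler1n.
rewrite max_r; last by rewrite (le_trans J1)// ltW.
rewrite lef_pV2 ?posrE ?exprn_gt0//; last by rewrite (lt_le_trans _ (ltW xl))// exprn_gt0.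
by apply: lerXn2r; rewrite ?nnegrE ?exprn_ge0// ltW.
Qed.

Lemma sum_geom_half (J : nat) : \sum_(j < J) (2 ^+ j)^-1 <= 2 :> R.
Proof.
suff -> : \sum_(j < J) (2 ^+ j)^-1 = 2 - 2 * (2 ^+ J)^-1 :> R.
  by rewrite gerBl mulr_ge0// invr_ge0 exprn_ge0.
elim: J => [|J IH]; first by rewrite big_ord0 expr0 invr1; ring.
by rewrite big_ord_recr/= IH exprS invfM; field; rewrite expf_neq0.
Qed.

Lemma dyadic_powR (M' j : nat) (Q : R) : 0 <= Q -> Q <= M'%:R ->
  (2 ^+ j) ^- M'.+1 * (2 ^+ j.+1) `^ Q <= 2 `^ Q * (2 ^+ j)^-1.
Proof.
move=> Q0 QM; rewrite [2 ^+ j.+1]exprS powRM ?exprn_ge0// mulrCA ler_wpM2l ?powR_ge0//.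
have j1 : 1 <= 2 ^+ j :> R by rewrite exprn_ege1// ler1n.
have jp : 0 < 2 ^+ j :> R by rewrite exprn_gt0.
have : (2 ^+ j) `^ Q <= (2 ^+ j) ^+ M' :> R.
  by have := ler_powR j1 QM; rewrite powR_mulrn ?exprn_ge0.
move=> h; rewrite exprS invfM -mulrA ler_piMr ?invr_ge0 ?exprn_ge0//.
by rewrite mulrC ler_pdivrMr ?exprn_gt0// mul1r.
Qed.

Lemma ex_dyadic (u : R) : exists J : nat, u <= 2 ^+ J.
Proof. by exists (Num.bound u); apply/ltW/upper_nthrootP. Qed.

Lemma pow_expRN_bounded (q : nat) (x : R) : 0 <= x ->
  x ^+ q.+1 * expR (- x) <= q.+1%:R ^+ q.+1.
Proof.
move=> x0; have q0 : 0 < q.+1%:R :> R by [].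
rewrite expRN ler_pdivrMr ?expR_gt0//.
have -> : x = q.+1%:R * (x / q.+1%:R) by rewrite mulrC divfK// gt_eqF.
rewrite expRM_natl exprMn ler_wpM2l ?exprn_ge0//.
apply: lerXn2r; rewrite ?nnegrE ?divr_ge0 ?expR_ge0//.
by rewrite (le_trans _ (expR_ge1Dx _))// lerDr.
Qed.

End dyadic.

Section windows.
Variables (R : realType) (I : choiceType) (a l : I -> R).
Hypothesis l0 : forall i, 0 <= l i.
Hypothesis fin : forall u, finite_set [set i | l i < u].
Implicit Types (u v : R) (g w : R -> R).

Definition window u := fset_set [set i | l i < u].

Lemma in_window u i : (i \in window u) = (l i < u).
Proof.
by rewrite in_fset_set//; apply/idP/idP; rewrite inE.
Qed.

(** The integral of [g] against the signed measure sum a_i delta_(l_i) cut off at [u]; [Asum] is the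
    same for its total variation. *)
Definition Lsum u g := \sum_(i <- window u) a i * g (l i).
Definition Asum u w := \sum_(i <- window u) `|a i| * w (l i).

Lemma ler_Lsum u g w : (forall x, 0 <= x -> x < u -> `|g x| <= w x) ->
  `|Lsum u g| <= Asum u w.
Proof.
move=> gw; rewrite (le_trans (ler_norm_sum _ _ _))// big_seq [leRHS]big_seq.
by apply: ler_sum => i; rewrite in_window => iu; rewrite normrM ler_wpM2l// gw.
Qed.

Lemma ler_Asum u w w' : (forall x, 0 <= x -> x < u -> w x <= w' x) -> Asum u w <= Asum u w'.
Proof.
move=> gw; rewrite /Asum big_seq [leRHS]big_seq.
by apply: ler_sum => i; rewrite in_window => iu; rewrite ler_wpM2l// gw.
Qed.

Lemma window_subset u v (F : I -> R) : u <= v ->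
  \sum_(i <- window u) F i = \sum_(i <- window v | l i < u) F i.
Proof.
move=> uv; rewrite -[RHS]big_filter; apply: perm_big; apply: uniq_perm.
- exact: fset_uniq.
- by rewrite filter_uniq// fset_uniq.
- move=> i; rewrite mem_filter !in_window.
  by case: ltP => // iu; rewrite (lt_le_trans iu).
Qed.

Lemma Asum_indicator u v w : (forall x, 0 <= w x) ->
  Asum u (fun x => w x * (x < v)%R%:R) <= Asum v w.
Proof.
move=> w0; rewrite /Asum.
have F0 i : 0 <= `|a i| * w (l i) by rewrite mulr_ge0.
have -> : \sum_(i <- window u) `|a i| * (w (l i) * (l i < v)%R%:R) =
  \sum_(i <- window u | l i < v) `|a i| * w (l i).
  rewrite [RHS]big_mkcond; apply: eq_bigr => i _; rewrite mulrA.
  by case: ifP => _; rewrite ?mulr1 ?mulr0.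
have [uv|vu] := leP u v; last by rewrite (window_subset _ (ltW vu)).
rewrite (@le_trans _ _ (\sum_(i <- window u) `|a i| * w (l i)))//.
  by rewrite big_mkcond; apply: ler_sum => i _; case: ifP.
rewrite (window_subset _ uv) big_mkcond; apply: ler_sum => i _.
by case: ifP.
Qed.

Variables (C Q : R).
Hypothesis C0 : 0 <= C.
Hypothesis Q0 : 0 <= Q.
Hypothesis growth : forall u, 1 <= u -> Asum u (fun=> 1) <= C * u `^ Q.

Lemma Asum_weight (M' : nat) u : Q <= M'%:R ->
  Asum u (fun x => (Num.max 1 x) ^- M'.+1) <= C * (2 ^+ M'.+1 * 2 `^ Q * 2).
Proof.
move=> QM; have [J uJ] := ex_dyadic u.
apply: (@le_trans _ _ (\sum_(j < J.+1)
   2 ^+ M'.+1 * ((2 ^+ j) ^- M'.+1 * Asum u (fun x => 1 * (x < 2 ^+ j.+1)%R%:R)))).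
  under [leRHS]eq_bigr do rewrite /Asum !mulr_sumr.
  rewrite exchange_big/= /Asum big_seq [leRHS]big_seq; apply: ler_sum => i.
  rewrite in_window => iu; have liJ := le_trans (ltW iu) uJ.
  apply: (le_trans (ler_wpM2l (normr_ge0 (a i)) (dyadic_weight M'.+1 (l0 i) liJ))).
  rewrite !mulr_sumr; apply: ler_sum => j _; rewrite mulrCA ler_wpM2l ?exprn_ge0//.
  rewrite mulrCA ler_wpM2l ?invr_ge0 ?exprn_ge0// ler_wpM2l// mul1r.
  (* Windows are open, so [l i <= 2 ^ j] is relaxed to [l i < 2 ^ j.+1]; this accounts for the
     factor 2^Q. *)
  case: (leP (l i) (2 ^+ j)) => [li|_]; last by rewrite ler0n.
  by rewrite (le_lt_trans li)// exprS ltr_pMl ?exprn_gt0// ltr1n.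
apply: (@le_trans _ _ (\sum_(j < J.+1) C * (2 ^+ M'.+1 * (2 `^ Q * (2 ^+ j)^-1)))).
  apply: ler_sum => j _; rewrite [leRHS]mulrCA ler_wpM2l ?exprn_ge0//.
  apply: (@le_trans _ _ ((2 ^+ j) ^- M'.+1 * (C * (2 ^+ j.+1) `^ Q))).
    rewrite ler_wpM2l ?invr_ge0 ?exprn_ge0//.
    rewrite (le_trans (Asum_indicator _ _ _))// growth//.
    by rewrite exprn_ege1// ler1n.
  by rewrite mulrCA ler_wpM2l// dyadic_powR.
rewrite -!mulr_sumr ler_wpM2l// -mulrA ler_wpM2l ?exprn_ge0// ler_wpM2l ?powR_ge0//.
exact: sum_geom_half.
Qed.

Definition tail_const (M' : nat) := 2 ^+ M'.+1 * 2 `^ Q * 2 : R.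

Lemma Asum_tail (M' : nat) u (X : R) : 0 < X -> Q <= M'%:R ->
  Asum u (fun x => (Num.max 1 x) ^- M'.+2 * (X <= x)%R%:R) <= C * tail_const M' / X.
Proof.
move=> X0 QM; apply: (@le_trans _ _ (Asum u (fun x => X^-1 * (Num.max 1 x) ^- M'.+1))).
  apply: ler_Asum => x x0 xu.
  have mp : 0 < Num.max 1 x by rewrite lt_max ltr01.
  case: (leP X x) => Xx; last by rewrite mulr0 mulr_ge0// invr_ge0 ?exprn_ge0// ltW.
  rewrite mulr1 exprS invfM ler_wpM2r// ?invr_ge0 ?exprn_ge0// ?(ltW mp)//.
  by rewrite lef_pV2// (le_trans Xx)// le_max lexx orbT.
rewrite /Asum; under eq_bigr do rewrite mulrCA.
by rewrite -mulr_sumr mulrC ler_wpM2r ?invr_ge0 ?(ltW X0)// Asum_weight.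
Qed.

(** The upper limit of [|Lsum u g|] is at most [b]. Unlike a limit, it is subadditive without asking
    for convergence. *)
Definition lsup g (b : R) :=
  forall e, 0 < e -> exists u0, forall u, u0 <= u -> `|Lsum u g| <= b + e.

Lemma lsup_le g b b' : b <= b' -> lsup g b -> lsup g b'.
Proof.
move=> bb gb e e0; have [u0 H] := gb e e0; exists u0 => u uu.
by rewrite (le_trans (H _ uu))// lerD2r.
Qed.

Lemma eq_lsup g g' b : (forall x, 0 <= x -> g x = g' x) -> lsup g b -> lsup g' b.
Proof.
move=> gg gb e e0; have [u0 H] := gb e e0; exists u0 => u uu.
suff -> : Lsum u g' = Lsum u g by exact: H.
by apply: eq_bigr => i _; rewrite gg.
Qed.

Lemma lsupD g g' b b' : lsup g b -> lsup g' b' -> lsup (g \+ g') (b + b').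
Proof.
move=> gb gb' e e0; have e2 : 0 < e / 2 by rewrite divr_gt0.
have [u0 H] := gb _ e2; have [u0' H'] := gb' _ e2.
exists (Num.max u0 u0') => u; rewrite ge_max => /andP[/H h /H' h'].
rewrite /Lsum; under eq_bigr do rewrite mulrDr.
rewrite big_split/= (le_trans (ler_normD _ _))// (le_trans (lerD h h'))//.
by rewrite [e in leRHS]splitr; lra.
Qed.

Lemma lsupZ g b (k : R) : 0 <= b -> lsup g b -> lsup (fun x => k * g x) (`|k| * b).
Proof.
move=> b0 gb e e0; have k1 : 0 < `|k| + 1 by rewrite ltr_wpDl.
have [|u0 H] := gb (e / (`|k| + 1)); first by rewrite divr_gt0.
exists u0 => u /H h; rewrite /Lsum; under eq_bigr do rewrite mulrCA.
rewrite -mulr_sumr normrM (le_trans (ler_wpM2l _ h))// mulrDr lerD2l.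
by rewrite mulrCA ler_piMr ?(ltW e0)// ler_pdivrMr// mul1r lerDl.
Qed.

Lemma lsup_sum D (k : nat -> R) (g : nat -> R -> R) b : 0 <= b ->
  (forall i, (i < D)%N -> lsup (g i) b) ->
  lsup (fun x => \sum_(i < D) k i * g i x) ((\sum_(i < D) `|k i|) * b).
Proof.
move=> b0; elim: D => [|D IH] H.
  move=> e e0; exists 0 => u _; rewrite /Lsum big1 ?normr0.
    by rewrite big_ord0 mul0r add0r ltW.
  by move=> i _; rewrite big_ord0 mulr0.
rewrite big_ord_recr/= mulrDl.
have H1 : lsup (fun x => \sum_(i < D) k i * g i x) ((\sum_(i < D) `|k i|) * b).
  by apply: IH => i iD; apply: H; exact: leqW.
apply: eq_lsup (lsupD H1 (lsupZ (k D) b0 (H D (ltnSn D)))) => x _ /=.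
by rewrite big_ord_recr.
Qed.

Lemma lsup_dist g g' b d : (forall u, `|Lsum u (g \- g')| <= d) -> lsup g b -> lsup g' (b + d).
Proof.
move=> H gb e /gb[u0 h]; exists u0 => u /h hu.
have -> : Lsum u g' = Lsum u g - Lsum u (g \- g').
  by rewrite /Lsum -sumrB; apply: eq_bigr => i _ /=; ring.
by rewrite (le_trans (ler_normB _ _))// addrAC lerD.
Qed.

End windows.

(** * Finite propagation speed and kernel localization *)

Lemma cvgn_sum (R : realType) (I : Type) (s : seq I) (f : I -> nat -> R) (k : I -> R) :
  (forall i, f i @ \oo --> k i) ->
  (fun n => \sum_(i <- s) f i n) @ \oo --> \sum_(i <- s) k i.
Proof.
move=> H; elim: s => [|i s IH].
  under eq_fun do rewrite big_nil; rewrite big_nil; exact: cvg_cst.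
under eq_fun do rewrite big_cons; rewrite big_cons; exact: cvgD.
Qed.

Section vanishing.
Variables (R : realType) (I : choiceType) (a l : I -> R).
Hypothesis l0 : forall i, 0 <= l i.
Hypothesis fin : forall u, finite_set [set i | l i < u].
Variables (C Q : R).
Hypothesis C0 : 0 <= C.
Hypothesis Q0 : 0 <= Q.
Hypothesis growth : forall u, 1 <= u -> Asum a l u (fun=> 1) <= C * u `^ Q.
Variables (t0 G c N : R).
Hypotheses (t00 : 0 < t0) (G0 : 0 <= G) (c0 : 0 <= c) (N1 : 1 <= N).
Hypothesis gauss : forall t : R, 0 < t -> t <= t0 ->
  lsup a l (fun x => expR (- (x ^+ 2 * t))) (G * t `^ (- c) * expR (- (N ^+ 2 / t))).

(** Compares the coefficient bound 3^D with exp(3 D / 2); the proof cubes exp(1/2) >= 3/2. *)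
Lemma expR_three_half : 3 <= expR (3 / 2) :> R.
Proof.
have -> : 3 / 2 = 3%:R * (1 / 2) :> R by field.
rewrite expRM_natl; have := expR_ge1Dx (1 / 2 : R).
move: (expR _) => z h; have -> : z ^+ 3 = z * (z * z) by ring.
by nra.
Qed.

(** The condition on M p + j says that the limit function has exponential type M + j / p at most N;
    it bounds the degree D of [chebP] by m N. Each monomial is a Gaussian of time tau <= N / (2 m),
    for which the hypothesis gives exp(-2 m N). The coefficients contribute at most 3^D <= exp(3 m N
    / 2), and exp(-m N / 2) <= exp(-m / 2) remains. *)
Lemma lsup_chebP (M p j n : nat) : (0 < M)%N -> (0 < p)%N ->
  (M * p + j)%:R <= p%:R * N -> N <= 2 * t0 * (p * n.+1)%:R ->
  lsup a l (fun x => chebP M (p * n.+1) (j * n.+1) (cos (gauss_angle (p * n.+1) x)))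
    (G * (2 * (p * n.+1)%:R ^+ 2) `^ c * expR (- ((p * n.+1)%:R / 2))).
Proof.
move=> M0 p0 hN ht; set m := (p * n.+1)%N.
have m0 : (0 < m)%N by rewrite muln_gt0 p0.
have m1 : 0 < m%:R :> R by rewrite ltr0n.
have m11 : 1 <= m%:R :> R by rewrite ler1n.
have [b be bW] := @powsum_chebP R M m (j * n.+1) m0.
set D := (M * m.-1 + j * n.+1).+1 in be bW.
have DM : (M * m + j * n.+1)%:R <= m%:R * N.
  rewrite /m mulnA -mulnDl natrM natrM [X in _ <= X]mulrAC.
  exact: ler_wpM2r.
pose tau i : R := (i + M)%:R / (2 * m%:R ^+ 2).
have tau0 i : 0 < tau i by rewrite divr_gt0 ?ltr0n ?addn_gt0 ?M0 ?orbT// mulr_gt0// exprn_gt0.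
have iD i : (i < D)%N -> (i + M)%:R <= m%:R * N.
  move=> h; apply: le_trans DM; rewrite ler_nat; move: h; rewrite /D ltnS => h.
  rewrite (leq_trans (leq_add h (leqnn M)))// addnAC leq_add2r.
  by rewrite -mulnSr prednK.
have tauD i : (i < D)%N -> tau i <= N / (2 * m%:R).
  move=> h; rewrite /tau ler_pdivrMr ?mulr_gt0 ?exprn_gt0//.
  rewrite (le_trans (iD _ h))// le_eqVlt; apply/orP; left; apply/eqP.
  by field; rewrite gt_eqF.
pose bd := G * (2 * m%:R ^+ 2) `^ c * expR (- (2 * m%:R * N)).
have bd0 : 0 <= bd by rewrite !mulr_ge0 ?powR_ge0 ?expR_ge0.
have H i : (i < D)%N -> lsup a l (fun x => expR (- (x ^+ 2 * tau i))) bd.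
  move=> h; apply: lsup_le (gauss (tau0 i) _); last first.
    rewrite (le_trans (tauD _ h))// ler_pdivrMr ?mulr_gt0//.
    by rewrite (le_trans ht)// mulrCA mulrA.
  apply: ler_pM; rewrite ?mulr_ge0 ?powR_ge0 ?expR_ge0//.
    rewrite ler_wpM2l//.
    have -> : tau i `^ (- c) = ((tau i)^-1) `^ c.
      by rewrite -powR_inv1 ?(ltW (tau0 i))// -powRrM mulN1r.
    have m20 : 0 <= 2 * m%:R ^+ 2 :> R by apply: mulr_ge0 => //; exact: sqr_ge0.
    have ti : (tau i)^-1 <= 2 * m%:R ^+ 2.
      rewrite /tau invf_div ler_piMr// invf_le1 ?ltr0n ?addn_gt0 ?M0 ?orbT//.
      by rewrite ler1n addn_gt0 M0 orbT.
    apply: (ge0_ler_powR c0 _ _ ti); rewrite nnegrE//.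
    by rewrite invr_ge0 ltW.
  rewrite ler_expR lerN2 ler_pdivlMr//.
  have N0 : 0 < N by exact: lt_le_trans ltr01 N1.
  rewrite (le_trans (ler_wpM2l _ (tauD _ h))) ?mulr_ge0 ?(ltW N0)//.
  rewrite le_eqVlt; apply/orP; left; apply/eqP; field.
  by rewrite gt_eqF.
have := lsup_sum l0 b bd0 H; move=> {}H.
apply: (eq_lsup l0); last first.
  apply: lsup_le H.
  apply: (@le_trans _ _ (3 ^+ (M * m + j * n.+1) * bd)); first by rewrite ler_wpM2r.
  have -> : 3 ^+ (M * m + j * n.+1) * bd = G * (2 * m%:R ^+ 2) `^ c *
     (3 ^+ (M * m + j * n.+1) * expR (- (2 * m%:R * N))) by rewrite /bd; ring.
  rewrite ler_wpM2l ?mulr_ge0 ?powR_ge0//.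
  apply: (@le_trans _ _ (expR (3 / 2) ^+ (M * m + j * n.+1) * expR (- (2 * m%:R * N)))).
    by rewrite ler_wpM2r ?expR_ge0//; apply: lerXn2r; rewrite ?nnegrE ?expR_ge0// expR_three_half.
  rewrite -expRM_natl -expRD ler_expR.
  have mN : m%:R <= m%:R * N by rewrite ler_peMr// ltW.
  by move: DM; move: (M * m + j * n.+1)%:R => z DM; lra.
move=> x _; rewrite be; apply: eq_bigr => i _; congr (_ * _).
rewrite cos_gauss_angle -expRM_natl; congr expR.
by rewrite /tau; ring.
Qed.

Lemma chebP_bound_small (e : R) (p : nat) : (0 < p)%N -> 0 < e -> \forall n \near \oo,
  G * (2 * (p * n.+1)%:R ^+ 2) `^ c * expR (- ((p * n.+1)%:R / 2)) <= e.
Proof.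
move=> p0 e0.
pose q := Num.bound c; have cq : c <= q%:R by apply/ltW/archi_boundP.
pose K := G * 2 ^+ q * 2 ^+ (2 * q).+1 * (2 * q).+1%:R ^+ (2 * q).+1.
have K0 : 0 <= K by apply: mulr_ge0; [do 2 apply: mulr_ge0 => //|]; apply: exprn_ge0.
have Kn : \forall n \near \oo, K / n.+1%:R <= e.
  have : (fun n => K * harmonic n) @ \oo --> (K * 0 : R) by apply: cvgMr; exact: cvg_harmonic.
  rewrite mulr0 => /cvgr_le; exact.
apply: filterS Kn => n; apply: le_trans; set m := (p * n.+1)%N.
have m0 : (0 < m)%N by rewrite muln_gt0 p0.
have m1 : 0 < m%:R :> R by rewrite ltr0n.
have m11 : 1 <= m%:R :> R by rewrite ler1n.
have nm : n.+1%:R <= m%:R :> R by rewrite ler_nat leq_pmull.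
apply: (@le_trans _ _ (K / m%:R)); last first.
  by rewrite ler_wpM2l// lef_pV2 ?posrE.
rewrite ler_pdivlMr//.
have m2 : 1 <= 2 * m%:R ^+ 2 :> R by have := exprn_ege1 2 m11; lra.
apply: (@le_trans _ _ (G * (2 * m%:R ^+ 2) ^+ q * expR (- (m%:R / 2)) * m%:R)).
  apply: ler_wpM2r; first exact: ler0n.
  apply: ler_wpM2r; first exact: expR_ge0.
  apply: ler_wpM2l; first exact: G0.
  by have := ler_powR m2 cq; rewrite powR_mulrn// (le_trans ler01).
have mh : 0 <= m%:R / 2 :> R by rewrite divr_ge0.
have h := @pow_expRN_bounded R (2 * q) (m%:R / 2) mh.
have -> : G * (2 * m%:R ^+ 2) ^+ q * expR (- (m%:R / 2)) * m%:R =
  G * 2 ^+ q * 2 ^+ (2 * q).+1 * ((m%:R / 2) ^+ (2 * q).+1 * expR (- (m%:R / 2))).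
  have -> : (2 * m%:R ^+ 2) ^+ q = 2 ^+ q * m%:R ^+ (2 * q) :> R by rewrite exprMn -exprM.
  rewrite expr_div_n [m%:R ^+ (2 * q).+1]exprS.
  have : 2 ^+ (2 * q).+1 != 0 :> R by rewrite expf_neq0.
  move: (2 ^+ (2 * q).+1) => z z0.
  by field; exact: z0.
apply: ler_wpM2l => //.
by apply: mulr_ge0; [apply: mulr_ge0 => //|]; apply: exprn_ge0.
Qed.

Lemma sinc_weight (M : nat) x y : 0 <= x ->
  `|sinc x ^+ M * cos y| <= (Num.max 1 x) ^- M :> R.
Proof.
move=> x0; rewrite normrM -[leRHS]mulr1 ler_pM// ?cos_max//.
rewrite normrX -exprVn; apply: lerXn2r; rewrite ?nnegrE ?invr_ge0 ?le_max ?ler01//.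
by have [x1|x1] := leP 1 x; [rewrite sinc_leV// (lt_le_trans ltr01)|rewrite invr1 sinc_le1].
Qed.

(* The measure [sum a_i delta_(l_i)] annihilates even functions of exponential type at most [N]
   with enough decay: such functions are limits of polynomials in [exp (- x ^ 2 / (2 m ^ 2))]
   as [m] grows, and these only involve Gaussians of width [O (N / m)]. *)
Lemma finite_propagation (M' p j : nat) : Q <= M'%:R -> (0 < p)%N ->
  (M'.+2 * p + j)%:R <= p%:R * N ->
  lsup a l (fun x => sinc x ^+ M'.+2 * cos (j%:R * x / p%:R)) 0.
Proof.
move=> QM p0 hN e e0.
set M := M'.+2; pose E (x : R) := sinc x ^+ M * cos (j%:R * x / p%:R).
pose P (n : nat) (x : R) := chebP M (p * n.+1) (j * n.+1) (cos (gauss_angle (p * n.+1) x)).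
pose K := C * tail_const Q M'.
have K0 : 0 <= K.
  by rewrite mulr_ge0// /tail_const !mulr_ge0 ?exprn_ge0 ?powR_ge0.
(* Beyond [X] both functions are at most max(1, x)^-M, so the tail costs at most e/4 whatever n is;
   below [X] only finitely many frequencies remain and pointwise convergence is enough. The other
   two quarters of [e] are the Chebyshev bound and the slack of [lsup]. *)
pose X := 8 * K / e + 1; have X0 : 0 < X by rewrite ltr_wpDl// divr_ge0 ?mulr_ge0// ltW.
have KX : 2 * (K / X) <= e / 4.
  rewrite mulrA ler_pdivrMr// /X mulrDr mulr1.
  have -> : e / 4 * (8 * K / e) = 2 * K by field; rewrite gt_eqF.
  by rewrite lerDl divr_ge0// ltW.
have fincvg : (fun n => \sum_(i <- window l X) `|a i| * `|P n (l i) - E (l i)|) @ \oo --> (0 : R).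
  have z : \sum_(i <- window l X) `|a i| * `|E (l i) - E (l i)| = 0.
    by rewrite big1// => i _; rewrite subrr normr0 mulr0.
  rewrite -[X in _ --> X]z.
  apply: (@cvgn_sum R I (window l X) (fun i n => `|a i| * `|P n (l i) - E (l i)|)
    (fun i => `|a i| * `|E (l i) - E (l i)|)) => i.
  apply: cvgMr; apply: cvg_norm; apply: cvgB; last exact: cvg_cst.
  exact: cvg_chebP.
have bt : \forall n \near \oo, N <= 2 * t0 * (p * n.+1)%:R.
  near=> n; apply: (@le_trans _ _ (2 * t0 * n.+1%:R)); last first.
    by rewrite ler_wpM2l ?mulr_ge0 ?(ltW t00)// ler_nat leq_pmull.
  rewrite mulrC -ler_pdivrMr ?mulr_gt0//.
  rewrite (le_trans (ltW (archi_boundP _)))//.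
    by rewrite divr_ge0 ?mulr_ge0 ?(ltW t00)// (le_trans ler01 N1).
  rewrite ler_nat ltnW// ltnS; near: n; exact: nbhs_infty_ge.
have e4 : 0 < e / 4 by rewrite divr_gt0.
have [n [nf nb nt]] : exists n, [/\ \sum_(i <- window l X) `|a i| * `|P n (l i) - E (l i)| <= e / 4,
    G * (2 * (p * n.+1)%:R ^+ 2) `^ c * expR (- ((p * n.+1)%:R / 2)) <= e / 4 &
    N <= 2 * t0 * (p * n.+1)%:R].
  near \oo => n; exists n; split; near: n => //.
  - by move/cvgr_le : fincvg; apply.
  - exact: chebP_bound_small.
have lP := lsup_le nb (lsup_chebP (isT : (0 < M)%N) p0 hN nt).
have PE u : `|Lsum a l u (P n \- E)| <= e / 4 + e / 4.
  pose w (x : R) : R := (x < X)%R%:R * `|P n x - E x| + 2 * ((Num.max 1 x) ^- M * (X <= x)%R%:R).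
  apply: (@le_trans _ _ (Asum a l u w)).
    apply: (@ler_Lsum R I a l l0 fin u (P n \- E) w) => x x0 _; rewrite /w /=; case: (ltP x X) => xX.
      by rewrite mul1r !mulr0 addr0.
    rewrite mul0r add0r mulr1 (le_trans (ler_normB _ _))// mulr2n mulrDl mul1r.
    by rewrite lerD//; [apply: chebP_le => //; rewrite muln_gt0 p0|exact: sinc_weight].
  have -> : Asum a l u w =
    Asum a l u (fun x => `|P n x - E x| * (x < X)%R%:R) +
    2 * Asum a l u (fun x => (Num.max 1 x) ^- M * (X <= x)%R%:R).
    by rewrite /Asum mulr_sumr -big_split; apply: eq_bigr => i _ /=; rewrite /w; ring.
  apply: lerD.
    by apply: le_trans nf; apply: (Asum_indicator a fin).
  apply: le_trans KX; rewrite ler_wpM2l//.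
  exact: (Asum_tail l0 fin C0 Q0 growth).
have [u0 H] := lsup_dist PE lP e4.
by exists u0 => u /H h; rewrite add0r (le_trans h)//; lra.
Unshelve. all: by end_near. Qed.

End vanishing.

(** For N < 2 M the total variation on [0, 1[ is a sufficient bound. Otherwise half of N pays for
    the type M of sinc^M and the other half, N' = floor (N/2), for Jackson's approximation of the
    filter divided by sinc^M. Its error of order N'^-S is summed against max(1, x)^-M. The constant
    depends only on the filter, S and Q. *)
Lemma tauberian (R : realType) (h : R -> R) (S : nat) (Q : R) :
  lowpass_filter h -> 0 <= Q ->
  exists2 C1 : R, 0 <= C1 &
  forall (I : choiceType) (a l : I -> R) (C t0 G c N : R),
    (forall i, 0 <= l i) -> (forall u, finite_set [set i | l i < u]) ->
    0 <= C -> (forall u, 1 <= u -> Asum a l u (fun=> 1) <= C * u `^ Q) ->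
    0 < t0 -> 0 <= G -> 0 <= c -> 0 <= N ->
    (forall t : R, 0 < t -> t <= t0 ->
      lsup a l (fun x => expR (- (x ^+ 2 * t))) (G * t `^ (- c) * expR (- (N ^+ 2 / t)))) ->
    `|Lsum a l 1 h| <= C1 * C * (Num.max 1 N) ^- S.
Proof.
move=> fh Q0.
pose M' := Num.bound Q; have QM : Q <= M'%:R by apply/ltW/archi_boundP.
pose M := M'.+2.
have [F [bF FN hF]] := lowpass_factor S M fh.
have [B B0 HB] := bandlimited_approx bF FN.
have [k1 k10 k1E] : exists2 k1 : R, 0 <= k1 & 514 = k1 by exists 514.
rewrite k1E in HB.
have [K K0 KE] : exists2 K : R, 0 <= K & K = tail_const Q M'.
  exists (tail_const Q M') => //; rewrite /tail_const.
  by apply: mulr_ge0 => //; apply: mulr_ge0; rewrite ?powR_ge0 ?exprn_ge0.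
have h1 x : `|h x| <= 1.
  by case: fh => _ h01 _ _ _; have /andP[h0 h1] := h01 x; rewrite ger0_norm.
have hz : forall x, 1 <= x -> h x = 0 by case: fh.
pose M2 : R := (2 * M)%:R.
have M21 : 1 <= M2 by rewrite ler1n.
(* The factor 4 comes from N <= 4 N' below. *)
pose k := k1 * 4; have k0 : 0 <= k by rewrite mulr_ge0.
have M20 : 0 <= M2 by exact: le_trans M21.
have kS := exprn_ge0 S k0; have MS := exprn_ge0 S M20.
have KB := mulr_ge0 (mulr_ge0 K0 B0) kS.
exists (M2 ^+ S + K * B * k ^+ S); first exact: addr_ge0.
move=> I a l C t0 G c N l0 fin C0 growth t00 G0 c0 N0 gauss.
have mN : 1 <= Num.max 1 N by rewrite le_max lexx.
have mN0 : 0 < Num.max 1 N by rewrite (lt_le_trans ltr01).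
have [NM|NM] := ltP N M2.
  have tr : `|Lsum a l 1 h| <= C.
    have := growth 1 (lexx _); rewrite powR1 mulr1; apply: le_trans.
    by apply: (@ler_Lsum R I a l l0 fin 1 h (fun=> 1)) => x _ _.
  rewrite (le_trans tr)// mulrDl mulrDl ler_wpDr//.
    by apply: mulr_ge0; [exact: mulr_ge0|rewrite invr_ge0 exprn_ge0// ltW].
  rewrite mulrAC ler_peMl// ler_pdivlMr ?exprn_gt0// mul1r.
  apply: lerXn2r; rewrite ?nnegrE ?(ltW mN0) ?(le_trans ler01 M21)//.
  by rewrite ge_max M21 ltW.
have N1 : 1 <= N by rewrite (le_trans M21).
rewrite max_r//.
pose N' := Num.truncn (N / 2).
have N20 : 0 <= N / 2 by rewrite divr_ge0.
have /andP[N'l N'g] : N'%:R <= N / 2 < N'.+1%:R by exact: truncn_itv.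
have MN' : (M <= N')%N.
  rewrite /N' truncn_ge_nat// ler_pdivlMr// -natrM mulnC; exact: NM.
have N'0 : (0 < N')%N by exact: leq_trans MN'.
have NN' : N <= 4 * N'%:R.
  have : 1 <= N'%:R :> R by rewrite ler1n.
  by move: N'g; rewrite -[N'.+1%:R]natr1; lra.
have N'p : 0 < N'%:R :> R by rewrite ltr0n.
have [e [e0 eN eE]] : exists e : R, [/\ 0 <= e, e <= B * k ^+ S / N ^+ S &
    e = (k1 / N'%:R) ^+ S * B].
  have q0 : 0 <= k1 / N'%:R :> R by apply: divr_ge0.
  exists ((k1 / N'%:R) ^+ S * B); split => //.
    by apply: mulr_ge0 => //; exact: exprn_ge0.
  rewrite [leLHS]mulrC -mulrA ler_wpM2l// -expr_div_n.
  apply: lerXn2r; rewrite ?nnegrE//; first by rewrite divr_ge0.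
  have Np : 0 < N by exact: lt_le_trans ltr01 N1.
  rewrite ler_pdivrMr// mulrAC ler_pdivlMr//.
  by apply: (le_trans (ler_wpM2l _ NN')) => //; rewrite mulrA.
have B20 : 0 <= 2 * B + e by apply: addr_ge0 => //; exact: mulr_ge0.
have BK : 0 <= (2 * B + e) * (C * K) by apply: mulr_ge0 => //; exact: mulr_ge0.
(* The last term comes from frequencies x >= p, where the approximant is only bounded; it disappears
   as p tends to infinity. *)
suff H (p : nat) : (0 < p)%N -> `|Lsum a l 1 h| <= C * K * e + (2 * B + e) * (C * K) / p%:R.
  have Hlim : `|Lsum a l 1 h| <= C * K * e.
    apply/ler_addgt0Pr => d d0.
    pose p := (Num.bound ((2 * B + e) * (C * K) / d)).+1.
    rewrite (le_trans (H p isT))// lerD2l ler_pdivrMr// [leRHS]mulrC -ler_pdivrMr//.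
    rewrite ltW// (lt_trans (archi_boundP _)) ?ltr_nat//.
    by apply: divr_ge0 => //; exact: ltW.
  rewrite (le_trans Hlim)// mulrDl mulrDl ler_wpDl//.
    by apply: mulr_ge0; [exact: mulr_ge0|rewrite invr_ge0 exprn_ge0].
  apply: (le_trans (ler_wpM2l (mulr_ge0 C0 K0) eN)).
  rewrite le_eqVlt; apply/orP; left; apply/eqP.
  by move: (k ^+ S) (N ^- S) => z z'; ring.
move=> p0.
pose m := (N' * p).-1.
have Np2 : (1 < N' * p)%N by rewrite (leq_trans _ (leq_pmulr _ p0))// (leq_trans _ MN').
have m1 : m.+1 = (N' * p)%N by rewrite prednK// ltnW.
have [|al [gF gb]] := HB p m p0; first by rewrite -ltnS m1.
set g := fun u : R => \sum_(j < m.+2) al j * cos (j%:R * u / p%:R) in gF gb.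
have pp : 0 < p%:R :> R by rewrite ltr0n.
have ee : (k1 * p%:R / m.+1%:R) ^+ S * B = e.
  rewrite eE m1 natrM; congr (_ ^+ _ * _); field.
  by rewrite !gt_eqF.
rewrite ee in gF; have {}gb x : `|g x| <= B + e by rewrite -ee; exact: gb.
have lg : lsup a l (fun x => sinc x ^+ M * g x) 0.
  have H (j : nat) : (j < m.+2)%N ->
      lsup a l (fun x => sinc x ^+ M * cos (j%:R * x / p%:R)) 0.
    move=> jm; apply: (finite_propagation l0 fin C0 Q0 growth t00 G0 c0 N1 gauss QM p0).
    have jN : (j <= N' * p)%N by rewrite -m1 -ltnS.
    apply: (@le_trans _ _ (N' * p + N' * p)%:R).
      by rewrite ler_nat leq_add// leq_mul2r MN' orbT.
    rewrite natrD natrM; have : p%:R * N'%:R <= p%:R * (N / 2) by rewrite ler_wpM2l// ltW.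
    by lra.
  have := lsup_sum l0 al (lexx 0) H; rewrite mulr0.
  apply: (eq_lsup l0) => x _; rewrite /g mulr_sumr; apply: eq_bigr => j _; ring.
have FB x : 1 < `|x| -> F x = 0 by exact: bump_supp bF x.
pose w (x : R) := e * (Num.max 1 x) ^- M + (2 * B + e) * ((Num.max 1 x) ^- M * (p%:R <= x)%R%:R).
have Hd u : `|Lsum a l u ((fun x => sinc x ^+ M * g x) \- h)| <=
    C * K * e + (2 * B + e) * (C * K) / p%:R.
  apply: (@le_trans _ _ (Asum a l u w)).
    apply: (@ler_Lsum R I a l l0 fin u _ w) => x x0 _ /=.
    have sw := sinc_weight M 0 x0; rewrite cos0 mulr1 in sw.
    rewrite hF -mulrBr normrM.
    apply: (le_trans (ler_wpM2r (normr_ge0 _) sw)); rewrite /w.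
    rewrite [leRHS](_ : _ = (Num.max 1 x) ^- M * (e + (2 * B + e) * (p%:R <= x)%R%:R)); last by ring.
    apply: ler_wpM2l; first by rewrite invr_ge0 exprn_ge0// le_max ler01.
    case: (leP p%:R x) => px.
      have [xp|xp] := ltP x (pi * p%:R).
        rewrite mulr1 distrC (le_trans (gF _ _)) ?ger0_norm//.
        by rewrite lerDl addr_ge0// mulr_ge0.
      rewrite FB ?subr0; last first.
        rewrite ger0_norm// (lt_le_trans _ xp)//.
        have p1 : 1 <= p%:R :> R by rewrite ler1n.
        by have := @pi_ge2 R; nra.
      by rewrite mulr1 (le_trans (gb _))//; move: B0 e0; lra.
    rewrite mulr0 addr0 distrC gF// ger0_norm// (lt_le_trans px)//.
    by rewrite ler_peMl// (le_trans _ (@pi_ge2 R))// ler1n.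
  have -> : Asum a l u w = e * Asum a l u (fun x => (Num.max 1 x) ^- M) +
     (2 * B + e) * Asum a l u (fun x => (Num.max 1 x) ^- M * (p%:R <= x)%R%:R).
    by rewrite /Asum !mulr_sumr -big_split; apply: eq_bigr => i _ /=; rewrite /w; ring.
  apply: lerD.
    rewrite mulrC; apply: ler_wpM2r => //.
    have AW := Asum_weight l0 fin C0 Q0 growth u QM; rewrite -/(tail_const Q M') -KE in AW.
    rewrite (le_trans _ AW)//.
    apply: (@ler_Asum R I a l l0 fin u _ _) => x x0 _.
    rewrite lef_pV2 ?posrE ?exprn_gt0 ?lt_max ?ltr01//.
    by apply: ler_weXn2l => //; rewrite le_max lexx.
  rewrite -mulrA; apply: ler_wpM2l; first by rewrite addr_ge0// mulr_ge0.
  by rewrite KE; exact: (Asum_tail l0 fin C0 Q0 growth).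
apply/ler_addgt0Pr => d d0.
have [u0 Hu0] := lsup_dist Hd lg d0.
(* Since [h] vanishes from 1 on, its sum over any window beyond 1 is already the sum over the window
   1. *)
have := Hu0 (Num.max u0 1); rewrite le_max lexx => /(_ isT); rewrite add0r.
suff -> : Lsum a l (Num.max u0 1) h = Lsum a l 1 h by [].
have u1 : 1 <= Num.max u0 1 by rewrite le_max lexx orbT.
rewrite /Lsum (window_subset fin _ u1) [RHS]big_mkcond; apply: eq_bigr => i _.
by case: ltP => // li; rewrite hz// mulr0.
Qed.

(** * Means against localized kernels *)

Section integration.
Variables (R : realType) (X : data_space R).
Implicit Types (f g : X -> R).

Let T := g_sigma_algebraType (@open X).

(** A class closed under sums and products and consisting of integrable functions, the measure being
    a probability; by compactness it contains the continuous functions. *)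
Definition bounded_measurable f : Prop :=
  measurable_fun [set: T] (f : T -> R) /\ exists B, forall x, `|f x| <= B.

Definition mean f : R := \int[ds_mu X]_x f x.

Lemma continuous_bounded f : continuous f -> exists2 B, 0 <= B & forall x, `|f x| <= B.
Proof.
move=> cf.
have cn : {within [set: X], continuous (fun x => `|f x|)}.
  apply: continuous_subspaceT => x.
  by apply: continuous_comp; [exact: cf|exact: norm_continuous].
have X0 : [set: X] !=set0 by exists point.
have [c _ cM] := compact_EVT_max X0 (@ds_compact R X) cn.
by exists `|f c| => // x; apply: cM; rewrite inE.
Qed.

Lemma bounded_measurable_continuous f : continuous f -> bounded_measurable f.
Proof.
move=> cf; split; last by have [B _ fB] := continuous_bounded cf; exists B.
apply: (measurability _ (RGenOpens.measurableE R)).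
move=> _ [_ [a [b ->] <-]]; rewrite setTI; apply: sub_sigma_algebra.
by move/continuousP: cf; apply; exact: interval_open.
Qed.

Lemma bounded_measurable_integrable f : bounded_measurable f ->
  (ds_mu X).-integrable [set: T] (EFin \o f).
Proof.
move=> [mf [B fB]]; apply: measurable_bounded_integrable => //.
  by apply: le_lt_trans (probability_le1 (ds_mu X) (@measurableT _ T)) (ltry _).
exists B; split; first exact: num_real.
by move=> M BM x _; rewrite /= (le_trans (fB x))// ltW.
Qed.

Lemma bounded_measurableD f g :
  bounded_measurable f -> bounded_measurable g -> bounded_measurable (fun x => f x + g x).
Proof.
move=> [mf [B fB]] [mg [B' gB]]; split; first exact: measurable_funD.
by exists (B + B') => x; rewrite (le_trans (ler_normD _ _))// lerD.
Qed.

Lemma bounded_measurableM f g :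
  bounded_measurable f -> bounded_measurable g -> bounded_measurable (fun x => f x * g x).
Proof.
move=> [mf [B fB]] [mg [B' gB]]; split; first exact: measurable_funM.
by exists (B * B') => x; rewrite normrM ler_pM.
Qed.

Lemma bounded_measurable_cst (a : R) : bounded_measurable (fun=> a).
Proof. by split; [exact: measurable_cst|exists `|a|]. Qed.

Lemma bounded_measurableZ (a : R) f :
  bounded_measurable f -> bounded_measurable (fun x => a * f x).
Proof. exact/bounded_measurableM/bounded_measurable_cst. Qed.

Lemma bounded_measurable_norm f :
  bounded_measurable f -> bounded_measurable (fun x => `|f x|).
Proof.
move=> [mf [B fB]]; split; last by exists B => x; rewrite normr_id.
exact: measurableT_comp.
Qed.

Lemma bounded_measurable_sum (I : Type) (s : seq I) (f : I -> X -> R) :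
  (forall i, bounded_measurable (f i)) -> bounded_measurable (fun x => \sum_(i <- s) f i x).
Proof.
move=> H; elim: s => [|i s IH].
  by under eq_fun do rewrite big_nil; exact: bounded_measurable_cst.
by under eq_fun do rewrite big_cons; exact: bounded_measurableD.
Qed.

Lemma bounded_measurable_indic (A : set X) : @measurable _ T A ->
  bounded_measurable (\1_A : X -> R).
Proof.
move=> mA; split; first exact: measurable_indic.
by exists 1 => x; rewrite indicE normr_nat; case: (_ \in _).
Qed.

Lemma meanD f g : bounded_measurable f -> bounded_measurable g ->
  mean (fun x => f x + g x) = mean f + mean g.
Proof. by move=> bf bg; apply: RintegralD => //; exact: bounded_measurable_integrable. Qed.

Lemma meanZ (a : R) f : bounded_measurable f -> mean (fun x => a * f x) = a * mean f.
Proof. by move=> bf; apply: RintegralZl => //; exact: bounded_measurable_integrable. Qed.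

Lemma mean_sum (I : Type) (s : seq I) (f : I -> X -> R) :
  (forall i, bounded_measurable (f i)) ->
  mean (fun x => \sum_(i <- s) f i x) = \sum_(i <- s) mean (f i).
Proof.
move=> H; elim: s => [|i s IH].
  under [X in mean X]eq_fun do rewrite big_nil.
  by rewrite big_nil /mean Rintegral_cst// mul0r.
under [X in mean X]eq_fun do rewrite big_cons.
by rewrite big_cons meanD ?IH//; exact: bounded_measurable_sum.
Qed.

Lemma le_mean f g : bounded_measurable f -> bounded_measurable g ->
  (forall x, f x <= g x) -> mean f <= mean g.
Proof.
move=> bf bg fg; apply: le_Rintegral => //; exact: bounded_measurable_integrable.
Qed.

Lemma normr_mean_le f g : bounded_measurable f -> bounded_measurable g ->
  (forall x, `|f x| <= g x) -> `|mean f| <= mean g.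
Proof.
move=> bf bg fg; apply: (@le_trans _ _ (mean (fun x => `|f x|))).
  by apply: le_normr_Rintegral => //; exact: bounded_measurable_integrable.
by apply: le_mean => //; exact: bounded_measurable_norm.
Qed.

Lemma mean_indic (A : set X) : @measurable _ T A -> mean (\1_A) = fine (ds_mu X A).
Proof. by move=> mA; rewrite /mean /Rintegral integral_indic// setIT. Qed.

Lemma measurable_sublevel (d : X -> R) (a : R) : continuous d ->
  @measurable _ T [set x | d x <= a].
Proof.
move=> cd; have [md _] := bounded_measurable_continuous cd.
rewrite (_ : [set x | _] = d @^-1` `]-oo, a]); last first.
  by apply/seteqP; split => x /=; rewrite in_itv.
rewrite -[X in measurable X]setTI; exact: md.
Qed.

Lemma bounded_measurable_weight (d : X -> R) (M : nat) (a : R) : continuous d ->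
  bounded_measurable (fun x => (Num.max 1 (d x / a)) ^- M).
Proof.
move=> cd; apply: bounded_measurable_continuous => x.
have m0 y : Num.max 1 (d y / a) ^+ M != 0.
  by rewrite expf_neq0// gt_eqF// lt_max ltr01.
apply: cvgV => //.
have cM : (fun y => Num.max 1 (d y / a)) @ x --> Num.max 1 (d x / a).
  apply: (continuous_comp (f := fun y => d y / a) (g := fun z : R => Num.max 1 z)).
    by apply: cvgMl; exact: cd.
  move=> B; exact: continuous_max (cvg_cst _) cvg_id B.
exact: (continuous_cvg _ (@exprn_continuous R M _) cM).
Qed.

(** The ball of radius 2^j r has measure at most C (2^j r)^q, which loses to the weight 2^(-j M'.+1)
    because q <= M'. Finitely many radii are enough, [d] being bounded. *)
Lemma mean_weight (d : X -> R) (M' : nat) (C q r : R) :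
  continuous d -> (forall x, 0 <= d x) -> 0 <= C -> 0 <= q -> q <= M'%:R -> 0 < r ->
  (forall s : R, 0 < s -> (ds_mu X [set x | (d x <= s)%R] <= (C * s `^ q)%:E)%E) ->
  mean (fun x => (Num.max 1 (d x / r)) ^- M'.+1) <= C * 2 ^+ M'.+1 * 2 * r `^ q.
Proof.
move=> cd d0 C0 q0 qM r0 Hmu.
have [B B0 dB] := continuous_bounded cd.
have [J BJ] := ex_dyadic (B / r).
pose A j := [set x | d x <= 2 ^+ j * r].
have mA j : @measurable _ T (A j) by exact: measurable_sublevel.
pose w (x : X) : R := 2 ^+ M'.+1 * \sum_(j < J.+1) (2 ^+ j) ^- M'.+1 * \1_(A j) x.
have bA (j : 'I_J.+1) : bounded_measurable (fun x => (2 ^+ j) ^- M'.+1 * \1_(A j) x).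
  exact/bounded_measurableZ/bounded_measurable_indic.
have bw : bounded_measurable (fun x => \sum_(j < J.+1) (2 ^+ j) ^- M'.+1 * \1_(A j) x).
  exact: bounded_measurable_sum.
apply: (@le_trans _ _ (mean w)).
  apply: le_mean; first exact: bounded_measurable_weight.
    exact: bounded_measurableZ.
  move=> x; rewrite (le_trans (@dyadic_weight R M'.+1 J (d x / r) _ _))//.
  - by rewrite divr_ge0// ltW.
  - rewrite (le_trans _ BJ)// ler_pM2r ?invr_gt0//.
    by rewrite (le_trans _ (dB x))// ler_norm.
  - rewrite le_eqVlt; apply/orP; left; apply/eqP; congr (_ * _).
    apply: eq_bigr => j _; congr (_ * _); rewrite indicE ler_pdivrMr//.
    suff -> : (x \in A j) = (d x <= 2 ^+ j * r) by [].
    by apply/idP/idP; rewrite inE.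
rewrite meanZ// mean_sum//.
apply: (@le_trans _ _ (2 ^+ M'.+1 * \sum_(j < J.+1) C * r `^ q * (2 ^+ j)^-1)).
  rewrite ler_wpM2l ?exprn_ge0//; apply: ler_sum => j _.
  rewrite meanZ ?mean_indic//; last exact: bounded_measurable_indic.
  have jp : 0 < 2 ^+ j :> R by rewrite exprn_gt0.
  have jr : 0 < 2 ^+ j * r by rewrite mulr_gt0.
  have h : fine (ds_mu X (A j)) <= C * (2 ^+ j * r) `^ q.
    rewrite -lee_fin fineK; first exact: Hmu.
    exact: fin_num_measure.
  apply: (le_trans (ler_wpM2l _ h)); first by rewrite invr_ge0 exprn_ge0// (ltW jp).
  rewrite powRM ?(ltW jp) ?(ltW r0)//.
  have key : (2 ^+ j) ^- M'.+1 * (2 ^+ j) `^ q <= (2 ^+ j)^-1 :> R.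
    have j1 : 1 <= 2 ^+ j :> R by rewrite exprn_ege1// ler1n.
    have := ler_powR j1 qM; rewrite powR_mulrn ?(ltW jp)// => h'.
    rewrite exprS invfM -mulrA ler_piMr ?invr_ge0 ?(ltW jp)//.
    by rewrite mulrC ler_pdivrMr ?exprn_gt0// mul1r.
  have := ler_wpM2l (mulr_ge0 C0 (powR_ge0 r q)) key.
  move: (r `^ q) ((2 ^+ j) `^ q) ((2 ^+ j) ^- M'.+1) ((2 ^+ j)^-1) => z1 z2 z3 z4.
  by apply: le_trans; rewrite le_eqVlt; apply/orP; left; apply/eqP; ring.
rewrite -mulr_sumr.
have := ler_wpM2l (mulr_ge0 C0 (powR_ge0 r q)) (@sum_geom_half R J.+1).
move: (r `^ q) (\sum_(j < _) _) => z v zv.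
have := ler_wpM2l (exprn_ge0 M'.+1 (ler0n R 2)) zv.
move: (2 ^+ M'.+1) => y h; apply: (le_trans h).
by rewrite le_eqVlt; apply/orP; left; apply/eqP; ring.
Qed.

End integration.

(** * Localization of filtered kernels *)

Lemma window_scale (R : realType) (I : choiceType) (l : I -> R) (n u : R) : 0 < n ->
  window (fun i => l i / n) u = window l (u * n).
Proof.
move=> n0; rewrite /window; congr (fset_set _).
by apply/seteqP; split => i /=; rewrite ltr_pdivrMr.
Qed.

(** The estimate of [tauberian] for the frequencies l / n. Times are divided by n^2, so the range t
    <= 1 becomes t <= n^2, and t^-c brings a factor n^(2c). Neither matters, as the constant of
    [tauberian] is independent of [t0], [G] and [c]. *)
Lemma kernel_localization (R : realType) (h : R -> R) (S : nat) (Q : R) :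
  lowpass_filter h -> 0 <= Q ->
  exists2 C1 : R, 0 <= C1 &
  forall (I : choiceType) (a l : I -> R) (C c1 c c2 d n : R),
    (forall i, 0 <= l i) -> (forall u, finite_set [set i | l i < u]) ->
    0 <= C -> 0 < n -> (forall u, n <= u -> Asum a l u (fun=> 1) <= C * u `^ Q) ->
    0 <= c1 -> 0 <= c -> 0 < c2 -> 0 <= d ->
    (forall t : R, 0 < t -> t <= 1 ->
      lsup a l (fun x => expR (- (x ^+ 2 * t))) (c1 * t `^ (- c) * expR (- (c2 * d ^+ 2 / t)))) ->
    `|\sum_(i <- window l n) a i * h (l i / n)| <=
      C1 * C * n `^ Q * (Num.max 1 (Num.sqrt c2 * d * n)) ^- S.
Proof.
move=> fh Q0; have [C1 C10 H] := tauberian S fh Q0.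
exists C1 => // I a l C c1 c c2 d n l0 fin C0 n0 growth c10 c0 c20 d0 gauss.
have n20 : 0 < n ^+ 2 by rewrite exprn_gt0.
pose l' i := l i / n.
have e u g : Lsum a l' u g = Lsum a l (u * n) (fun x => g (x / n)).
  by rewrite /Lsum /l' window_scale.
have := H I a l' (C * n `^ Q) (n ^+ 2) (c1 * (n ^+ 2) `^ c) c (Num.sqrt c2 * d * n).
rewrite e mul1r mulrA; apply => //.
- by move=> i; rewrite divr_ge0 ?(ltW n0).
- move=> u; rewrite (_ : [set i | _] = [set i | l i < u * n])//.
  by apply/seteqP; split => i /=; rewrite ltr_pdivrMr.
- by rewrite mulr_ge0// powR_ge0.
- move=> u u1; have -> : Asum a l' u (fun=> 1) = Asum a l (u * n) (fun=> 1).
    by rewrite /Asum /l' window_scale.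
  rewrite (le_trans (growth _ _))//; first by rewrite ler_peMl// ltW.
  by rewrite powRM ?(le_trans ler01 u1) ?(ltW n0)// -mulrA [X in _ * X]mulrC.
- by rewrite mulr_ge0// powR_ge0.
- by rewrite !mulr_ge0 ?sqrtr_ge0// ltW.
- move=> t t0 tn eps eps0.
  have t1 : t / n ^+ 2 <= 1 by rewrite ler_pdivrMr// mul1r.
  have t2 : 0 < t / n ^+ 2 by rewrite divr_gt0.
  have [u0 Hu] := gauss _ t2 t1 eps eps0.
  exists (u0 / n) => u; rewrite ler_pdivrMr// => /Hu.
  rewrite e; set s1 := Lsum _ _ _ _; set s2 := Lsum _ _ _ _.
  have -> : s1 = s2.
    apply: eq_bigr => i _; congr (_ * expR (- _)).
    by field; rewrite gt_eqF.
  move=> h1; apply: (le_trans h1); rewrite lerD2r.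
  have -> : c2 * d ^+ 2 / (t / n ^+ 2) = (Num.sqrt c2 * d * n) ^+ 2 / t.
    rewrite !exprMn sqr_sqrtr ?(ltW c20)//; field.
    by rewrite !gt_eqF.
  apply: ler_wpM2r; first exact: expR_ge0.
  rewrite -mulrA ler_wpM2l// le_eqVlt; apply/orP; left; apply/eqP.
  rewrite powRM ?invr_ge0 ?(ltW t0) ?(ltW n20)// mulrC; congr (_ * _).
  by rewrite -powR_inv1 ?(ltW n20)// -powRrM mulN1r opprK.
Qed.

Lemma max1_scale (R : realType) (S : nat) (k z : R) : 0 < k -> 0 <= z ->
  (Num.max 1 (k * z)) ^- S <= (Num.max 1 k^-1) ^+ S * (Num.max 1 z) ^- S.
Proof.
move=> k0 z0.
have m1 (x : R) : 0 < Num.max 1 x by rewrite lt_max ltr01.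
have m1' (x : R) : 1 <= Num.max 1 x by rewrite le_max lexx.
rewrite -!exprVn -exprMn; apply: lerXn2r; rewrite ?nnegrE ?mulr_ge0 ?invr_ge0 ?(ltW (m1 _))//.
rewrite ler_pdivlMr// mulrC ler_pdivrMr// ge_max; apply/andP; split.
  by rewrite -[leLHS]mulr1 ler_pM// m1'.
rewrite [leLHS](_ : z = k^-1 * (k * z)); last by rewrite mulKf// gt_eqF.
have kz : 0 <= k * z by rewrite mulr_ge0// ltW.
by apply: ler_pM => //; [rewrite invr_ge0 ltW|rewrite le_max lexx orbT..].
Qed.

Section joint_kernel.
Variables (R : realType) (X1 X2 : data_space R) (d12 : X1 -> X2 -> R).
Variables (Am L : nat -> nat -> R) (Q q1 q2 : R) (h : R -> R).
Hypothesis joint : joint_data_space d12 Am L Q q1 q2.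
Hypothesis filt : lowpass_filter h.

Definition jwindow (n : R) := window (fun p : nat * nat => L p.1 p.2) n.

Definition joint_kernel (n : R) (x : X1) (y : X2) : R :=
  \sum_(p <- jwindow n) Am p.1 p.2 * ds_phi p.1 x * ds_phi p.2 y * h (L p.1 p.2 / n).

Lemma joint_fin u : finite_set [set p : nat * nat | L p.1 p.2 < u].
Proof.
case: joint => _ L0 Lfin _ _; have [u0|u0] := ltP 0 u; first exact: Lfin.
rewrite (_ : [set p | _] = set0)//; apply/seteqP; split => // p /= pu.
by have := lt_le_trans pu u0; rewrite ltNge L0.
Qed.

Lemma joint_kernel_localization (S : nat) : exists2 C : R, 0 <= C &
  forall n x y, 0 < n ->
    `|joint_kernel n x y| <= C * n `^ Q * (Num.max 1 (n * d12 x y)) ^- S.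
Proof.
case: joint => [[d0 _ _] L0 Lfin [Q0 q10 q20] [c [c1 [c2 [C [[c0 c10 c20 C0] H]]]]]].
have [C1 C10 K] := kernel_localization S filt (ltW Q0).
have sc : 0 < Num.sqrt c2 by rewrite sqrtr_gt0.
have m0 : 0 <= Num.max 1 (Num.sqrt c2)^-1 ^+ S by rewrite exprn_ge0// le_max ler01.
exists (C1 * C * (Num.max 1 (Num.sqrt c2)^-1) ^+ S).
  by rewrite mulr_ge0// mulr_ge0// ltW.
move=> n x y n0; have [_ Hg Hk] := H x y.
pose a (p : nat * nat) := Am p.1 p.2 * ds_phi p.1 x * ds_phi p.2 y.
have := K _ a (fun p : nat * nat => L p.1 p.2) C c1 c c2 (d12 x y) n
  (fun p => L0 _ _) joint_fin (ltW C0) n0.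
move=> /(_ _ (ltW c10) (ltW c0) c20 (d0 x y) _) B.
apply: (le_trans (B _ _)).
- move=> u nu; have u0 := lt_le_trans n0 nu; have := Hg u u0.
  rewrite fsbig_finite; last exact: joint_fin.
  apply: le_trans; rewrite /Asum le_eqVlt; apply/orP; left; apply/eqP.
  by apply: eq_bigr => p _; rewrite mulr1.
- move=> t t0 t1 eps eps0; have [cv lt] := Hk t t0 t1.
  have /cvgrPdist_le/(_ eps eps0)[u0 [_ Hu]] := cv.
  exists (u0 + 1) => u uu; have {}uu : u0 < u by rewrite (lt_le_trans _ uu)// ltrDl.
  have := Hu _ uu; set l := lim _ in lt *; set s := \sum_(_ \in _) _ => ls.
  have -> : Lsum a (fun p : nat * nat => L p.1 p.2) u (fun z => expR (- (z ^+ 2 * t))) = s.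
    rewrite /s fsbig_finite; last exact: joint_fin.
    by apply: eq_bigr => p _; rewrite /a mulNr; ring.
  have -> : s = l - (l - s) by ring.
  rewrite (le_trans (ler_normB _ _))// lerD// (le_trans lt)//.
  by rewrite mulNr mulNr.
- have -> : C1 * C * Num.max 1 (Num.sqrt c2)^-1 ^+ S * n `^ Q * Num.max 1 (n * d12 x y) ^- S =
     C1 * C * n `^ Q * (Num.max 1 (Num.sqrt c2)^-1 ^+ S * Num.max 1 (n * d12 x y) ^- S) by ring.
  apply: ler_wpM2l; first by rewrite !mulr_ge0 ?powR_ge0 ?(ltW C0).
  have -> : Num.sqrt c2 * d12 x y * n = Num.sqrt c2 * (n * d12 x y) by ring.
  by apply: max1_scale => //; rewrite mulr_ge0 ?(ltW n0).
Qed.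

Lemma joint_sigmaE n f x : 0 < n ->
  joint_sigma X1 X2 h Am L n f x =
  \sum_(p <- jwindow n) h (L p.1 p.2 / n) * Am p.1 p.2 * fcoef f p.2 * ds_phi p.1 x.
Proof.
move=> n0; rewrite /joint_sigma; apply: fsbigTE => p.
rewrite (in_window joint_fin) -leNgt => np.
have [_ _ _ _ h0] := filt.
by rewrite h0 ?mul0r// ler_pdivlMr// mul1r.
Qed.

Lemma joint_sigma_mean n f x : 0 < n -> bounded_measurable f ->
  joint_sigma X1 X2 h Am L n f x = mean (fun y : X2 => f y * joint_kernel n x y).
Proof.
move=> n0 bf; rewrite joint_sigmaE// /joint_kernel.
under [X in mean X]eq_fun do rewrite mulr_sumr.
have bphi k : bounded_measurable (@ds_phi R X2 k).
  exact/bounded_measurable_continuous/ds_phi_cont.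
rewrite mean_sum; last first.
  move=> p; apply: bounded_measurableM => //.
  have -> : (fun y : X2 => Am p.1 p.2 * ds_phi p.1 x * ds_phi p.2 y * h (L p.1 p.2 / n)) =
    (fun y : X2 => (Am p.1 p.2 * ds_phi p.1 x * h (L p.1 p.2 / n)) * ds_phi p.2 y).
    by apply/funext => y /=; ring.
  exact: bounded_measurableZ.
apply: eq_bigr => p _.
have -> : (fun y : X2 => f y * (Am p.1 p.2 * ds_phi p.1 x * ds_phi p.2 y * h (L p.1 p.2 / n))) =
    (fun y : X2 => (Am p.1 p.2 * ds_phi p.1 x * h (L p.1 p.2 / n)) * (f y * ds_phi p.2 y)).
  by apply/funext => y /=; ring.
rewrite meanZ; last exact: bounded_measurableM.
by rewrite /fcoef /mean; ring.
Qed.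

End joint_kernel.

(** Two weights are integrated: one of scale 1/n against the part of [g] bounded by [a], and one of
    scale r against the far part. For d >= r the kernel factor is at most (n r)^-M'.+1 (d /
    r)^-M'.+1. *)
Lemma mean_kernel_bound (R : realType) (X : data_space R) (k g d : X -> R)
    (M' : nat) (A C q n r a b : R) :
  continuous d -> (forall y, 0 <= d y) -> 0 <= A -> 0 <= C -> 0 <= q -> q <= M'%:R ->
  0 < n -> 0 < r -> 0 <= a -> 0 <= b ->
  (forall s : R, 0 < s -> (ds_mu X [set y | (d y <= s)%R] <= (C * s `^ q)%:E)%E) ->
  bounded_measurable k -> bounded_measurable g ->
  (forall y, `|k y| <= A * (Num.max 1 (n * d y)) ^- M'.+1) ->
  (forall y, `|g y| <= a \/ (`|g y| <= b /\ r <= d y)) ->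
  `|mean (fun y => g y * k y)| <=
    A * (C * 2 ^+ M'.+1 * 2) * (n `^ (- q) * a + (n * r) ^- M'.+1 * r `^ q * b).
Proof.
move=> cd d0 A0 C0 q0 qM n0 r0 a0 b0 Hmu bk bg kA gab.
pose w1 y := (Num.max 1 (d y / n^-1)) ^- M'.+1.
pose w2 y := (Num.max 1 (d y / r)) ^- M'.+1.
have m1 (x : R) : 0 < Num.max 1 x by rewrite lt_max ltr01.
have bw1 : bounded_measurable w1 by exact: bounded_measurable_weight.
have bw2 : bounded_measurable w2 by exact: bounded_measurable_weight.
have w10 y : 0 <= w1 y by rewrite invr_ge0 exprn_ge0 ?(ltW (m1 _)).
have w20 y : 0 <= w2 y by rewrite invr_ge0 exprn_ge0 ?(ltW (m1 _)).
have nr0 : 0 < n * r by rewrite mulr_gt0.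
set t := (n * r) ^- M'.+1.
have t0 : 0 <= t by rewrite invr_ge0 exprn_ge0 ?(ltW nr0).
apply: (@le_trans _ _ (mean (fun y => A * a * w1 y + A * t * b * w2 y))).
  apply: normr_mean_le; first exact: bounded_measurableM.
    by apply: bounded_measurableD; exact: bounded_measurableZ.
  move=> y; rewrite normrM.
  have s1 : 0 <= A * a * w1 y by rewrite !mulr_ge0.
  have s2 : 0 <= A * t * b * w2 y by rewrite !mulr_ge0.
  case: (gab y) => [ga|[gb rd]].
    apply: (@le_trans _ _ (A * a * w1 y)); last by rewrite lerDl.
    rewrite mulrAC mulrC; apply: ler_pM => //.
    by rewrite /w1 invrK [d y * n]mulrC; exact: kA.
  apply: (@le_trans _ _ (A * t * b * w2 y)); last by rewrite lerDr.
  rewrite mulrAC mulrC; apply: ler_pM => //.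
  apply: (le_trans (kA y)); rewrite -mulrA ler_wpM2l// /t /w2 -invfM -exprMn.
  have dr : 1 <= d y / r by rewrite ler_pdivlMr// mul1r.
  rewrite [in leRHS]max_r// lef_pV2 ?posrE ?exprn_gt0 ?mulr_gt0 ?invr_gt0 ?(lt_le_trans r0 rd)//.
  apply: lerXn2r; rewrite ?nnegrE ?(ltW (m1 _))//.
    by rewrite mulr_ge0 ?(ltW nr0)// (le_trans ler01 dr).
  have -> : n * r * (d y / r) = n * d y by field; rewrite gt_eqF.
  by rewrite le_max lexx orbT.
have ME : mean (fun y : X => A * a * w1 y + A * t * b * w2 y) =
    A * a * mean w1 + A * t * b * mean w2.
  rewrite -!meanZ//.
  exact: meanD (bounded_measurableZ (A * a) bw1) (bounded_measurableZ (A * t * b) bw2).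
apply: (@le_trans _ _ (A * a * mean w1 + A * t * b * mean w2)).
  by rewrite -ME; exact: lexx.
rewrite mulrDr; apply: lerD.
  have h := mean_weight cd d0 C0 q0 qM (_ : 0 < n^-1) Hmu.
  rewrite -mulrA (le_trans (ler_wpM2l A0 (ler_wpM2l a0 (h _))))// ?invr_gt0//.
  rewrite -powR_inv1 ?(ltW n0)// -powRrM mulN1r.
  by rewrite le_eqVlt; apply/orP; left; apply/eqP; move: (2 ^+ _) => z; ring.
have h := mean_weight cd d0 C0 q0 qM r0 Hmu.
have Atb : 0 <= A * t * b by rewrite !mulr_ge0.
apply: (le_trans (ler_wpM2l Atb h)).
by rewrite le_eqVlt; apply/orP; left; apply/eqP; move: (2 ^+ _) => z; ring.
Qed.

Lemma continuous_mdist (R : realType) (X : data_space R) (x : X) :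
  continuous (fun y : X => mdist x y).
Proof.
move=> y; apply/cvgrPdist_lt => e e0.
have : \forall z \near y, ball y e z by exact: nbhsx_ballx.
apply: filterS => z; rewrite ballEmdist/= => yz.
have h1 := metric_triangle x y z; have h2 := metric_triangle x z y.
rewrite (metric_sym z y) in h2.
by rewrite ltr_norml; apply/andP; split; lra.
Qed.

(** * Kernel localization on one data space *)

Section one_space.
Variables (R : realType) (X : data_space R) (h : R -> R).
Hypothesis filt : lowpass_filter h.
Notation lam := (ds_lam X).
Notation phi := (@ds_phi R X).

Lemma lam_ge0 k : 0 <= lam k.
Proof. by rewrite -(ds_lam0 X); exact: ds_lam_nd. Qed.

Lemma lam_segment u : exists m, forall k, (lam k < u) = (k < m)%N.
Proof.
have ex : exists m, u <= lam m.
  have /cvgryPge/(_ u)[m _ H] := @ds_lam_oo R X.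
  by exists m; apply: H => /=.
exists (ex_minn ex) => k; case: ex_minnP => m um min_m.
apply/idP/idP => [ku|km].
  by rewrite ltnNge; apply/negP => /(@ds_lam_nd R X) mk; move: ku; rewrite ltNge (le_trans um mk).
by rewrite ltNge; apply/negP => /min_m; rewrite leqNgt km.
Qed.

Lemma lam_fin u : finite_set [set k | lam k < u].
Proof.
have [m H] := lam_segment u.
rewrite (_ : [set k | _] = `I_m); first exact: finite_II.
by apply/seteqP; split => k /=; rewrite H.
Qed.

Lemma window_segment u : exists m,
  (forall k, (lam k < u) = (k < m)%N) /\
  forall g : nat -> R, \sum_(k <- window lam u) g k = \sum_(0 <= k < m) g k.
Proof.
have [m H] := lam_segment u; exists m; split => // g.
rewrite /index_iota subn0; apply: perm_big; apply: uniq_perm.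
- exact: fset_uniq.
- exact: iota_uniq.
- by move=> k; rewrite (in_window lam_fin) mem_iota/= H.
Qed.

Definition kernel1 (n : R) (x y : X) : R :=
  \sum_(k <- window lam n) phi k x * phi k y * h (lam k / n).

Lemma bounded_measurable_phi k : bounded_measurable (phi k).
Proof. exact/bounded_measurable_continuous/ds_phi_cont. Qed.

Lemma bounded_measurable_kernel1 n x : bounded_measurable (kernel1 n x).
Proof.
apply: bounded_measurable_sum => k.
have -> : (fun y : X => phi k x * phi k y * h (lam k / n)) =
    (fun y : X => (phi k x * h (lam k / n)) * phi k y).
  by apply/funext => y /=; ring.
exact/bounded_measurableZ/bounded_measurable_phi.
Qed.

Lemma sigma_opE n f x :
  sigma_op h n f x = \sum_(k <- window lam n) h (lam k / n) * fcoef f k * phi k x.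
Proof. by rewrite /sigma_op fsbig_finite//; exact: lam_fin. Qed.

Lemma sigma_op_mean n f x : bounded_measurable f ->
  sigma_op h n f x = mean (fun y => f y * kernel1 n x y).
Proof.
move=> bf; rewrite sigma_opE /kernel1.
under [X in mean X]eq_fun do rewrite mulr_sumr.
have e k : (fun y : X => f y * (phi k x * phi k y * h (lam k / n))) =
    (fun y : X => (phi k x * h (lam k / n)) * (f y * phi k y)).
  by apply/funext => y /=; ring.
have bfp k : bounded_measurable (fun y : X => f y * phi k y).
  by apply: bounded_measurableM => //; exact: bounded_measurable_phi.
rewrite mean_sum => [|k]; last by rewrite e; exact: bounded_measurableZ.
by apply: eq_bigr => k _; rewrite e meanZ// /fcoef /mean; ring.
Qed.

(** The growth condition is not an axiom of a data space; it is recovered from the heat kernel on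
    the diagonal at time u^-2. There exp(-lam^2 t) >= 1/e for lam < u, so the sum of the phi_k(x)^2
    is at most e k1 u^q, and 2 [|a b|] <= a^2 + b^2 handles two points. The restriction t <= 1
    imposes u >= 1, hence n >= 1. *)
Lemma kernel1_localization : exists2 q : R, 0 <= q &
  (exists2 C : R, 0 <= C & forall (x : X) (s : R), 0 < s ->
     (ds_mu X [set y | (mdist x y <= s)%R] <= (C * s `^ q)%:E)%E) /\
  forall S : nat, exists2 C : R, 0 <= C & forall n x y, 1 <= n ->
    `|kernel1 n x y| <= C * n `^ q * (Num.max 1 (n * mdist x y)) ^- S.
Proof.
have [q [kap [k1 [k2 [[q1 kap0 k10 k20] [Hmu Hk]]]]]] := ds_exponents X.
have q0 : 0 <= q by rewrite (le_trans ler01).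
exists q => //; split.
  by exists kap; [exact: ltW|move=> x s s0; case: (Hmu x s s0)].
move=> S; have [C1 C10 K] := kernel_localization S filt q0.
have sc : 0 < Num.sqrt k2 by rewrite sqrtr_gt0.
have m0 : 0 <= Num.max 1 (Num.sqrt k2)^-1 ^+ S by rewrite exprn_ge0// le_max ler01.
pose C := expR 1 * k1.
have C0 : 0 <= C by rewrite mulr_ge0 ?expR_ge0 ?ltW.
have sumsq x u : 1 <= u -> \sum_(k <- window lam u) phi k x ^+ 2 <= C * u `^ q.
  move=> u1; have u0 : 0 < u by rewrite (lt_le_trans ltr01).
  pose t := u ^- 2; have t0 : 0 < t by rewrite invr_gt0 exprn_gt0.
  have t1 : t <= 1 by rewrite invf_le1 ?exprn_gt0// exprn_ege1.
  have [cv lt] := Hk x x t t0 t1.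
  have [m [Hm ->]] := window_segment u.
  pose v (k : nat) := expR (- lam k ^+ 2 * t) * phi k x * phi k x.
  have v0 k : 0 <= v k by rewrite /v -mulrA mulr_ge0 ?expR_ge0// -expr2 sqr_ge0.
  have sv : \sum_(0 <= k < m) v k <= k1 * u `^ q.
    apply: (@le_trans _ _ (lim (series v @ \oo))).
      exact: (nondecreasing_cvgn_le (nondecreasing_series (fun k _ _ => v0 k)) cv).
    rewrite (le_trans (ler_norm _))// (le_trans lt)// mdistxx expr0n/= mulr0 mul0r expR0 mulr1.
    rewrite ler_wpM2l ?(ltW k10)// /t -powR_mulrn ?(ltW u0)//.
    rewrite -powRN -powRrM le_eqVlt; apply/orP; left; apply/eqP; congr (_ `^ _).
    by field.
  rewrite /C -mulrA; apply: (le_trans _ (ler_wpM2l (expR_ge0 1) sv)).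
  rewrite mulr_sumr big_nat [leRHS]big_nat; apply: ler_sum => k /andP[_ km].
  rewrite /v mulrA mulrA -expRD -mulrA -expr2 ler_peMl ?sqr_ge0//.
  rewrite -[leLHS]expR0 ler_expR mulNr subr_ge0 /t ler_pdivrMr ?exprn_gt0// mul1r.
  apply: lerXn2r; rewrite ?nnegrE ?lam_ge0 ?(ltW u0)//.
  by rewrite ltW// Hm.
exists (C1 * C * (Num.max 1 (Num.sqrt k2)^-1) ^+ S); first by apply: mulr_ge0 => //; exact: mulr_ge0.
move=> n x y n1; have n0 : 0 < n by rewrite (lt_le_trans ltr01).
pose a k := phi k x * phi k y.
have := K _ a lam C k1 (q / 2) k2 (mdist x y) n lam_ge0 lam_fin C0 n0.
move=> /(_ _ (ltW k10) _ k20 (mdist_ge0 _ _) _) B.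
apply: (le_trans (B _ _ _)).
- move=> u nu; have u1 := le_trans n1 nu.
  have := lerD (sumsq x u u1) (sumsq y u u1).
  rewrite -big_split/= => hs.
  rewrite -(@ler_pM2l _ 2)// mulr_sumr (_ : 2 * (C * _) = C * u `^ q + C * u `^ q); last by ring.
  apply: le_trans hs; apply: ler_sum => k _; rewrite mulr1 /a normrM.
  rewrite -[phi k x ^+ 2]real_normK ?num_real// -[phi k y ^+ 2]real_normK ?num_real//.
  by rewrite -subr_ge0 (_ : _ - _ = (`|phi k x| - `|phi k y|) ^+ 2) ?sqr_ge0//; ring.
- by rewrite divr_ge0.
- move=> t t0 t1 eps eps0; have [cv lt] := Hk x y t t0 t1.
  have /cvgrPdist_le/(_ eps eps0)[m0' _ Hu] := cv.
  exists (lam m0' + 1) => u uu; have {}uu : lam m0' < u by rewrite (lt_le_trans _ uu)// ltrDl.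
  have [m [Hm sm]] := window_segment u.
  have mm : (m0' <= m)%N by rewrite ltnW// -Hm.
  have := Hu m mm; set l := lim _ in lt *; set s := series _ _ => ls.
  have -> : Lsum a lam u (fun z => expR (- (z ^+ 2 * t))) = s.
    by rewrite /Lsum sm; apply: eq_bigr => k _; rewrite /a mulNr; ring.
  have -> : s = l - (l - s) by ring.
  rewrite (le_trans (ler_normB _ _))// lerD// (le_trans lt)//.
  by rewrite !mulNr.
- have -> : C1 * C * Num.max 1 (Num.sqrt k2)^-1 ^+ S * n `^ q * Num.max 1 (n * mdist x y) ^- S =
     C1 * C * n `^ q * (Num.max 1 (Num.sqrt k2)^-1 ^+ S * Num.max 1 (n * mdist x y) ^- S) by ring.
  apply: ler_wpM2l; first by apply: mulr_ge0; [exact: mulr_ge0|exact: powR_ge0].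
  have -> : Num.sqrt k2 * mdist x y * n = Num.sqrt k2 * (n * mdist x y) by ring.
  by apply: max1_scale => //; rewrite mulr_ge0 ?mdist_ge0// ltW.
Qed.

End one_space.

(** * Approximation on one data space *)

Lemma supnorm_le (R : realType) (T : Type) (K : set T) (f : T -> R) (B : \bar R) :
  (0 <= B)%E -> (forall x, K x -> (`|f x|%:E <= B)%E) -> (supnorm K f <= B)%E.
Proof.
move=> B0 H; rewrite /supnorm ge_max B0 /=.
by apply: ge_ereal_sup => _ [x Kx <-]; exact: H.
Qed.

Lemma supnorm_ge (R : realType) (T : Type) (K : set T) (f : T -> R) x : K x ->
  (`|f x|%:E <= supnorm K f)%E.
Proof.
move=> Kx; rewrite /supnorm le_max; apply/orP; right.
by apply: ereal_sup_ubound; exists x.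
Qed.

Lemma supnorm_ge0 (R : realType) (T : Type) (K : set T) (f : T -> R) : (0 <= supnorm K f)%E.
Proof. by rewrite /supnorm le_max lexx. Qed.

Lemma continuous_bigsum (R : realType) (T : topologicalType) (I : Type) (s : seq I)
    (f : I -> T -> R) : (forall i, continuous (f i)) ->
  continuous (fun x => \sum_(i <- s) f i x).
Proof.
move=> H; elim: s => [|i s IH].
  by under eq_fun do rewrite big_nil; move=> x; exact: cvg_cst.
by under eq_fun do rewrite big_cons; move=> x; apply: continuousD; [exact: H|exact: IH].
Qed.

Section one_space_approx.
Variables (R : realType) (X : data_space R) (h : R -> R).
Hypothesis filt : lowpass_filter h.
Notation lam := (ds_lam X).
Notation phi := (@ds_phi R X).
Implicit Types (f g P : X -> R).

Lemma diffpolyE n P : diffpoly X n P <->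
  exists c : nat -> R, P = fun x => \sum_(k <- window lam n) c k * phi k x.
Proof.
split=> -[c ->]; exists c; apply/funext => x; rewrite fsbig_finite//; exact: lam_fin.
Qed.

Lemma diffpoly_continuous n P : diffpoly X n P -> continuous P.
Proof.
move=> /diffpolyE[c ->]; apply: continuous_bigsum => k x.
by apply: cvgMr; exact: ds_phi_cont.
Qed.

Lemma diffpoly0 n : diffpoly X n (fun=> 0).
Proof.
apply/diffpolyE; exists (fun=> 0); apply/funext => x.
by rewrite big1// => k _; rewrite mul0r.
Qed.

Lemma diffpoly_mono n m P : n <= m -> diffpoly X n P -> diffpoly X m P.
Proof.
move=> nm /diffpolyE[c ->]; apply/diffpolyE.
exists (fun k => if lam k < n then c k else 0); apply/funext => x.
rewrite (window_subset (@lam_fin R X) _ nm) big_mkcond; apply: eq_bigr => k _.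
by case: ifP => //; rewrite mul0r.
Qed.

Lemma fcoef_sum (s : seq nat) (c : nat -> R) k : uniq s ->
  fcoef (fun x : X => \sum_(j <- s) c j * phi j x) k = if k \in s then c k else 0.
Proof.
move=> us; rewrite /fcoef -/(mean _).
have -> : (fun x : X => (\sum_(j <- s) c j * phi j x) * phi k x) =
    (fun x : X => \sum_(j <- s) c j * (phi j x * phi k x)).
  by apply/funext => x; rewrite mulr_suml; apply: eq_bigr => j _; rewrite mulrA.
have bp j : bounded_measurable (fun x : X => phi j x * phi k x).
  by apply: bounded_measurableM; exact: bounded_measurable_phi.
rewrite mean_sum => [|j]; last exact: bounded_measurableZ.
have e j : mean (fun x : X => c j * (phi j x * phi k x)) = c j * (j == k)%:R.
  by rewrite meanZ// /mean ds_phi_orthonormal.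
under eq_bigr do rewrite e.
case: ifP => ks.
  rewrite (bigD1_seq k)//= eqxx mulr1 big1 ?addr0// => j /negPf ->.
  by rewrite mulr0.
rewrite big_seq big1// => j js; case: eqP => [jk|_]; last by rewrite mulr0.
by rewrite -jk js in ks.
Qed.

Lemma sigma_reproduces n P : 0 < n -> diffpoly X (n / 2) P -> sigma_op h n P = P.
Proof.
move=> n0 /diffpolyE[c ->]; apply/funext => x; rewrite sigma_opE.
have n2 : n / 2 <= n by lra.
rewrite (window_subset (@lam_fin R X) _ n2) [RHS]big_mkcond; apply: eq_bigr => k _.
rewrite fcoef_sum ?fset_uniq// (in_window (@lam_fin R X)); case: ifP => kn; last by rewrite mulr0 mul0r.
have [_ _ _ h1 _] := filt; rewrite h1 ?mul1r// divr_ge0 ?lam_ge0 ?(ltW n0)//=.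
by rewrite ler_pdivrMr// mulrC ltW.
Qed.

Lemma sigma_opB n f g x : bounded_measurable f -> bounded_measurable g ->
  sigma_op h n (fun y => f y - g y) x = sigma_op h n f x - sigma_op h n g x.
Proof.
move=> bf bg.
have bN : bounded_measurable (fun y => -1 * g y) by exact: bounded_measurableZ.
have -> : (fun y => f y - g y) = (fun y => f y + (-1 * g y)).
  by apply/funext => y; rewrite mulN1r.
have bk := bounded_measurable_kernel1 h n x.
rewrite !sigma_op_mean//; last exact: bounded_measurableD.
have -> : (fun y => (f y + -1 * g y) * kernel1 h n x y) =
    (fun y => f y * kernel1 h n x y + -1 * (g y * kernel1 h n x y)).
  by apply/funext => y; ring.
rewrite (@meanD _ _ (fun y => f y * kernel1 h n x y) (fun y => -1 * (g y * kernel1 h n x y))).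
- by rewrite meanZ ?mulN1r//; exact: bounded_measurableM.
- exact: bounded_measurableM.
- by apply: bounded_measurableZ; exact: bounded_measurableM.
Qed.

(** A bounded function supported far from x contributes less than any prescribed power of n. The
    order of quantifiers matters: [C] precedes [r], so that a neighbourhood may later be chosen in
    terms of [C]. *)
Lemma sigma_local (gamma : R) : 0 <= gamma -> exists2 C : R, 0 <= C &
  forall r : R, 0 < r -> exists2 C' : R, 0 <= C' &
  forall (n : R) f x (a b : R), 1 <= n -> bounded_measurable f -> 0 <= a -> 0 <= b ->
    (forall y, `|f y| <= a \/ (`|f y| <= b /\ r <= mdist x y)) ->
    `|sigma_op h n f x| <= C * a + C' * (n `^ (- gamma) * b).
Proof.
move=> g0; have [q q0 [[C C0 Hmu] loc]] := kernel1_localization X filt.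
pose M' := Num.bound (q + gamma).
have qgM : q + gamma <= M'%:R by apply/ltW/archi_boundP; rewrite addr_ge0.
have qM : q <= M'%:R by rewrite (le_trans _ qgM)// lerDl.
have [C1 C10 Hk] := loc M'.+1.
have [Cw Cw0 CwE] : exists2 Cw : R, 0 <= Cw & C * 2 ^+ M'.+1 * 2 = Cw.
  by exists (C * 2 ^+ M'.+1 * 2) => //; apply: mulr_ge0 => //; apply: mulr_ge0 => //; exact: exprn_ge0.
have CC : 0 <= C1 * Cw by exact: mulr_ge0.
exists (C1 * Cw) => // r r0.
pose t := r ^- M'.+1 * r `^ q.
have t0 : 0 <= t by rewrite mulr_ge0 ?powR_ge0// invr_ge0 exprn_ge0// ltW.
exists (C1 * Cw * t); first exact: mulr_ge0.
move=> n f x a b n1 bf a0 b0 fab; have n0 : 0 < n by rewrite (lt_le_trans ltr01).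
have A0 : 0 <= C1 * n `^ q by rewrite mulr_ge0 ?powR_ge0.
have := mean_kernel_bound (@continuous_mdist R X x) (mdist_ge0 x) A0 C0 q0 qM n0 r0 a0 b0
  (fun s s0 => Hmu x s s0) (bounded_measurable_kernel1 h n x) bf (fun y => Hk n x y n1) fab.
rewrite -sigma_op_mean// CwE => H; apply: (le_trans H).
have -> : C1 * n `^ q * Cw * (n `^ (- q) * a + (n * r) ^- M'.+1 * r `^ q * b) =
    C1 * Cw * ((n `^ q * n `^ (- q)) * a + (n `^ q * n ^- M'.+1) * t * b).
  by rewrite /t exprMn invfM; ring.
rewrite -[X in _ <= _ + X]mulrA -mulrDr; apply: ler_wpM2l => //.
rewrite powRN divff ?gt_eqF ?powR_gt0// mul1r lerD2l.
have nM : n `^ q * n ^- M'.+1 <= n `^ (- gamma).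
  rewrite -powR_mulrn ?(ltW n0)// -powRN -powRD; last by apply/implyP => _; rewrite gt_eqF.
  apply: ler_powR => //; rewrite -natr1; lra.
rewrite mulrA [t * _]mulrC; apply: ler_wpM2r => //.
exact: ler_wpM2r.
Qed.

(** The operator reproduces [P], so its error on [g] is its error on g - P; [sigma_local] with b = 0
    provides the uniform bound on the operator. *)
Lemma sigma_near_best : exists2 C : R, 0 <= C &
  forall (n : R) g P (e : R), 1 <= n -> bounded_measurable g -> diffpoly X (n / 2) P ->
    (forall x, `|g x - P x| <= e) -> forall x, `|g x - sigma_op h n g x| <= C * e.
Proof.
have [C C0 /(_ 1 ltr01)[C' C'0 H]] := sigma_local (lexx 0).
exists (1 + C); first by rewrite addr_ge0.
move=> n g P e n1 bg dP ge x; have n0 : 0 < n by rewrite (lt_le_trans ltr01).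
have e0 : 0 <= e by exact: le_trans (normr_ge0 _) (ge x).
have bP : bounded_measurable P by apply/bounded_measurable_continuous/(diffpoly_continuous dP).
have := @sigma_opB n g P x bg bP; rewrite (sigma_reproduces n0 dP) => e1.
have bgP : bounded_measurable (fun y => g y - P y).
  have := bounded_measurableD bg (bounded_measurableZ (-1) bP).
  by under eq_fun do rewrite mulN1r.
have := H n (fun y => g y - P y) x e 0 n1 bgP e0 (lexx 0) (fun y => or_introl (ge y)).
rewrite !mulr0 addr0 e1 => h1.
have -> : g x - sigma_op h n g x = (g x - P x) - (sigma_op h n g x - P x) by ring.
by rewrite (le_trans (ler_normB _ _))// mulrDl mul1r lerD.
Qed.

Lemma smooth_class_approx gamma g : 0 < gamma -> smooth_class X gamma g ->
  exists2 K : R, 0 <= K & forall n : R, 0 < n ->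
    exists2 P, diffpoly X n P & forall x, `|g x - P x| <= K * n `^ (- gamma).
Proof.
move=> g0 [_ fin].
have E0 n : (0 <= approx_deg n g)%E.
  by apply: le_ereal_inf_tmp => _ [P _ <-]; exact: supnorm_ge0.
set s := ereal_sup _ in fin.
have s0 : (0 <= s)%E.
  apply: (@le_trans _ _ ((1 `^ gamma)%:E * approx_deg 1 g)%E).
    by rewrite mule_ge0// lee_fin powR_ge0.
  by apply: ereal_sup_ubound; exists 1 => //=; exact: ltr01.
have sfin : s \is a fin_num.
  rewrite ge0_fin_numE//; apply: le_lt_trans fin.
  by rewrite leeDr// supnorm_ge0.
(* The added 1 creates the strict inequality from which an actual polynomial is extracted out of the
   infimum. *)
exists (fine s + 1); first by rewrite addr_ge0// fine_ge0.
move=> n n0.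
have ng : 0 < n `^ gamma by rewrite powR_gt0.
have h1 : ((n `^ gamma)%:E * approx_deg n g <= s)%E.
  by apply: ereal_sup_ubound; exists n.
have h2 : (approx_deg n g < ((fine s + 1) * n `^ (- gamma))%:E)%E.
  apply: (@le_lt_trans _ _ (fine s * n `^ (- gamma))%:E).
    by rewrite mulrC EFinM fineK// powRN lee_pdivlMl.
  by rewrite lte_fin ltr_pM2r ?powR_gt0// ltrDl.
have [_ [P dP <-] hP] := ereal_inf_lt h2.
exists P => // x; rewrite -lee_fin (le_trans _ (ltW hP))//.
exact: (supnorm_ge (g \- P)).
Qed.

Lemma smooth_class_continuous gamma g : 0 < gamma -> smooth_class X gamma g -> continuous g.
Proof.
move=> g0 /(smooth_class_approx g0)[K K0 H] x; apply/cvgrPdist_le => e e0.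
have e3 : 0 < e / 3 by rewrite divr_gt0.
pose n := (3 * K / e + 1) `^ gamma^-1.
have b0 : 0 < 3 * K / e + 1 by rewrite ltr_wpDl// divr_ge0 ?mulr_ge0// ltW.
have n0 : 0 < n by rewrite powR_gt0.
have [P dP gP] := H n n0.
have nK : K * n `^ (- gamma) <= e / 3.
  rewrite powRN /n -powRrM mulVf ?gt_eqF// powRr1 ?(ltW b0)//.
  rewrite ler_pdivrMr// mulrDr mulr1 (_ : e / 3 * (3 * K / e) = K); last first.
    by field; rewrite gt_eqF.
  by rewrite lerDl ltW.
have cP := diffpoly_continuous dP.
have /cvgrPdist_le/(_ _ e3) := cP x.
apply: filterS => y Pxy.
have -> : g x - g y = (g x - P x) + (P x - P y) - (g y - P y) by ring.
have -> : e = e / 3 + e / 3 + e / 3 by field.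
rewrite (le_trans (ler_normB _ _))// lerD//; last exact: le_trans (gP y) nK.
by rewrite (le_trans (ler_normD _ _))// lerD// (le_trans (gP x)).
Qed.

Lemma sigma_smooth_rate gamma g : 0 < gamma -> smooth_class X gamma g ->
  exists2 K : R, 0 <= K & forall n, 1 <= n -> forall x,
    `|g x - sigma_op h n g x| <= K * n `^ (- gamma).
Proof.
move=> g0 sg; have [K K0 H] := smooth_class_approx g0 sg.
have bg : bounded_measurable g.
  exact/bounded_measurable_continuous/(smooth_class_continuous g0 sg).
have [C C0 HC] := sigma_near_best.
exists (C * (K * 2 `^ gamma)); first by rewrite !mulr_ge0 ?powR_ge0.
move=> n n1 x; have n0 : 0 < n by rewrite (lt_le_trans ltr01).
have [P dP gP] := H (n / 2) (divr_gt0 n0 (ltr0n R 2)).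
rewrite (le_trans (HC n g P _ n1 bg dP gP x))// -!mulrA !ler_wpM2l//.
rewrite powRM ?invr_ge0 ?(ltW n0)// mulrC.
by rewrite -powR_inv1// -powRrM mulN1r opprK.
Qed.

Lemma sigma_op_sum (J : seq nat) (F : nat -> X -> R) n x :
  (forall k, k \in J -> bounded_measurable (F k)) ->
  sigma_op h n (fun y => \sum_(k <- J) F k y) x = \sum_(k <- J) sigma_op h n (F k) x.
Proof.
move=> bF.
pose F' k := if k \in J then F k else fun=> 0.
have bF' k : bounded_measurable (F' k).
  by rewrite /F'; case: ifP => [/bF//|_]; exact: bounded_measurable_cst.
have -> : (fun y => \sum_(k <- J) F k y) = (fun y => \sum_(k <- J) F' k y).
  apply/funext => y; rewrite big_seq [RHS]big_seq; apply: eq_bigr => k kJ.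
  by rewrite /F' kJ.
have -> : \sum_(k <- J) sigma_op h n (F k) x = \sum_(k <- J) sigma_op h n (F' k) x.
  rewrite big_seq [RHS]big_seq; apply: eq_bigr => k kJ.
  by rewrite /F' kJ.
have bk := bounded_measurable_kernel1 h n x.
rewrite sigma_op_mean; last exact: bounded_measurable_sum.
have -> : (fun y => (\sum_(k <- J) F' k y) * kernel1 h n x y) =
   (fun y => \sum_(k <- J) (F' k y * kernel1 h n x y)).
  by apply/funext => y; rewrite mulr_suml.
rewrite mean_sum => [|k]; last exact: bounded_measurableM.
by apply: eq_bigr => k _; rewrite sigma_op_mean.
Qed.

(** Functions whose supporting ball misses the ball around x0 vanish on it and are dropped; a ball
    of radius r that meets it lies within 3 r of x0. *)
Lemma partition_of_unity_local (x0 : X) (r : R) : has_partition_of_unity X -> 0 < r ->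
  exists (J : seq nat) (psi : nat -> X -> R),
    (forall k, k \in J -> Cinfty_on X (cball x0 (3 * r)) (psi k)) /\
    (forall y, cball x0 r y -> \sum_(k <- J) psi k y = 1).
Proof.
move=> pou r0; have [I [psi [ctr [N [HI HJ]]]]] := pou r r0.
have [J [JI _ J1]] := HJ x0.
pose meets k := `[< exists y, cball x0 r y /\ cball (ctr k) r y >].
exists [seq k <- J | meets k], psi; split.
  move=> k; rewrite mem_filter => /andP[/asboolP[y [yx yc]] kJ].
  have [[Ck sk] _] := HI k (JI k kJ); split => // z zn; apply: sk => zc; apply: zn.
  rewrite /cball/= in yx yc zc *.
  rewrite (le_trans (metric_triangle _ y _))//.
  have := metric_triangle y (ctr k) z; rewrite (metric_sym y (ctr k)).
  by move=> h1; lra.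
move=> y yx; rewrite -(J1 y yx) big_filter big_mkcond big_seq [RHS]big_seq.
apply: eq_bigr => k kJ; case: ifPn => // /asboolPn nm.
have [[_ sk] _] := HI k (JI k kJ); rewrite sk// => yc.
by apply: nm; exists y.
Qed.

Lemma Cinfty_continuous g : Cinfty g -> continuous g.
Proof. by move=> /(_ 1 ltr01); exact: smooth_class_continuous. Qed.

End one_space_approx.

Section one_space_local.
Variables (R : realType) (X : data_space R) (h : R -> R).
Hypothesis filt : lowpass_filter h.
Implicit Types (f g : X -> R).

(** f is split into the sum of the psi_k f, which are globally smooth, and a remainder vanishing on
    the ball of radius r, whose image within r/2 of the centre is negligible by [sigma_local]. *)
Lemma sigma_local_rate (gamma r : R) (x0 : X) f (J : seq nat) (psi : nat -> X -> R) :
  0 < gamma -> 0 < r -> continuous f ->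
  (forall k, k \in J -> continuous (psi k)) ->
  (forall y, cball x0 r y -> \sum_(k <- J) psi k y = 1) ->
  (forall k, k \in J -> smooth_class X gamma (psi k \* f)) ->
  exists2 K : R, 0 <= K & forall n x, 1 <= n -> mdist x0 x < r / 2 ->
    `|f x - sigma_op h n f x| <= K * n `^ (- gamma).
Proof.
move=> g0 r0 cf cpsi psi1 spsi.
have r20 : 0 < r / 2 by rewrite divr_gt0.
have [K K0 HK] : exists2 K : R, 0 <= K & forall n x, 1 <= n ->
    \sum_(k <- J) `|(psi k \* f) x - sigma_op h n (psi k \* f) x| <= K * n `^ (- gamma).
  elim: J {psi1 cpsi} spsi => [|k J IH] spsi.
    by exists 0 => // n x _; rewrite big_nil mul0r.
  have [|K K0 HK] := IH; first by move=> j jJ; apply: spsi; rewrite inE jJ orbT.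
  have [K' K'0 HK'] := sigma_smooth_rate filt g0 (spsi k (mem_head _ _)).
  exists (K' + K); first by rewrite addr_ge0.
  by move=> n x n1; rewrite big_cons mulrDl lerD// ?HK' ?HK.
pose s y := \sum_(k <- J) psi k y.
pose f2 y := (1 - s y) * f y.
have bf := bounded_measurable_continuous cf.
have bpsi k : k \in J -> bounded_measurable (psi k).
  by move=> /cpsi; exact: bounded_measurable_continuous.
have bpf k : k \in J -> bounded_measurable (psi k \* f).
  by move=> kJ; apply: bounded_measurableM => //; exact: bpsi.
have bs : bounded_measurable (fun y => \sum_(k <- J) (psi k \* f) y).
  pose F' k := if k \in J then psi k \* f else fun=> 0.
  have -> : (fun y => \sum_(k <- J) (psi k \* f) y) = (fun y => \sum_(k <- J) F' k y).
    apply/funext => y; rewrite big_seq [RHS]big_seq; apply: eq_bigr => k kJ.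
    by rewrite /F' kJ.
  apply: bounded_measurable_sum => k; rewrite /F'.
  by case: ifP => [/bpf//|_]; exact: bounded_measurable_cst.
have fE : (fun y => f y - \sum_(k <- J) (psi k \* f) y) = f2.
  by apply/funext => y; rewrite /f2 mulrBl mul1r /s mulr_suml.
have bf2 : bounded_measurable f2.
  rewrite -fE; have := bounded_measurableD bf (bounded_measurableZ (-1) bs).
  by under eq_fun do rewrite mulN1r.
have [_ [B f2B]] := bf2.
have B0 : 0 <= B by exact: le_trans (normr_ge0 _) (f2B point).
have [C C0 /(_ _ r20)[C' C'0 HC]] := sigma_local X filt (ltW g0).
exists (K + C' * B); first by rewrite addr_ge0// mulr_ge0.
move=> n x n1 xr.
have f2z y : mdist x0 y < r -> f2 y = 0.
  by move=> yr; rewrite /f2 /s psi1 ?subrr ?mul0r// /cball/= ltW.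
have H2 := HC n f2 x 0 B n1 bf2 (lexx 0) B0.
have {}H2 : `|sigma_op h n f2 x| <= C' * (n `^ (- gamma) * B).
  rewrite mulr0 add0r in H2; apply: H2 => y.
  have [yr|yr] := ltP (mdist x y) (r / 2); last by right.
  left; rewrite f2z ?normr0// (le_lt_trans (metric_triangle _ x _))//; lra.
have e : f x - sigma_op h n f x =
  \sum_(k <- J) ((psi k \* f) x - sigma_op h n (psi k \* f) x) - sigma_op h n f2 x.
  rewrite -fE sigma_opB// sumrB sigma_op_sum//.
  have -> : \sum_(k <- J) (psi k \* f) x = f x; last by ring.
  by rewrite -[RHS]mul1r -(psi1 x) ?mulr_suml// /cball/= ltW// (lt_trans xr)//; lra.
rewrite e (le_trans (ler_normB _ _))// mulrDl lerD//.
  by rewrite (le_trans (ler_norm_sum _ _ _))// HK.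
by rewrite -mulrA [B * _]mulrC.
Qed.

(** Localization controls the image of f - f(x0), but constants are not assumed to be diffusion
    polynomials. That the image of 1 tends to 1 comes from [sigma_local_rate] for the constant 1,
    the products psi_k * 1 being smooth. *)
Lemma sigma_pointwise f : has_partition_of_unity X -> continuous f ->
  forall x, (fun n => sigma_op h (2 ^+ n) f x) @ \oo --> f x.
Proof.
move=> pou cf x0.
have [J [psi [HJ J1]]] := partition_of_unity_local x0 pou ltr01.
have c1 : continuous ((fun=> 1) : X -> R) by move=> y; exact: cvg_cst.
have s1 k : k \in J -> continuous (psi k).
  by move=> /HJ[Ck _]; exact: Cinfty_continuous Ck.
have s2 k : k \in J -> smooth_class X 1 (psi k \* (fun=> 1)).
  move=> kJ; have [Ck _] := HJ k kJ.
  have -> : psi k \* (fun=> 1) = psi k by apply/funext => y /=; rewrite mulr1.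
  exact: Ck.
have [K K0 HK] := sigma_local_rate ltr01 ltr01 c1 s1 J1 s2.
have [C C0 Hloc] := sigma_local X filt (ler01 : (0 : R) <= 1).
have [B B0 fB] := continuous_bounded cf.
apply/cvgrPdist_le => e e0.
have C1 : 0 < C + 1 by rewrite ltr_wpDl.
(* [d] depends on the operator bound [C] only; the radius on which f varies by at most [d], and then
   [C'], are chosen afterwards. *)
pose d := e / 3 / (C + 1); have d0 : 0 < d by rewrite !divr_gt0.
have /cvgrPdist_le/(_ d d0) := cf x0.
rewrite near_simpl => /nbhs_ballP[r /= r0 Hr].
have [C' C'0 HC] := Hloc r r0.
have [n0 Hn0] : exists n0 : nat, forall n, (n0 <= n)%N ->
    (K * B + C' * (2 * B)) * (2 ^+ n) `^ (-1) <= e / 3.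
  have : (fun n => (K * B + C' * (2 * B)) * (2^-1) ^+ n) @ \oo --> (K * B + C' * (2 * B)) * 0.
    by apply: cvgMr; apply: cvg_expr; rewrite ger0_norm ?invr_ge0// invf_lt1// ltr1n.
  rewrite mulr0 => /cvgr_le/(_ (e / 3)) []; first by rewrite divr_gt0.
  move=> n0 _ H; exists n0 => n nn; have := H n nn.
  by rewrite /= powR_inv1 ?exprn_ge0// exprVn.
exists n0 => // n /= nn; have := Hn0 n nn.
set N := 2 ^+ n; have N1 : 1 <= N by rewrite exprn_ege1// ler1n.
move=> HN.
have bf := bounded_measurable_continuous cf.
have bc : bounded_measurable ((fun=> f x0) : X -> R) by exact: bounded_measurable_cst.
have bc' : bounded_measurable ((fun=> - f x0) : X -> R) by exact: bounded_measurable_cst.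
have bfc : bounded_measurable (fun y => f y - f x0).
  exact: bounded_measurableD bf bc'.
have e1 := @sigma_opB R X h N f (fun=> f x0) x0 bf bc.
have e2 : sigma_op h N (fun=> f x0) x0 = f x0 * sigma_op h N (fun=> 1) x0.
  rewrite !sigma_op_mean//; last exact: bounded_measurable_cst.
  rewrite -meanZ; last first.
    apply: bounded_measurableM; first exact: bounded_measurable_cst.
    exact: bounded_measurable_kernel1.
  by congr mean; apply/funext => y; rewrite mul1r.
have h1 : `|1 - sigma_op h N (fun=> 1) x0| <= K * N `^ (-1).
  by apply: HK => //; rewrite mdistxx divr_gt0.
have h2 : `|sigma_op h N (fun y => f y - f x0) x0| <= C * d + C' * (N `^ (-1) * (2 * B)).
  apply: HC => //; [exact: ltW|exact: mulr_ge0|move=> y].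
  have [yr|yr] := ltP (mdist x0 y) r.
    by left; rewrite distrC; apply: Hr; rewrite ballEmdist.
  right; split => //; rewrite (le_trans (ler_normB _ _))// mulr2n mulrDl mul1r.
  by rewrite lerD.
have -> : f x0 - sigma_op h N f x0 =
   f x0 * (1 - sigma_op h N (fun=> 1) x0) - sigma_op h N (fun y => f y - f x0) x0.
  by rewrite e1 e2; ring.
rewrite (le_trans (ler_normB _ _))//.
rewrite (le_trans (lerD (_ : _ <= B * (K * N `^ (-1))) h2))//.
  by rewrite normrM ler_pM.
have Cd : C * d <= e / 3.
  have dC : d * (C + 1) = e / 3 by rewrite divfK// gt_eqF.
  by rewrite -dC mulrDr mulr1 [d * C]mulrC lerDl ltW.
by move: HN Cd; move: (N `^ _) => z; lra.
Qed.

(** The local rates have constants depending on the centre. Compactness is used in its near-covering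
    form, along constants tending to +oo. *)
Lemma sigma_compact_rate (gamma : R) (A : set X) f : 0 < gamma ->
  has_partition_of_unity X -> continuous f -> compact A ->
  smooth_class_on X gamma A f ->
  exists2 K : R, 0 <= K & forall n x, 1 <= n -> A x ->
    `|f x - sigma_op h n f x| <= K * n `^ (- gamma).
Proof.
move=> g0 pou cf cA sf.
pose P (K : R) (x : X) := forall n, 1 <= n -> `|f x - sigma_op h n f x| <= K * n `^ (- gamma).
have [K [_ HK]] : \forall K \near +oo%R, A `<=` P K.
  apply: (compact_near_coveringP A).1 => // x0 Ax0.
  have [r r0 Hr] := sf x0 Ax0.
  (* The local partition of unity has supports three times wider than the ball that it covers. *)
  have r30 : 0 < r / 3 by rewrite divr_gt0.
  have [J [psi [HJ J1]]] := partition_of_unity_local x0 pou r30.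
  have s1 k : k \in J -> continuous (psi k).
    by move=> /HJ[Ck _]; exact: Cinfty_continuous Ck.
  have s2 k : k \in J -> smooth_class X gamma (psi k \* f).
    move=> kJ; apply: Hr; have := HJ k kJ.
    by have -> : 3 * (r / 3) = r by rewrite mulrC divfK.
  have [K K0 HK] := sigma_local_rate g0 r30 cf s1 J1 s2.
  exists (ball x0 (r / 3 / 2), [set k | K <= k]) => /=.
    split; first by apply: nbhsx_ballx; rewrite divr_gt0.
    by exists K; split; [exact: num_real|move=> z /ltW].
  move=> [x k] /= [xr Kk] n n1.
  rewrite (le_trans (HK n x n1 _)) ?ler_wpM2r ?powR_ge0//.
  by move: xr; rewrite ballEmdist.
exists (Num.max 0 (K + 1)); first by rewrite le_max lexx.
have K1 : K < K + 1 by rewrite ltrDl.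
move=> n x n1 Ax; have := HK (K + 1) K1 x Ax n n1.
move=> /le_trans; apply; rewrite ler_wpM2r ?powR_ge0//.
by rewrite le_max lexx orbT.
Qed.

End one_space_local.

(** * The joint operators *)

Section joint_lift.
Variables (R : realType) (X1 X2 : data_space R) (d12 : X1 -> X2 -> R).
Variables (Am L : nat -> nat -> R) (Q q1 q2 : R) (h : R -> R) (cs : R) (S : nat).
Hypothesis joint : joint_data_space d12 Am L Q q1 q2.
Hypothesis filt : lowpass_filter h.
Hypothesis cs_gt0 : 0 < cs.
Hypothesis preserve : polynomial_preservation X1 X2 h Am L cs.
Hypothesis pou2 : has_partition_of_unity X2.
Hypothesis S_large : Num.max Q (Num.max q1 q2) + 1 < S%:R.

Notation T := (joint_sigma X1 X2 h Am L).

Lemma SQ : Q + 1 <= S%:R.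
Proof.
apply/ltW; apply: le_lt_trans S_large; rewrite lerD2r.
by rewrite le_max lexx.
Qed.

Lemma Sq2 : q2 + 1 <= S%:R.
Proof.
apply/ltW; apply: le_lt_trans S_large; rewrite lerD2r.
by rewrite le_max; apply/orP; right; rewrite le_max lexx orbT.
Qed.

Lemma q2_gt0 : 0 < q2. Proof. by case: joint => _ _ _ []. Qed.

Lemma joint_distance_continuous x1 : continuous (d12 x1).
Proof.
case: joint => [[_ _ tri] _ _ _ _] y; apply/cvgrPdist_lt => e e0.
have : \forall z \near y, ball y e z by exact: nbhsx_ballx.
apply: filterS => z; rewrite ballEmdist/= => yz.
have h1 := tri x1 y z; have h2 := tri x1 z y.
rewrite (metric_sym z y) in h1.
by rewrite ltr_norml; apply/andP; split; lra.
Qed.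

Lemma bounded_measurable_joint_kernel n x : bounded_measurable (@joint_kernel R X1 X2 Am L h n x).
Proof.
apply: bounded_measurable_sum => p.
have -> : (fun y : X2 => Am p.1 p.2 * ds_phi p.1 x * ds_phi p.2 y * h (L p.1 p.2 / n)) =
    (fun y : X2 => (Am p.1 p.2 * ds_phi p.1 x * h (L p.1 p.2 / n)) * ds_phi p.2 y).
  by apply/funext => y /=; ring.
exact/bounded_measurableZ/bounded_measurable_phi.
Qed.

Lemma joint_sigmaB n f g x : 0 < n -> bounded_measurable f -> bounded_measurable g ->
  T n (fun y => f y - g y) x = T n f x - T n g x.
Proof.
move=> n0 bf bg.
have bN : bounded_measurable (fun y => -1 * g y) by exact: bounded_measurableZ.
have -> : (fun y => f y - g y) = (fun y => f y + (-1 * g y)).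
  by apply/funext => y; rewrite mulN1r.
have bk := bounded_measurable_joint_kernel n x.
rewrite !(joint_sigma_mean joint filt)//; last exact: bounded_measurableD.
set k := joint_kernel _ _ _ _ _ in bk *.
have -> : (fun y => (f y + -1 * g y) * k y) = (fun y => f y * k y + -1 * (g y * k y)).
  by apply/funext => y; ring.
rewrite (@meanD _ _ (fun y => f y * k y) (fun y => -1 * (g y * k y))).
- by rewrite meanZ ?mulN1r//; exact: bounded_measurableM.
- exact: bounded_measurableM.
- by apply: bounded_measurableZ; exact: bounded_measurableM.
Qed.

Lemma joint_sigma_local : exists2 C : R, 0 <= C &
  forall (n r : R) g x (a b : R), 0 < n -> 0 < r -> bounded_measurable g -> 0 <= a -> 0 <= b ->
    (forall y, `|g y| <= a \/ (`|g y| <= b /\ r <= d12 x y)) ->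
    `|T n g x| <= C * (n `^ (Q - q2) * a + n `^ (Q - S%:R) * r `^ (q2 - S%:R) * b).
Proof.
have S0 : (0 < S)%N.
  by rewrite -(ltr_nat R) (lt_le_trans _ Sq2)// ltr_wpDl// ltW// q2_gt0.
have qM : q2 <= S.-1%:R by have := Sq2; rewrite -[in S%:R](prednK S0) -natr1 lerD2r.
have [C1 C10 Hk] := joint_kernel_localization joint filt S.
case: (joint) => [[d0 _ _] _ _ _ [c [c1 [c2 [C [[_ _ _ C0] HC]]]]]].
have [Cw Cw0 CwE] : exists2 Cw : R, 0 <= Cw & C * 2 ^+ S * 2 = Cw.
  exists (C * 2 ^+ S * 2) => //; apply: mulr_ge0 => //; apply: mulr_ge0; first exact: ltW.
  exact: exprn_ge0.
exists (C1 * Cw); first exact: mulr_ge0.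
move=> n r g x a b n0 r0 bg a0 b0 gab.
have A0 : 0 <= C1 * n `^ Q by rewrite mulr_ge0 ?powR_ge0.
have Hmu s : 0 < s -> (ds_mu X2 [set y | (d12 x y <= s)%R] <= (C * s `^ q2)%:E)%E.
  by move=> s0; have [H _ _] := HC x point; case: (H s s0).
have Hk' y : `|@joint_kernel R X1 X2 Am L h n x y| <= C1 * n `^ Q * Num.max 1 (n * d12 x y) ^- S.-1.+1.
  by rewrite prednK//; exact: Hk.
have := mean_kernel_bound (@joint_distance_continuous x) (d0 x) A0 (ltW C0) (ltW q2_gt0) qM n0 r0 a0 b0
  Hmu (bounded_measurable_joint_kernel n x) bg Hk' gab.
rewrite prednK// -(joint_sigma_mean joint filt)// CwE => H; apply: (le_trans H).
rewrite le_eqVlt; apply/orP; left; apply/eqP.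
have pB (z p p' : R) : 0 < z -> z `^ (p - p') = z `^ p * z `^ (- p').
  by move=> z0; rewrite powRD//; apply/implyP => _; rewrite gt_eqF.
rewrite !pB// exprMn invfM -!powR_mulrn ?(ltW n0) ?(ltW r0)// -!powRN.
by ring.
Qed.

Lemma pow2E (m : nat) (p : R) : (2 ^+ m) `^ p = 2 `^ (m%:R * p).
Proof. by rewrite powRrM powR_mulrn. Qed.

(** [w] and [e] are the powers of n = 2^m that multiply the near and the far contribution in
    [joint_sigma_local]. *)
Let w (m : nat) : R := 2 `^ (m%:R * (Q - q2)).
Let e (m : nat) : R := 2 `^ (m%:R * (Q - S%:R)).

Lemma e_le m : e m <= (2 ^+ m)^-1.
Proof.
rewrite /e -pow2E -[leRHS]powR_inv1 ?exprn_ge0//; apply: ler_powR.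
  by rewrite exprn_ege1// ler1n.
by have := SQ; lra.
Qed.

Lemma eS m : e m.+1 <= e m / 2.
Proof.
rewrite /e -[m.+1%:R]natr1 mulrDl mul1r powRD; last by apply/implyP => _; rewrite gt_eqF.
rewrite ler_wpM2l ?powR_ge0// -[leRHS]powR_inv1//; apply: ler_powR.
  by rewrite ler1n.
by have := SQ; lra.
Qed.

(** As S >= Q + 1, each term is at most half of the previous one; carrying [2 * e k] on the left
    makes the induction close. *)
Lemma sum_e n k : (n <= k)%N -> \sum_(n <= m < k) e m <= 2 * e n.
Proof.
move=> nk; suff : \sum_(n <= m < k) e m + 2 * e k <= 2 * e n.
  by apply: le_trans; rewrite lerDl mulr_ge0 ?powR_ge0.
elim: k nk => [|k IH].
  by rewrite leqn0 => /eqP ->; rewrite big_geq// add0r.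
rewrite leq_eqVlt => /orP[/eqP ->|nk]; first by rewrite big_geq// add0r.
rewrite big_nat_recr//= -addrA (le_trans _ (IH nk))// lerD2l.
by have := eS k; lra.
Qed.

Lemma sigma_bounded : exists2 C : R, 0 <= C & forall n f (F : R), 1 <= n ->
  bounded_measurable f -> (forall y, `|f y| <= F) -> forall y : X2, `|sigma_op h n f y| <= C * F.
Proof.
have [C C0 /(_ 1 ltr01)[C' _ H]] := sigma_local X2 filt (lexx (0 : R)).
exists C => // n f F n1 bf fF y.
have F0 : 0 <= F by exact: le_trans (normr_ge0 _) (fF y).
have := H n f y F 0 n1 bf F0 (lexx 0) (fun y => or_introl (fF y)).
by rewrite !mulr0 addr0.
Qed.

Lemma sigma_op_diffpoly n (f : X2 -> R) : diffpoly X2 n (sigma_op h n f).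
Proof. by exists (fun k => h (ds_lam X2 k / n) * fcoef f k). Qed.

Lemma sigma_op_bm n (f : X2 -> R) : bounded_measurable (sigma_op h n f).
Proof.
exact/bounded_measurable_continuous/(diffpoly_continuous (sigma_op_diffpoly n f)).
Qed.

Lemma joint_sigma_diag f n m : cs * 2 ^+ m <= n ->
  T n (sigma_op h (2 ^+ m) f) = T (cs * 2 ^+ m) (sigma_op h (2 ^+ m) f).
Proof.
by move=> nm; apply: (@preserve (2 ^+ m)) => //; rewrite ?exprn_gt0//; exact: sigma_op_diffpoly.
Qed.

Section fixed_function.
Variables (A : set X2) (f : X2 -> R) (F : R) (dl tau : nat -> R).
Hypothesis cf : continuous f.
Hypothesis fF : forall y, `|f y| <= F.
Hypothesis dl_ge0 : forall m, 0 <= dl m.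
Hypothesis dlP : forall m y, A y -> `|sigma_op h (2 ^+ m.+1) f y - sigma_op h (2 ^+ m) f y| <= dl m.
Hypothesis tauP : forall n k, (n <= k)%N -> \sum_(n <= m < k) w m * dl m <= tau n.
Hypothesis tau0 : tau @ \oo --> (0 : R).

Notation P m := (sigma_op h (2 ^+ m) f).

(** If q2 <= Q, the weights [w] are nondecreasing, so tau k / w k bounds the unweighted tail from k,
    and telescoping up to the pointwise limit f applies. If q2 > Q, the summability may say nothing
    about the convergence of P k, but w k tends to 0 and a bounded [a] is enough. *)
Lemma sigma_approx_on : exists a : nat -> R,
  [/\ forall k, 0 <= a k, forall k y, A y -> `|f y - P k y| <= a k &
      (fun k => w k * a k) @ \oo --> (0 : R)].
Proof.
have F0 : 0 <= F by exact: le_trans (normr_ge0 _) (fF point).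
have w0 k : 0 < w k by exact: powR_gt0.
have tau_ge0 k : 0 <= tau k by have := tauP (leqnn k); rewrite big_geq.
have [qQ|qQ] := leP q2 Q.
  exists (fun k => (w k)^-1 * tau k); split.
  - by move=> k; rewrite mulr_ge0// invr_ge0 ltW.
  - move=> k y Ay.
    have H j : (k <= j)%N -> `|P j y - P k y| <= (w k)^-1 * tau k.
      move=> kj; rewrite -(telescope_sumr (fun m => P m y) kj).
      apply: (le_trans (ler_norm_sum _ _ _)).
      apply: (@le_trans _ _ (\sum_(k <= m < j) (w k)^-1 * (w m * dl m))); last first.
        by rewrite -mulr_sumr ler_wpM2l ?invr_ge0 ?(ltW (w0 _))// tauP.
      rewrite big_nat [leRHS]big_nat; apply: ler_sum => m /andP[km _].
      rewrite (le_trans (dlP m Ay))// mulrA ler_peMl// mulrC ler_pdivlMr// mul1r.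
      apply: ler_powR; first by rewrite ler1n.
      by rewrite ler_wpM2r ?subr_ge0// ler_nat.
    have cv : (fun j => P j y) @ \oo --> f y by exact: sigma_pointwise.
    have cvN : (fun j => `|P j y - P k y|) @ \oo --> `|f y - P k y|.
      by apply: cvg_norm; apply: cvgB => //; exact: cvg_cst.
    have le1 : \forall j \near \oo, `|P j y - P k y| <= (w k)^-1 * tau k.
      by exists k => // j /= kj; exact: H.
    rewrite -(cvg_lim _ cvN)//; apply: limr_le => //.
    by apply/cvg_ex; exists `|f y - P k y|.
  - have -> : (fun k => w k * ((w k)^-1 * tau k)) = tau => //.
    by apply/funext => k; rewrite mulrA divff ?mul1r// gt_eqF.
have [C C0 HC] := sigma_bounded.
exists (fun=> (1 + C) * F); split.
- by move=> _; rewrite mulr_ge0// addr_ge0.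
- move=> k y _; rewrite (le_trans (ler_normB _ _))// mulrDl mul1r lerD//.
  apply: HC => //; first by rewrite exprn_ege1// ler1n.
  exact: bounded_measurable_continuous.
- have : (fun k => (2 `^ (Q - q2)) ^+ k * ((1 + C) * F)) @ \oo --> 0 * ((1 + C) * F).
    apply: cvgMl; apply: cvg_expr; rewrite ger0_norm ?powR_ge0//.
    by rewrite /powR pnatr_eq0/= -[ltRHS]expR0 ltr_expR nmulr_rlt0 ?subr_lt0// ln_gt0// ltr1n.
  rewrite mul0r; suff -> : (fun k => w k * ((1 + C) * F)) =
    (fun k => (2 `^ (Q - q2)) ^+ k * ((1 + C) * F)) by [].
  apply/funext => k; congr (_ * _).
  by rewrite /w mulrC powRrM powR_mulrn// powR_ge0.
Qed.

End fixed_function.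

(* [T n] is constant on diffusion polynomials for large [n], so it suffices to estimate [T n]
   on [f - P m] and, telescoping, on the differences [P m.+1 - P m]: these are controlled by
   [dl] on [A], while outside [A] they are only bounded but far from [x1]. *)
Lemma joint_limit : exists2 c : R, 0 < c & forall (r : R) (A : set X2) (f : X2 -> R) (F : R)
    (dl tau : nat -> R) (x1 : X1),
  0 < r -> continuous f -> (forall y, `|f y| <= F) -> (forall m, 0 <= dl m) ->
  (forall m y, A y -> `|sigma_op h (2 ^+ m.+1) f y - sigma_op h (2 ^+ m) f y| <= dl m) ->
  (forall n k, (n <= k)%N -> \sum_(n <= m < k) w m * dl m <= tau n) ->
  tau @ \oo --> (0 : R) ->
  (forall y, ~ A y -> r <= d12 x1 y) ->
  exists2 E : R, T n f x1 @[n --> +oo%R] --> E &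
    forall n (a : R), 0 <= a -> (forall y, A y -> `|f y - sigma_op h (2 ^+ n) f y| <= a) ->
    `|E - T (cs * 2 ^+ n) f x1| <= c * (w n * a + F * (e n * r `^ (q2 - S%:R)) + tau n).
Proof.
have [CJ CJ0 HJ] := joint_sigma_local.
have [Cs Cs0 HCs] := sigma_bounded.
pose k1 := (2 * cs) `^ (Q - q2); pose k2 := (2 * cs) `^ (Q - S%:R).
pose k3 := cs `^ (Q - q2); pose k4 := cs `^ (Q - S%:R).
have k10 : 0 <= k1 by exact: powR_ge0.
have k20 : 0 <= k2 by exact: powR_ge0.
have k30 : 0 <= k3 by exact: powR_ge0.
have k40 : 0 <= k4 by exact: powR_ge0.
pose c := CJ * (k1 + 4 * k2 * Cs + k3 + k4 * (1 + Cs)) + 1.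
have c1 : CJ * k3 <= c /\ CJ * k1 <= c /\ CJ * (4 * k2 * Cs + k4 * (1 + Cs)) <= c.
  rewrite /c; have a1 : 0 <= CJ * k1 by exact: mulr_ge0.
  have a2 : 0 <= CJ * (k2 * Cs) by apply: mulr_ge0 => //; exact: mulr_ge0.
  have a3 : 0 <= CJ * k3 by exact: mulr_ge0.
  have a4 : 0 <= CJ * (k4 * (1 + Cs)) by apply: mulr_ge0 => //; apply: mulr_ge0 => //; exact: addr_ge0.
  by split; [|split]; lra.
have c0 : 0 < c.
  by rewrite /c ltr_wpDl// mulr_ge0// !addr_ge0// mulr_ge0// ?mulr_ge0// addr_ge0.
exists c => // r A f F dl tau x1 r0 cf fF dl0 dlP tauP tau0 far.
have F0 : 0 <= F by exact: le_trans (normr_ge0 _) (fF point).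
have bf := bounded_measurable_continuous cf.
pose P m := sigma_op h (2 ^+ m) f.
have two1 m : 1 <= 2 ^+ m :> R by rewrite exprn_ege1// ler1n.
have bP m : bounded_measurable (P m) by exact: sigma_op_bm.
have PF m y : `|P m y| <= Cs * F by exact: HCs.
have bD (u v : X2 -> R) : bounded_measurable u -> bounded_measurable v ->
    bounded_measurable (fun y => u y - v y).
  move=> bu bv; have := bounded_measurableD bu (bounded_measurableZ (-1) bv).
  by under eq_fun do rewrite mulN1r.
have w0 k : 0 <= w k by exact: powR_ge0.
have e0 k : 0 <= e k by exact: powR_ge0.
have csm m : 0 < cs * 2 ^+ m by rewrite mulr_gt0// exprn_gt0.
pose rho := r `^ (q2 - S%:R); have rho0 : 0 <= rho by exact: powR_ge0.
have Tloc n (g : X2 -> R) (a b : R) : 0 < n -> bounded_measurable g -> 0 <= a -> 0 <= b ->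
    (forall y, A y -> `|g y| <= a) -> (forall y, `|g y| <= b) ->
    `|T n g x1| <= CJ * (n `^ (Q - q2) * a + n `^ (Q - S%:R) * rho * b).
  move=> n0 bg a0 b0 ga gb; apply: HJ => // y.
  by have [Ay|nA] := EM (A y); [left; exact: ga|right; split => //; exact: far].
(* By polynomial preservation this is the final value of the lift of P m at x1. *)
pose U m := T (cs * 2 ^+ m) (P m) x1.
have TP n m : cs * 2 ^+ m <= n -> T n (P m) x1 = U m.
  by move=> nm; rewrite /U (joint_sigma_diag f nm).
have pm (k p : R) m : 0 < k -> (k * 2 ^+ m) `^ p = k `^ p * 2 `^ (m%:R * p).
  by move=> k0; rewrite powRM ?(ltW k0) ?exprn_ge0// pow2E.
have stepU m : `|U m.+1 - U m| <= CJ * (k1 * (w m * dl m) + k2 * rho * (2 * Cs * F) * e m).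
  (* Both approximants are lifted at the common degree cs 2^(m+1), where the lift of P m is already
     final, so linearity applies to their difference. *)
  have le1 : cs * 2 ^+ m <= cs * 2 ^+ m.+1.
    by rewrite ler_pM2l// exprS ler_peMl ?exprn_ge0// ler1n.
  rewrite -(TP _ _ le1) /U -joint_sigmaB//.
  have CF0 : 0 <= 2 * Cs * F by apply: mulr_ge0 => //; exact: mulr_ge0.
  apply: (le_trans (Tloc _ _ (dl m) (2 * Cs * F) (csm m.+1) (bD _ _ (bP _) (bP _)) (dl0 m) CF0 _ _)).
  - by move=> y; exact: dlP.
  - move=> y; rewrite (le_trans (ler_normB _ _))// -mulrA mulr2n mulrDl mul1r.
    by rewrite lerD.
  rewrite ler_wpM2l// exprS mulrCA mulrA !pm ?mulr_gt0// -/k1 -/k2 -/(w m) -/(e m).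
  by rewrite le_eqVlt; apply/orP; left; apply/eqP; ring.
pose eps n := CJ * (k1 * tau n + k2 * rho * (2 * Cs * F) * (2 * e n)).
have distU n k : (n <= k)%N -> `|U k - U n| <= eps n.
  move=> nk; rewrite -(telescope_sumr U nk).
  apply: (le_trans (ler_norm_sum _ _ _)).
  apply: (@le_trans _ _ (\sum_(n <= m < k)
      CJ * (k1 * (w m * dl m) + k2 * rho * (2 * Cs * F) * e m))).
    exact: ler_sum.
  rewrite -mulr_sumr ler_wpM2l// big_split/= -!mulr_sumr lerD//.
    by rewrite ler_wpM2l// tauP.
  rewrite ler_wpM2l ?sum_e//.
  by apply: mulr_ge0; [exact: mulr_ge0|apply: mulr_ge0 => //; exact: mulr_ge0].
have e_cvg : e @ \oo --> (0 : R).
  apply: (@squeeze_cvgr _ _ _ _ (cst 0) (fun m => (2^-1) ^+ m)); last 2 first.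
  - exact: cvg_cst.
  - by apply: cvg_expr; rewrite ger0_norm ?invr_ge0// invf_lt1// ltr1n.
  by near=> m; rewrite e0/= (le_trans (e_le m))// exprVn.
have eps_cvg : eps @ \oo --> (0 : R).
  have : eps @ \oo --> CJ * (k1 * 0 + k2 * rho * (2 * Cs * F) * (2 * 0)).
    by apply: cvgMr; apply: cvgD; [exact: cvgMr|apply: cvgMr; exact: cvgMr].
  by rewrite !mulr0 addr0 mulr0.
have eps_small d : 0 < d -> exists n0, forall n, (n0 <= n)%N -> eps n <= d.
  by move=> d0; have /cvgr_le/(_ d d0)[n0 _ H] := eps_cvg; exists n0.
have [E UE] : exists E : R, U @ \oo --> E.
  apply/cvg_ex/cauchy_cvgP; apply: cauchy_exP => d d0.
  have d2 : 0 < d / 2 by rewrite divr_gt0.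
  have [n0 Hn0] := eps_small _ d2.
  exists (U n0); exists n0 => // k /= kn.
  rewrite /ball/= distrC (le_lt_trans (distU _ _ kn))// (le_lt_trans (Hn0 _ (leqnn _)))//.
  by rewrite ltr_pdivrMr// ltr_pMr// ltr1n.
have EU n : `|E - U n| <= eps n.
  have cvN : (fun j => `|U j - U n|) @ \oo --> `|E - U n|.
    by apply: cvg_norm; apply: cvgB => //; exact: cvg_cst.
  have le1 : \forall j \near \oo, `|U j - U n| <= eps n.
    by exists n => // j /= nj; exact: distU.
  rewrite -(cvg_lim _ cvN)//; apply: limr_le => //.
  by apply/cvg_ex; exists `|E - U n|.
have fPF m y : `|f y - P m y| <= (1 + Cs) * F.
  by rewrite (le_trans (ler_normB _ _))// mulrDl mul1r lerD.
have CF1 : 0 <= (1 + Cs) * F by rewrite mulr_ge0// addr_ge0.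
exists E.
  have [a [a0 ha wa]] := sigma_approx_on cf fF dl0 dlP tauP tau0.
  pose nu := CJ * ((1 + 2 `^ (Q - q2)) * k3).
  have nu0 : 0 <= nu by apply: mulr_ge0 => //; apply: mulr_ge0 => //; rewrite addr_ge0// powR_ge0.
  pose mu := CJ * k4 * rho * ((1 + Cs) * F).
  pose eta k := nu * (w k * a k) + mu * e k + eps k.
  have eta_cvg : eta @ \oo --> (0 : R).
    have : eta @ \oo --> nu * 0 + mu * 0 + 0.
      by apply: cvgD => //; apply: cvgD; apply: cvgMr.
    by rewrite !mulr0 !addr0.
  (* A real n is compared with the dyadic degree just below it: the lift of P k is final at n, and n
     / (cs 2^k) lies in [1, 2[, so powers of n change by bounded factors. The bound 1 + 2^(Q - q2)
     covers both signs of Q - q2. *)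
  have key n k : cs * 2 ^+ k <= n -> n < cs * 2 ^+ k.+1 -> `|E - T n f x1| <= eta k.
    move=> kn nk; have n0 : 0 < n by exact: lt_le_trans (csm k) kn.
    have -> : E - T n f x1 = (E - U k) - T n (fun y => f y - P k y) x1.
      by rewrite joint_sigmaB// TP//; ring.
    rewrite (le_trans (ler_normB _ _))// addrC /eta lerD//.
    apply: (le_trans (Tloc _ _ (a k) ((1 + Cs) * F) n0 (bD _ _ bf (bP _)) (a0 k) CF1 (ha k) (fPF k))).
    have nE : n = (cs * 2 ^+ k) * (n / (cs * 2 ^+ k)) by rewrite mulrC divfK// gt_eqF.
    set th := n / _ in nE.
    have th1 : 1 <= th by rewrite ler_pdivlMr// mul1r.
    have th0 : 0 <= th by rewrite (le_trans ler01).
    have th2 : th <= 2 by rewrite ler_pdivrMr// mulrCA -exprS ltW.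
    have thp p : n `^ p = cs `^ p * 2 `^ (k%:R * p) * th `^ p.
      by rewrite [in LHS]nE powRM ?(ltW (csm k))// pm.
    have hth : th `^ (Q - q2) <= 1 + 2 `^ (Q - q2).
      have [qq|qq] := leP 0 (Q - q2).
        apply: (@le_trans _ _ (2 `^ (Q - q2))); last by rewrite lerDr.
        by apply: (ge0_ler_powR qq _ _ th2); rewrite nnegrE.
      apply: (@le_trans _ _ (th `^ 0)); first by apply: ler_powR => //; exact: ltW.
      by rewrite powRr0 lerDl powR_ge0.
    have hth' : th `^ (Q - S%:R) <= 1.
      apply: (@le_trans _ _ (th `^ 0)); last by rewrite powRr0.
      by apply: ler_powR => //; have := SQ; lra.
    rewrite !thp -/k3 -/k4 -/(w k) -/(e k) mulrDr; apply: lerD.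
      rewrite [leRHS](_ : _ = CJ * k3 * w k * a k * (1 + 2 `^ (Q - q2))); last by rewrite /nu; ring.
      rewrite [leLHS](_ : _ = CJ * k3 * w k * a k * th `^ (Q - q2)); last by ring.
      by apply: ler_wpM2l hth; apply: mulr_ge0 => //; apply: mulr_ge0 => //; exact: mulr_ge0.
    rewrite [leLHS](_ : _ = CJ * k4 * rho * ((1 + Cs) * F) * e k * th `^ (Q - S%:R)); last by ring.
    rewrite -[leRHS]mulr1; apply: ler_wpM2l => //.
    apply: mulr_ge0 => //; apply: mulr_ge0 => //; apply: mulr_ge0 => //; exact: mulr_ge0.
  apply/cvgrPdist_le => d d0.
  have /cvgr_le/(_ d d0)[k0 _ Hk0] := eta_cvg.
  exists (cs * 2 ^+ k0); split; first exact: num_real.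
  move=> n n0; have nk0 : cs * 2 ^+ k0 <= n by exact: ltW.
  have ex : exists k, n < cs * 2 ^+ k.
    have [J HJ'] := ex_dyadic (n / cs); exists J.+1.
    rewrite [cs * _]mulrC -ltr_pdivrMr//; apply: (le_lt_trans HJ').
    by rewrite exprS ltr_pMl ?exprn_gt0// ltr1n.
  have [k nk kmin] := find_ex_minn ex.
  have k0k : (k0 < k)%N.
    rewrite ltnNge; apply/negP => kk.
    have kk' : cs * 2 ^+ k <= cs * 2 ^+ k0 by rewrite ler_pM2l// ler_weXn2l// ler1n.
    by have := lt_le_trans nk kk'; rewrite ltNge nk0.
  case: k nk kmin k0k => // k nk kmin k0k.
  apply: (le_trans (key n k _ nk)); last exact: Hk0.
  by rewrite leNgt; apply/negP => /kmin; rewrite ltnn.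
move=> n a a0 ha.
have -> : E - T (cs * 2 ^+ n) f x1 = (E - U n) - T (cs * 2 ^+ n) (fun y => f y - P n y) x1.
  by rewrite joint_sigmaB// TP//; ring.
have H1 := EU n.
have H2 := Tloc _ _ a ((1 + Cs) * F) (csm n) (bD _ _ bf (bP _)) a0 CF1 ha (fPF n).
rewrite !pm// -/k3 -/k4 -/(w n) -/(e n) in H2.
apply: (le_trans (ler_normB _ _)); apply: (le_trans (lerD H1 H2)).
have [c2 [c3 c4]] := c1.
have t1 : CJ * k3 * (w n * a) <= c * (w n * a) by rewrite ler_wpM2r// mulr_ge0.
have tn0 : 0 <= tau n by have := tauP n n (leqnn n); rewrite big_geq.
have t2 : CJ * k1 * tau n <= c * tau n by rewrite ler_wpM2r.
have z0 : 0 <= F * (e n * rho) by rewrite mulr_ge0// mulr_ge0.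
have t3 := ler_wpM2r z0 c4.
rewrite -/rho !mulrDr; apply: le_trans (lerD (lerD t1 t3) t2).
by rewrite le_eqVlt; apply/orP; left; apply/eqP; rewrite /eps; ring.
Unshelve. all: by end_near.
Qed.

End joint_lift.

(** * Smoothness of the lifted function *)

Lemma supnorm_fin (R : realType) (T : Type) (K : set T) (f : T -> R) (B : R) :
  0 <= B -> (forall x, K x -> `|f x| <= B) ->
  [/\ supnorm K f = (fine (supnorm K f))%:E, 0 <= fine (supnorm K f) &
      forall x, K x -> `|f x| <= fine (supnorm K f)].
Proof.
move=> B0 fB; have sB : (supnorm K f <= B%:E)%E.
  by apply: supnorm_le => [|x Kx]; rewrite lee_fin// fB.
have sf : supnorm K f \is a fin_num.
  by rewrite ge0_fin_numE ?supnorm_ge0// (le_lt_trans sB)// ltry.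
split; rewrite ?fineK ?fine_ge0 ?supnorm_ge0// => x Kx.
by rewrite -lee_fin fineK// supnorm_ge.
Qed.

Lemma summable_tails (R : realType) (u : nat -> R) : (forall m, 0 <= u m) ->
  (\sum_(0 <= m <oo) (u m)%:E < +oo)%E ->
  exists tau : nat -> R, [/\
    (forall n, \sum_(n <= m <oo) (u m)%:E = (tau n)%:E)%E,
    (forall n k, (n <= k)%N -> \sum_(n <= m < k) u m <= tau n) &
    tau @ \oo --> (0 : R)].
Proof.
move=> u0 su; have uE0 m : (0 <= (u m)%:E)%E by rewrite lee_fin.
have tf n : (\sum_(n <= m <oo) (u m)%:E \is a fin_num)%E.
  rewrite ge0_fin_numE; last by apply: nneseries_ge0.
  apply: le_lt_trans su; rewrite (@nneseries_split _ _ 0 n)// add0n.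
  by rewrite leeDr// sume_ge0.
exists (fun n => fine (\sum_(n <= m <oo) (u m)%:E)%E); split.
- by move=> n; rewrite fineK.
- move=> n k nk; rewrite -lee_fin fineK// -sumEFin.
  by apply: (@nneseries_lim_ge _ (fun m => (u m)%:E) xpredT n k).
- apply: fine_cvg; apply: nneseries_tail_cvg => //.
Qed.

Lemma powR_small (R : realType) (p d : R) : 0 < p -> 0 < d ->
  \forall n \near +oo%R, n `^ (- p) <= d.
Proof.
move=> p0 d0; pose t := d `^ (- p^-1); have t0 : 0 < t by exact: powR_gt0.
exists t; split; first exact: num_real.
move=> n tn; have n0 : 0 < n by exact: lt_trans tn.
have -> : d = t `^ (- p) by rewrite /t -powRrM mulrNN mulVf ?gt_eqF// powRr1// ltW.
rewrite !powRN lef_pV2 ?posrE ?powR_gt0//.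
by apply: ge0_ler_powR; rewrite ?nnegrE ?(ltW p0) ?(ltW t0) ?(ltW n0) ?(ltW tn).
Qed.

(** For n >= D the largest degree D 2^k not exceeding n is used, at the cost of a factor (2 D)^p;
    for n < D the zero polynomial serves. These are the two terms of [K4]. *)
Lemma smooth_class_intro (R : realType) (X : data_space R) (g : X -> R) (p D K M : R) :
  0 < p -> 1 <= D -> 0 <= K -> 0 <= M -> (forall x, `|g x| <= M) ->
  (forall k : nat, exists2 P, diffpoly X (D * 2 ^+ k) P &
    forall x, `|g x - P x| <= K * (2 ^+ k) `^ (- p)) ->
  smooth_class X p g.
Proof.
move=> p0 D1 K0 M0 gM H; have D0 : 0 < D by exact: lt_le_trans D1.
pose K4 := K * (2 * D) `^ p + D `^ p * M.
have K40 : 0 <= K4 by rewrite addr_ge0// mulr_ge0 ?powR_ge0.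
have E0 n : (0 <= approx_deg n g)%E.
  by apply: le_ereal_inf_tmp => _ [P _ <-]; exact: supnorm_ge0.
have Ele n P (e : R) : 0 <= e -> diffpoly X n P -> (forall x, `|g x - P x| <= e) ->
    (approx_deg n g <= e%:E)%E.
  move=> e0 dP gP; apply: ge_ereal_inf; exists (supnorm setT (g \- P)); first by exists P.
  by apply: supnorm_le => [|x _]; rewrite lee_fin//; exact: gP.
have key n : 0 < n -> (approx_deg n g <= (K4 * n `^ (- p))%:E)%E.
  move=> n0; have ng : 0 < n `^ p by rewrite powR_gt0.
  have [nD|Dn] := ltP n D.
    apply: (@le_trans _ _ M%:E).
      by apply: (Ele n (fun=> 0)) => //; [exact: diffpoly0|move=> x; rewrite subr0].
    rewrite lee_fin powRN ler_pdivlMr// /K4.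
    apply: (@le_trans _ _ (D `^ p * M)); last by rewrite lerDr mulr_ge0 ?powR_ge0.
    rewrite mulrC ler_wpM2r//; apply: ge0_ler_powR; rewrite ?nnegrE ?(ltW p0) ?(ltW D0)
      ?(ltW n0) ?(ltW nD)//.
  have ex : exists k, n < D * 2 ^+ k.
    have [J HJ'] := ex_dyadic (n / D); exists J.+1.
    rewrite [D * _]mulrC -ltr_pdivrMr//; apply: (le_lt_trans HJ').
    by rewrite exprS ltr_pMl ?exprn_gt0// ltr1n.
  have [k nk kmin] := find_ex_minn ex.
  case: k nk kmin => [|k] nk kmin; first by move: nk; rewrite expr0 mulr1 ltNge Dn.
  have kn : D * 2 ^+ k <= n by rewrite leNgt; apply/negP => /kmin; rewrite ltnn.
  have [P dP gP] := H k.
  apply: (@le_trans _ _ (K * (2 ^+ k) `^ (- p))%:E).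
    by apply: (Ele n P) => //; [rewrite mulr_ge0 ?powR_ge0|exact: diffpoly_mono dP].
  have kk : 0 < 2 ^+ k :> R by rewrite exprn_gt0.
  rewrite lee_fin [n `^ (- p)]powRN ler_pdivlMr// mulrAC.
  apply: (@le_trans _ _ (K * (2 * D) `^ p)); last by rewrite lerDl mulr_ge0 ?powR_ge0.
  rewrite powRN ler_pdivrMr ?powR_gt0// -mulrA ler_wpM2l// -powRM ?mulr_ge0 ?(ltW D0) ?(ltW kk)//.
  apply: ge0_ler_powR; rewrite ?nnegrE ?(ltW p0) ?(ltW n0) ?mulr_ge0 ?(ltW D0) ?(ltW kk)//.
  by rewrite ltW// (lt_le_trans nk)// exprS mulrCA mulrA.
split.
  apply: (@squeeze_cvge _ _ _ _ (cst 0%E) _ (fun n : R => (K4 * n `^ (- p))%:E)).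
  - exists 0; split; first exact: num_real.
    by move=> n n0; rewrite /= E0 key.
  - exact: cvg_cst.
  - apply: cvg_EFin; first by near=> n.
    apply/cvgrPdist_le => d d0 /=.
    have d1 : 0 < d / (K4 + 1) by rewrite divr_gt0// ltr_wpDl.
    have := powR_small p0 d1; apply: filterS => n.
    rewrite ler_pdivlMr ?ltr_wpDl// => h.
    rewrite sub0r normrN ger0_norm ?mulr_ge0 ?powR_ge0// mulrC.
    by apply: le_trans h; rewrite ler_wpM2l ?powR_ge0// lerDl.
apply: (@le_lt_trans _ _ (M%:E + K4%:E)%E); last by rewrite -EFinD ltry.
apply: leeD.
  by apply: supnorm_le => [|x _]; rewrite lee_fin.
apply: ge_ereal_sup => _ [n n0 <-].
have ng : 0 < n `^ p by rewrite powR_gt0.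
by rewrite -lee_pdivlMl// -EFinM mulrC -powRN; exact: key.
Unshelve. all: by end_near. Qed.

Lemma joint_sigma_diffpoly (R : realType) (X1 X2 : data_space R) (d12 : X1 -> X2 -> R)
    (Am L : nat -> nat -> R) (Q q1 q2 : R) (h : R -> R) (alpha n : R) f :
  joint_data_space d12 Am L Q q1 q2 -> lowpass_filter h -> 0 < alpha ->
  (forall j k, ds_lam X1 j <= alpha * L j k) -> 0 < n ->
  diffpoly X1 (alpha * n) (joint_sigma X1 X2 h Am L n f).
Proof.
move=> joint filt a0 aL n0; apply/diffpolyE.
pose c (p : nat * nat) := h (L p.1 p.2 / n) * Am p.1 p.2 * fcoef f p.2.
exists (fun j => \sum_(p <- jwindow L n | p.1 == j) c p); apply/funext => x.
rewrite (joint_sigmaE joint filt)//.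
under [RHS]eq_bigr do rewrite mulr_suml big_mkcond.
rewrite exchange_big/= big_seq [RHS]big_seq; apply: eq_bigr => p pn.
rewrite (in_window (joint_fin joint)) in pn.
have pw : p.1 \in window (ds_lam X1) (alpha * n).
  rewrite (in_window (@lam_fin R X1)) (le_lt_trans (aL p.1 p.2))//.
  by rewrite ltr_pM2l.
rewrite (bigD1_seq p.1) ?fset_uniq//= eqxx big1 ?addr0//.
by move=> j /negPf pj; rewrite eq_sym pj.
Qed.

(** The triangle inequality of the joint distance spends s of the margin s + r; the [eps] accounts
    for the infimum in the distance to [Bm]. *)
Lemma far_from_complement (R : realType) (X1 X2 : data_space R) (d12 : X1 -> X2 -> R)
    (r s : R) (A : set X2) (Bm : set X1) : joint_distance d12 ->
  Bm `<=` [set x1 | ((s + r)%:E <= dist_to d12 x1 (~` A))%E] ->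
  forall x, (dist_to (@mdist R X1) x Bm <= s%:E)%E -> forall y, ~ A y -> r <= d12 x y.
Proof.
move=> [_ tri _] BmA x xB y nA; apply/ler_addgt0Pr => eps eps0.
have lt1 : (dist_to (@mdist R X1) x Bm < (s + eps)%:E)%E.
  by rewrite (le_lt_trans xB)// lte_fin ltrDl.
have [_ [b Bb <-]] := ereal_inf_lt lt1; rewrite lte_fin => xb.
have h1 : ((s + r)%:E <= (d12 b y)%:E)%E.
  by apply: le_trans (BmA b Bb) _; apply: ereal_inf_lbound; exists y.
rewrite lee_fin in h1; have := tri b x y; rewrite metric_sym => h2.
by lra.
Qed.

Lemma sum_powR_geom (R : realType) (p : R) (n k : nat) : 0 < p ->
  \sum_(n <= m < k) (2 ^+ m) `^ (- p) <= (1 - 2 `^ (- p))^-1 * (2 ^+ n) `^ (- p).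
Proof.
move=> p0; set z := 2 `^ (- p).
have z1 : z < 1.
  by rewrite /z powRN invf_lt1 ?powR_gt0// /powR pnatr_eq0/= -[ltLHS]expR0 ltr_expR
    mulr_gt0// ln_gt0// ltr1n.
have z0 : 0 < z by rewrite powR_gt0.
have e m : (2 ^+ m) `^ (- p) = z ^+ m.
  by rewrite -powR_mulrn// -powRrM mulrC powRrM powR_mulrn// ltW.
have zz : 0 < 1 - z by rewrite subr_gt0.
under eq_bigr do rewrite e; rewrite e mulrC ler_pdivlMr//.
have [nk|kn] := leqP n k; last by rewrite big_geq ?mul0r ?exprn_ge0 ?ltW// ltnW.
suff -> : (\sum_(n <= m < k) z ^+ m) * (1 - z) = z ^+ n - z ^+ k.
  by rewrite gerBl exprn_ge0// ltW.
rewrite mulr_suml -[RHS]opprB; have <- := telescope_sumr (fun m => z ^+ m) nk.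
by rewrite -sumrN; apply: eq_bigr => m _ /=; rewrite exprS; ring.
Qed.

Section smooth_lift.
Variables (R : realType) (X1 X2 : data_space R) (d12 : X1 -> X2 -> R)
  (Am L : nat -> nat -> R) (Q q1 q2 : R) (h : R -> R) (cs : R) (S : nat)
  (joint : joint_data_space d12 Am L Q q1 q2)
  (filt : lowpass_filter h)
  (cs_gt0 : 0 < cs)
  (preserve : polynomial_preservation X1 X2 h Am L cs)
  (pou2 : has_partition_of_unity X2)
  (S_large : Num.max Q (Num.max q1 q2) + 1 < S%:R).

Notation T := (joint_sigma X1 X2 h Am L).
Notation E f := (joint_lift X1 X2 h Am L f).

Lemma joint_sigma_continuous n f : 0 < n -> continuous (T n f).
Proof.
move=> n0.
have -> : T n f = fun x => \sum_(p <- jwindow L n)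
    h (L p.1 p.2 / n) * Am p.1 p.2 * fcoef f p.2 * ds_phi p.1 x.
  by apply/funext => x; rewrite (joint_sigmaE joint filt).
by apply: continuous_bigsum => p x; apply: cvgMr; exact: ds_phi_cont.
Qed.

(** All three terms of [joint_limit] are O(2^(-n p)): the near term because w n 2^(-n gamma) = 2^(-n
    p), the tail because p > 0 makes it geometric, and the far term because gamma < S - q2 means Q -
    S < -p. *)
Lemma joint_lift_rate (gamma r : R) (A : set X2) (B : set X1) f :
  0 < gamma -> Q - q2 < gamma -> gamma < S%:R - q2 -> 0 < r -> compact A ->
  (forall x, B x -> forall y, ~ A y -> r <= d12 x y) ->
  continuous f -> smooth_class_on X2 gamma A f ->
  exists2 K : R, 0 <= K & forall n x, B x ->
    `|E f x - T (cs * 2 ^+ n) f x| <= K * (2 ^+ n) `^ (- (gamma - Q + q2)).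
Proof.
move=> g0 gQ gS r0 cA far cf sf; set p := gamma - Q + q2.
have p0 : 0 < p by rewrite /p; lra.
have [K K0 HK] := sigma_compact_rate filt g0 pou2 cf cA sf.
have [c c0 Hlim] := joint_limit joint filt cs_gt0 preserve pou2 S_large.
have [F F0 fF] := continuous_bounded cf.
pose w (m : nat) : R := 2 `^ (m%:R * (Q - q2)).
pose dl (m : nat) := 2 * K * (2 ^+ m) `^ (- gamma).
have two1 m : 1 <= 2 ^+ m :> R by rewrite exprn_ege1// ler1n.
have twop m : 0 < 2 ^+ m :> R by rewrite exprn_gt0.
have dl0 m : 0 <= dl m by rewrite /dl mulr_ge0 ?powR_ge0// mulr_ge0.
have dlP m y : A y -> `|sigma_op h (2 ^+ m.+1) f y - sigma_op h (2 ^+ m) f y| <= dl m.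
  move=> Ay; have h1 := HK _ y (two1 m) Ay; have h2 := HK _ y (two1 m.+1) Ay.
  have h3 : (2 ^+ m.+1) `^ (- gamma) <= (2 ^+ m) `^ (- gamma) :> R.
    rewrite !powRN lef_pV2 ?posrE ?powR_gt0//.
    apply: ge0_ler_powR; rewrite ?nnegrE ?(ltW g0) ?exprn_ge0//.
    by rewrite exprS ler_peMl// ?ler1n// ltW.
  have -> : sigma_op h (2 ^+ m.+1) f y - sigma_op h (2 ^+ m) f y =
    (f y - sigma_op h (2 ^+ m) f y) - (f y - sigma_op h (2 ^+ m.+1) f y) by ring.
  rewrite (le_trans (ler_normB _ _))// /dl -mulrA mulr2n mulrDl mul1r lerD//.
  by rewrite (le_trans h2)// ler_wpM2l.
have wg m : w m * (2 ^+ m) `^ (- gamma) = (2 ^+ m) `^ (- p).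
  rewrite /w -pow2E -powRD; last by apply/implyP => _; rewrite gt_eqF.
  by congr (_ `^ _); rewrite /p; ring.
pose G := (1 - 2 `^ (- p))^-1.
pose tau (n : nat) := 2 * K * (G * (2 ^+ n) `^ (- p)).
have tauP n k : (n <= k)%N -> \sum_(n <= m < k) w m * dl m <= tau n.
  move=> _; under eq_bigr do rewrite /dl mulrCA wg.
  by rewrite -mulr_sumr ler_wpM2l ?mulr_ge0// sum_powR_geom.
have tau_cvg : tau @ \oo --> (0 : R).
  have : (fun n : nat => (2 * K * G) * (2 `^ (- p)) ^+ n) @ \oo --> (2 * K * G) * 0.
    apply: cvgMr; apply: cvg_expr; rewrite ger0_norm ?powR_ge0//.
    by rewrite powRN invf_lt1 ?powR_gt0// /powR pnatr_eq0/= -[ltLHS]expR0 ltr_expR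
      mulr_gt0// ln_gt0// ltr1n.
  rewrite mulr0; suff -> : tau = (fun n : nat => (2 * K * G) * (2 `^ (- p)) ^+ n) by [].
  apply/funext => n; rewrite /tau mulrA; congr (_ * _).
  by rewrite -powR_mulrn// -powRrM mulrC powRrM powR_mulrn// powR_ge0.
pose rho := r `^ (q2 - S%:R).
have G0 : 0 <= G.
  have := @sum_powR_geom R p 0 0 p0; rewrite big_geq// expr0 powR1 mulr1.
  by [].
have rho0 : 0 <= rho by exact: powR_ge0.
exists (c * (K + F * rho + 2 * K * G)).
  apply: mulr_ge0; first exact: ltW.
  by apply: addr_ge0; [apply: addr_ge0 => //|]; do ?[exact: mulr_ge0|apply: mulr_ge0 => //].
move=> n x Bx.
have [E0 EE H] := Hlim r A f F dl tau x r0 cf fF dl0 dlP tauP tau_cvg (far x Bx).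
have -> : E f x = E0 by exact: cvg_lim.
have Kn0 : 0 <= K * (2 ^+ n) `^ (- gamma) by rewrite mulr_ge0 ?powR_ge0.
apply: (le_trans (H n _ Kn0 (fun y Ay => HK _ y (two1 n) Ay))).
rewrite -mulrA; apply: ler_wpM2l; first exact: ltW.
rewrite -/(w n) -/rho mulrCA wg /tau !mulrDl; apply: lerD; last by rewrite mulrA.
rewrite lerD2l -mulrA ler_wpM2l// mulrC ler_wpM2l// -pow2E; apply: ler_powR => //.
by rewrite /p; lra.
Qed.

Lemma joint_lift_continuous (p K : R) (B : set X1) f : 0 < p -> 0 <= K ->
  (forall n x, B x -> `|E f x - T (cs * 2 ^+ n) f x| <= K * (2 ^+ n) `^ (- p)) ->
  {within B, continuous (E f)}.
Proof.
move=> p0 K0 H; apply/subspace_continuousP => x Bx.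
apply/cvgrPdist_le => d d0.
have d3 : 0 < d / 3 by rewrite divr_gt0.
have d4 : 0 < d / 3 / (K + 1) by rewrite divr_gt0// ltr_wpDl.
have [n Hn] : exists n : nat, K * (2 ^+ n) `^ (- p) <= d / 3.
  have [M [_ HM]] := powR_small p0 d4.
  have [J HJ] := ex_dyadic (M + 1); exists J.
  have := HM (2 ^+ J) (lt_le_trans _ HJ); rewrite ltrDl => /(_ ltr01).
  rewrite ler_pdivlMr ?ltr_wpDl// => hh; apply: le_trans hh.
  by rewrite mulrC ler_wpM2l ?powR_ge0// lerDl.
have csn : 0 < cs * 2 ^+ n by rewrite mulr_gt0// exprn_gt0.
have cT := joint_sigma_continuous (f := f) csn.
have /cvgrPdist_le/(_ _ d3) := cT x.
rewrite /prop_near1 /= /within /=; rewrite near_simpl; apply: filterS => y Txy By.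
have -> : E f x - E f y = (E f x - T (cs * 2 ^+ n) f x) +
   (T (cs * 2 ^+ n) f x - T (cs * 2 ^+ n) f y) - (E f y - T (cs * 2 ^+ n) f y) by ring.
have -> : d = d / 3 + d / 3 + d / 3 by field.
rewrite (le_trans (ler_normB _ _))// lerD//; last exact: le_trans (H n y By) Hn.
by rewrite (le_trans (ler_normD _ _))// lerD// (le_trans (H n x Bx)).
Qed.

End smooth_lift.

Section product_lift.
Variables (R : realType) (X1 X2 : data_space R) (d12 : X1 -> X2 -> R)
  (Am L : nat -> nat -> R) (Q q1 q2 : R) (h : R -> R) (cs : R) (S : nat)
  (joint : joint_data_space d12 Am L Q q1 q2)
  (filt : lowpass_filter h)
  (cs_gt0 : 0 < cs)
  (preserve : polynomial_preservation X1 X2 h Am L cs)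
  (pou2 : has_partition_of_unity X2)
  (S_large : Num.max Q (Num.max q1 q2) + 1 < S%:R).

Notation T := (joint_sigma X1 X2 h Am L).
Notation E f := (joint_lift X1 X2 h Am L f).

Lemma joint_sigma_growth f : continuous f -> exists2 K : R, 0 <= K &
  forall (k : nat) x, `|T (cs * 2 ^+ k) f x| <= K * (2 ^+ k) `^ (Q - q2).
Proof.
move=> cf; have [C C0 HC] := joint_sigma_local joint filt S_large.
have [F F0 fF] := continuous_bounded cf.
exists (C * cs `^ (Q - q2) * F); first by rewrite !mulr_ge0 ?powR_ge0.
move=> k x; have k0 : 0 < 2 ^+ k :> R by rewrite exprn_gt0.
have := HC (cs * 2 ^+ k) 1 f x F 0 (mulr_gt0 cs_gt0 k0) ltr01
  (bounded_measurable_continuous cf) F0 (lexx _) (fun y => or_introl (fF y)).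
rewrite mulr0 addr0 powRM ?(ltW cs_gt0) ?(ltW k0)// => H; apply: (le_trans H).
by rewrite le_eqVlt; apply/orP; left; apply/eqP; ring.
Qed.

(* The approximant of [phi * E f] is [P * T f] for a near-best approximant [P]
   of [phi]: the growth of [T f] costs the exponent [Q - q2] only. *)
Lemma lift_product_smooth (alpha gamma K : R) (B : set X1) f phi :
  strong_product X1 -> 0 < alpha -> (forall j k, ds_lam X1 j <= alpha * L j k) ->
  0 < gamma -> Q - q2 < gamma -> continuous f -> 0 <= K ->
  (forall n x, B x ->
    `|E f x - T (cs * 2 ^+ n) f x| <= K * (2 ^+ n) `^ (- (gamma - Q + q2))) ->
  Cinfty_on X1 B phi ->
  smooth_class X1 (gamma - Q + q2) (patch (fun=> 0) B (phi \* E f)).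
Proof.
move=> [As As1 prod] a0 aL g0 gQ cf K0 HK [phiC phiB]; set p := gamma - Q + q2.
have p0 : 0 < p by rewrite /p; lra.
have [G G0 HG] := joint_sigma_growth cf.
have [N N0 phiN] := continuous_bounded (Cinfty_continuous phiC).
have [H H0 HH] := smooth_class_approx g0 (phiC gamma g0).
pose beta := Num.max 1 (alpha * cs).
have beta1 : 1 <= beta by rewrite le_max lexx.
have beta0 : 0 < beta := lt_le_trans ltr01 beta1.
have twop k : 0 < 2 ^+ k :> R by rewrite exprn_gt0.
(* [phi] vanishes outside B, so the value of [lim] there, where convergence is not known, is
   harmless. *)
have patchE x : patch (fun=> 0) B (phi \* E f) x = phi x * E f x.
  by rewrite patchE; case: ifPn => //; rewrite notin_setE => /phiB ->; rewrite mul0r.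
apply: (@smooth_class_intro R X1 _ p (As * beta) (N * K + G * H) (N * (K + G))).
- exact: p0.
- exact: mulr_ege1.
- by apply: addr_ge0; apply: mulr_ge0.
- by apply: mulr_ge0 => //; apply: addr_ge0.
- move=> x; rewrite patchE normrM.
  have [Bx|nBx] := pselect (B x); last first.
    by rewrite phiB// normr0 mul0r mulr_ge0// addr_ge0.
  apply: ler_pM => //.
  have -> : E f x = (E f x - T (cs * 2 ^+ 0) f x) + T (cs * 2 ^+ 0) f x by ring.
  apply: (le_trans (ler_normD _ _)); apply: lerD.
    by have := HK 0%N x Bx; rewrite expr0 powR1 !mulr1.
  by have := HG 0%N x; rewrite expr0 powR1 !mulr1.
move=> k; have [P dP phiP] := HH _ (twop k).
have TP : diffpoly X1 (beta * 2 ^+ k) (T (cs * 2 ^+ k) f).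
  have := joint_sigma_diffpoly f joint filt a0 aL (mulr_gt0 cs_gt0 (twop k)).
  by apply: diffpoly_mono; rewrite mulrA ler_wpM2r ?(ltW (twop k))// le_max lexx orbT.
exists (P \* T (cs * 2 ^+ k) f).
  rewrite -mulrA; apply: prod => //; first exact: mulr_gt0.
  by apply: diffpoly_mono dP; rewrite ler_peMl// ltW.
move=> x; rewrite patchE /=; set t := T _ f x.
(* The lift is compared with [t] only where [phi] is nonzero, hence in B. The second product must be
   bounded on all of X1, since [P] does not vanish outside B; [joint_sigma_growth] holds
   everywhere. *)
have -> : phi x * E f x - P x * t = phi x * (E f x - t) + t * (phi x - P x) by ring.
rewrite (le_trans (ler_normD _ _))// !normrM mulrDl; apply: lerD.
  have [Bx|nBx] := pselect (B x); last first.
    by rewrite phiB// normr0 mul0r !mulr_ge0 ?powR_ge0.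
  by rewrite -mulrA; apply: ler_pM => //; exact: HK.
apply: (le_trans (ler_pM _ _ (HG k x) (phiP x))) => //.
rewrite mulrACA -powRD; last by apply/implyP => _; rewrite gt_eqF.
by rewrite /p; have -> : Q - q2 - gamma = - (gamma - Q + q2) by ring.
Qed.

End product_lift.

Theorem theorem3 (R : realType) (X1 X2 : data_space R) (d12 : X1 -> X2 -> R)
  (Am L : nat -> nat -> R) (Q q1 q2 : R) (h : R -> R) (cs : R) (S : nat)
  (joint : joint_data_space d12 Am L Q q1 q2)
  (filt : lowpass_filter h)
  (cs_gt0 : 0 < cs)
  (preserve : polynomial_preservation X1 X2 h Am L cs)
  (pou2 : has_partition_of_unity X2)
  (S_large : Num.max Q (Num.max q1 q2) + 1 < S%:R) :
  exists2 c : R, 0 < c &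
  forall (r s : R) (A : set X2) (Bm : set X1),
  0 < r -> 0 < s -> compact A -> compact Bm -> Bm !=set0 ->
  Bm `<=` [set x1 | ((s + r)%:E <= dist_to d12 x1 (~` A))%E] ->
  let B : set X1 := [set x1 | (dist_to (@mdist R X1) x1 Bm <= s%:E)%E] in
  forall f : X2 -> R, continuous f ->
  (\sum_(0 <= m <oo)
     ((2 `^ (m%:R * (Q - q2)))%:E
      * supnorm A (sigma_op h (2 ^+ m.+1) f \- sigma_op h (2 ^+ m) f)) < +oo)%E ->
  [/\ (forall x1, B x1 -> cvg (joint_sigma X1 X2 h Am L n f x1 @[n --> +oo%R])),
      (forall n : nat, 1 <= cs * r * 2 ^+ n ->
         (supnorm B (joint_lift X1 X2 h Am L f
                     \- joint_sigma X1 X2 h Am L (cs * 2 ^+ n) f)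
          <= c%:E * (
             (2 `^ (n%:R * (Q - q2)))%:E
               * supnorm A (f \- sigma_op h (2 ^+ n) f)
             + supnorm setT f
               * (2 `^ (n%:R * (Q - S%:R)) * r `^ (q2 - S%:R))%:E
             + \sum_(n <= m <oo)
                 ((2 `^ (m%:R * (Q - q2)))%:E
                  * supnorm A (sigma_op h (2 ^+ m.+1) f
                               \- sigma_op h (2 ^+ m) f))))%E) &
      forall alpha : R,
        strong_product X1 -> has_partition_of_unity X1 -> 0 < alpha ->
        (forall j k, ds_lam X1 j <= alpha * L j k) ->
        (forall n : R, 0 < n ->
           diffpoly X1 (alpha * n) (joint_sigma X1 X2 h Am L n f)) /\
        (forall gamma : R, 0 < gamma -> Q - q2 < gamma -> gamma < S%:R - q2 ->
           smooth_class_on X2 gamma A f ->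
           {within B, continuous (joint_lift X1 X2 h Am L f)} /\
           (forall phi : X1 -> R, Cinfty_on X1 B phi ->
              smooth_class X1 (gamma - Q + q2)
                (patch (fun=> 0) B (phi \* joint_lift X1 X2 h Am L f))))].
Proof.
have [c c0 Hlim] := joint_limit joint filt cs_gt0 preserve pou2 S_large.
exists c => // r s A Bm r0 s0 cA _ _ BmA B f cf sumf.
have [d12J _ _ _ _] := joint.
have far : forall x, B x -> forall y, ~ A y -> r <= d12 x y.
  exact: far_from_complement d12J BmA.
have [F0 F0_ge0 fF0] := continuous_bounded cf.
(* [F0] serves to show that the supremum norm is finite; the estimates then use the norm itself, as
   the conclusion is stated with it. *)
have [FE F_ge0 fF] := supnorm_fin F0_ge0 (fun x (_ : setT x) => fF0 x).
set F := fine _ in FE F_ge0 fF.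
pose P m := sigma_op h (2 ^+ m) f.
have cP m : continuous (P m).
  exact: diffpoly_continuous (sigma_op_diffpoly _ _ _).
pose dl m := fine (supnorm A (P m.+1 \- P m)).
have dlE m : [/\ supnorm A (P m.+1 \- P m) = (dl m)%:E, 0 <= dl m &
    forall y, A y -> `|(P m.+1 \- P m) y| <= dl m].
  have [b1 b10 Hb1] := continuous_bounded (@cP m.+1).
  have [b b0 Hb] := continuous_bounded (@cP m).
  apply: (supnorm_fin (B := b1 + b)); first exact: addr_ge0.
  by move=> y _ /=; rewrite (le_trans (ler_normB _ _))// lerD.
pose w (m : nat) : R := 2 `^ (m%:R * (Q - q2)).
have w0 m : 0 <= w m by exact: powR_ge0.
have termE m : ((2 `^ (m%:R * (Q - q2)))%:E
      * supnorm A (sigma_op h (2 ^+ m.+1) f \- sigma_op h (2 ^+ m) f))%E = (w m * dl m)%:E.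
  by have [e _ _] := dlE m; rewrite EFinM -e.
have wdl0 m : 0 <= w m * dl m by have [_ d0 _] := dlE m; exact: mulr_ge0.
rewrite (eq_eseriesr (fun m _ => termE m)) in sumf.
have [tau [tauE tauP tau_cvg]] := summable_tails wdl0 sumf.
have lim_at x : B x -> _ := fun Bx => Hlim r A f F dl tau x r0 cf
  (fun y => fF y I) (fun m => let: And3 _ d _ := dlE m in d)
  (fun m => let: And3 _ _ d := dlE m in d) tauP tau_cvg (far x Bx).
split.
- by move=> x /lim_at[E0 EE _]; apply/cvg_ex; exists E0.
- move=> n _.
  have [b b0 Hb] := continuous_bounded (@cP n).
  have fb y : A y -> `|(f \- P n) y| <= F0 + b.
    by move=> _ /=; rewrite (le_trans (ler_normB _ _))// lerD.
  have [aE a_ge0 fa] := supnorm_fin (addr_ge0 F0_ge0 b0) fb.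
  rewrite (eq_eseriesr (fun m _ => termE m)) tauE aE FE -!EFinM.
  apply: supnorm_le => [|x Bx].
    have tau0 : 0 <= tau n by have := tauP n n (leqnn n); rewrite big_geq.
    by rewrite lee_fin mulr_ge0 ?(ltW c0)// !addr_ge0 ?mulr_ge0 ?powR_ge0.
  have [E0 EE HE] := lim_at x Bx.
  have jE : joint_lift X1 X2 h Am L f x = E0 by exact: cvg_lim.
  by rewrite lee_fin /= jE; exact: HE n _ a_ge0 fa.
- move=> alpha prod _ a0 aL; split; first by move=> n n0; exact: joint_sigma_diffpoly joint _ _ _ _.
  move=> gamma g0 gQ gS sf.
  have [K K0 HK] := joint_lift_rate joint filt cs_gt0 preserve pou2 S_large g0 gQ gS r0 cA far cf sf.
  split; last first.
    move=> phi phiB.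
    exact: (lift_product_smooth joint filt cs_gt0 S_large prod a0 aL g0 gQ cf K0 HK).
  by apply: (joint_lift_continuous joint filt cs_gt0 _ K0 HK); lra.
Qed.
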